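(* Let $N\ge1$ be an integer, $c\in\mathbb{C}\setminus\{0\}$, $a_1,\dots,a_N\in\mathbb{C}$ with $|a_k|\ge1$, and $s_1,\dots,s_N$ real numbers with $s_k\ge1$. Let $$f(z)=c\prod_{k=1}^N(z-a_k)^{s_k},$$ and suppose that $s_k\in\mathbb{N}$ whenever $|a_k|>1$. Then $$\|f'\|_{\mathbb{T}}\le\frac{\sum_{k=1}^Ns_k}{2}\,\|f\|_{\mathbb{T}},$$ with equality if and only if $|a_k|=1$ for all $k$.
   Context: $\mathbb{T}$ is the unit circle and $\|g\|_{\mathbb{T}}=\sup_{z\in\mathbb{T}}|g(z)|$. The branches in the definition of $f$ are chosen so that $f$ is analytic in the open unit disk $\mathbb{D}$; then $f$ and $f'$ extend continuously to $\overline{\mathbb{D}}$, and the norms on $\mathbb{T}$ are those of these extensions. *)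

(* Defs.v *)
(* Stdlib real numbers with Coquelicot's complex numbers [C]. *)
From Stdlib Require Import Reals.
From Coquelicot Require Import Coquelicot.
Open Scope R_scope.

Definition Cexp (z : C) : C :=
  (exp (Re z) * cos (Im z), exp (Re z) * sin (Im z)).

(* [v] is one of the values of the multivalued power [w ^ s]: [exp (s * l)]
   for some logarithm [l] of [w]. *)
Definition is_power_value (w : C) (s : R) (v : C) : Prop :=
  exists l : C, Cexp l = w /\ v = Cexp (RtoC s * l)%C.

(* Multiplicative analogue of [sum_n_m]: u n * u (n+1) * ... * u m. *)
Definition prod_n_m (u : nat -> C) (n m : nat) : C :=
  Iter.iter_nat Cmult (RtoC 1) u n m.

(* Complex differentiability at every point of the open unit disk. *)
Definition analytic_on_disk (f : C -> C) : Prop :=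
  forall z : C, Cmod z < 1 -> @ex_derive C_AbsRing C_NormedModule f z.

(* On the open unit disk, [f z] is c * prod_{k=1}^N (z - a_k)^{s_k} for some
   determination of the powers, chosen point by point.  The values of [f] off
   the disk are irrelevant.  When all |a_k| >= 1, analyticity makes the choice
   consistent, hence fixes [f] on the disk up to a constant of modulus 1. *)
Definition is_analytic_power_product
    (N : nat) (c : C) (a : nat -> C) (s : nat -> R) (f : C -> C) : Prop :=
  analytic_on_disk f /\
  forall z : C, Cmod z < 1 ->
    exists v : nat -> C,
      (forall k : nat, (1 <= k <= N)%nat ->
         is_power_value (z - a k)%C (s k) (v k)) /\
      f z = (c * prod_n_m v 1 N)%C.

(* Value at [z] of the continuous extension of [g] from the open unit disk to
   the closed one, i.e. the limit of [g w] as [w] tends to [z] inside the open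
   disk.  [lim] is total: the value is meaningful when this limit exists. *)
Definition disk_ext (g : C -> C) (z : C) : C :=
  @lim C_CompleteNormedModule
    (filtermap g (within (fun w : C => Cmod w < 1) (locally z))).

(* Supremum over the unit circle of the modulus of the extension of [g];
   [real] drops the [Rbar] wrapper of a supremum that is finite whenever the
   extension is continuous. *)
Definition circle_norm (g : C -> C) : R :=
  real (Lub_Rbar (fun r : R =>
    exists z : C, Cmod z = 1 /\ r = Cmod (disk_ext g z))).

(* Main.v *)
Require Import Defs.
From Stdlib Require Import Reals Lra Lia Psatz Classical.
From Stdlib Require Import FunctionalExtensionality IndefiniteDescription.
From Coquelicot Require Import Coquelicot.
Open Scope R_scope.

(* Write [n = sum s_k], [q = z f' / f] and [M = ||f||].  On the circle
   [Re q <= n / 2], so [|f'| <= |n f - z f'|], and everything follows from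
   [|f'| + |n f - z f'| <= n M].  With [z = e^(i t)] and [A = e^(- i n t / 2) f],
   this says that for the functions
   [H = A (1 + beta) / 2],
   [beta = omega * prod_(|a_k| > 1) ((z - 1 / conj a_k) / (1 - z / a_k))^s_k],
   [|omega| = 1], one has [|H'|^2 + (n / 2)^2 |H|^2 <= (n / 2)^2 M^2] on the real axis.
   [H] has no zeros in the upper half plane, and on the real axis its argument is a step
   function whose values are at least [PI] apart; this is where [s_k >= 1] is used.
   Let [K = H^2 / M^2].  For a single-valued [K] the confocal sum [|K| + |K - 1|] is
   [cosh] of twice the harmonic function [log |H/M + sqrt (H^2/M^2 - 1)|], to be compared
   with [cosh (n y)].  Here [1] has to be replaced by the phase [e^(i th)], [th] among the
   boundary arguments of [K], which is nearest to the argument of [K], and by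
   [- K / |K|] when no such phase is within [PI]; the resulting function equals [1] on the axis, and by the spacing
   of the phases every point has a branch touching it from below, so the maximum
   principle still applies and gives the bound [cosh (n y)].  Its second-order behaviour
   at the axis is the inequality for [H].

   Strictness: if [|a_k| > 1] for some [k], then [|f'| < |n f - z f'|] wherever [f <> 0].
   At a zero [z1] of [f] on the circle, moving [a_k] to a suitable point of the circle
   would increase [|f'(z1)| / ||f||]. *)

(** * Directional calculus for curves in the complex plane *)

(** With [H = M cos w], the confocal sum of [K] is [|cos w|^2 + |sin w|^2 = cosh (2 Im w)]. It needs
    neither [w] nor a square root, so the harmonic function is never formed: the sum is compared
    directly with [cosh] of a barrier. [beta] comes from reflection. For zeros off the circle,
    multiplication by the Blaschke product turns [A] into its conjugate on the axis, up to a
    unimodular constant, so [A (1 + beta)] has constant phase modulo [PI] there. The Blaschke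
    product vanishes inside the disk, so integer exponents keep it single valued. A factor with its
    zero on the circle has constant argument on each arc without any reflection, but this argument
    jumps by [s_k PI] at the zero. So on different arcs [K] runs along different segments issuing
    from [0], and no single second focus serves them all; hence the gluing. The free constant
    [omega] turns the bound for one modulus into a bound for a sum: with [v] the value of [beta] at
    the point and [q = z f' / f], the inequality for [H] reads [|f| |q + v (n - conj q)| <= n M],
    and [v] can be chosen to align the two terms. *)

Lemma is_derive_value (f : R -> R) (x a b : R) :
  is_derive f x a -> a = b -> is_derive f x b.
Proof. now intros H <-. Qed.

(** Coordinatewise, so that [auto_derive] does the calculus on pairs of real functions. *)
Definition curve_derive (g : R -> C) (x : R) (v : C) : Prop :=
  is_derive (fun y => fst (g y)) x (fst v) /\
  is_derive (fun y => snd (g y)) x (snd v).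

Lemma curve_derive_value (g : R -> C) (x : R) (v w : C) :
  curve_derive g x v -> v = w -> curve_derive g x w.
Proof. now intros H <-. Qed.

Lemma curve_derive_ext_loc (g h : R -> C) (x : R) (v : C) :
  locally x (fun y => g y = h y) -> curve_derive g x v -> curve_derive h x v.
Proof.
  intros E [H1 H2]; split; eapply is_derive_ext_loc; eauto;
    apply (filter_imp _ _) with (2 := E); intros y ->; reflexivity.
Qed.

Lemma curve_derive_ext (g h : R -> C) (x : R) (v : C) :
  (forall y, g y = h y) -> curve_derive g x v -> curve_derive h x v.
Proof.
  intros E; apply curve_derive_ext_loc; now apply filter_forall.
Qed.

Lemma curve_pair (g : R -> C) : exists a b : R -> R, g = fun y => (a y, b y).
Proof.
  exists (fun y => fst (g y)), (fun y => snd (g y)).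
  apply functional_extensionality; intros y; apply surjective_pairing.
Qed.

Lemma curve_derive_const (c : C) (x : R) : curve_derive (fun _ => c) x 0%C.
Proof. split; apply (is_derive_const (K := R_AbsRing) (V := R_NormedModule)). Qed.

Lemma curve_derive_plus (g h : R -> C) (x : R) (v w : C) :
  curve_derive g x v -> curve_derive h x w ->
  curve_derive (fun y => g y + h y)%C x (v + w)%C.
Proof.
  destruct (curve_pair g) as (a & b & ->), (curve_pair h) as (c & d & ->).
  intros [A1 A2] [B1 B2]; simpl in *; split; simpl; auto_derive;
    try (repeat split; eexists; eassumption).
  - rewrite (is_derive_unique _ _ _ A1), (is_derive_unique _ _ _ B1); ring.
  - rewrite (is_derive_unique _ _ _ A2), (is_derive_unique _ _ _ B2); ring.
Qed.

Lemma curve_derive_opp (g : R -> C) (x : R) (v : C) :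
  curve_derive g x v -> curve_derive (fun y => - g y)%C x (- v)%C.
Proof.
  destruct (curve_pair g) as (a & b & ->).
  intros [A1 A2]; simpl in *; split; simpl; auto_derive;
    try (repeat split; eexists; eassumption).
  - rewrite (is_derive_unique _ _ _ A1); ring.
  - rewrite (is_derive_unique _ _ _ A2); ring.
Qed.

Lemma curve_derive_mult (g h : R -> C) (x : R) (v w : C) :
  curve_derive g x v -> curve_derive h x w ->
  curve_derive (fun y => g y * h y)%C x (v * h x + g x * w)%C.
Proof.
  destruct (curve_pair g) as (a & b & ->), (curve_pair h) as (c & d & ->).
  intros [A1 A2] [B1 B2]; simpl in *; split; simpl; auto_derive;
    try (repeat split; eexists; eassumption);
    rewrite (is_derive_unique _ _ _ A1), (is_derive_unique _ _ _ B1),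
      (is_derive_unique _ _ _ A2), (is_derive_unique _ _ _ B2); ring.
Qed.

Lemma curve_derive_inv (g : R -> C) (x : R) (v : C) :
  curve_derive g x v -> g x <> 0%C ->
  curve_derive (fun y => / g y)%C x (- v / (g x * g x))%C.
Proof.
  destruct (curve_pair g) as (a & b & ->).
  intros [A1 A2] H; simpl in *.
  assert (P : a x * a x + b x * b x <> 0).
  { intros E; apply H. assert (a x = 0) by nra. assert (b x = 0) by nra.
    now apply injective_projections. }
  split; unfold Cinv; simpl.
  - auto_derive.
    + repeat split; try (eexists; eassumption). now rewrite !Rmult_1_r.
    + rewrite (is_derive_unique _ _ _ A1), (is_derive_unique _ _ _ A2).
      field. split; [contradict P; nra|].
      intros E; apply P. nra.
  - auto_derive.
    + repeat split; try (eexists; eassumption). now rewrite !Rmult_1_r.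
    + rewrite (is_derive_unique _ _ _ A1), (is_derive_unique _ _ _ A2).
      field. split; [contradict P; nra|].
      intros E; apply P. nra.
Qed.

Lemma curve_derive_exp (g : R -> C) (x : R) (v : C) :
  curve_derive g x v -> curve_derive (fun y => Cexp (g y)) x (v * Cexp (g x))%C.
Proof.
  destruct (curve_pair g) as (a & b & ->).
  intros [A1 A2]; simpl in *; split; simpl; unfold Re, Im; simpl; auto_derive;
    try (repeat split; eexists; eassumption);
    rewrite (is_derive_unique _ _ _ A1), (is_derive_unique _ _ _ A2); ring.
Qed.

(* The principal logarithm, meaningful on the open right half plane only. *)
Definition Clog (w : C) : C :=
  (ln (fst w * fst w + snd w * snd w) / 2, atan (snd w / fst w)).

Lemma curve_derive_log (g : R -> C) (x : R) (v : C) :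
  curve_derive g x v -> 0 < fst (g x) ->
  curve_derive (fun y => Clog (g y)) x (v / g x)%C.
Proof.
  destruct (curve_pair g) as (a & b & ->).
  intros [A1 A2] H; simpl in *.
  assert (P : 0 < a x * a x + b x * b x) by nra.
  split; simpl; auto_derive;
    try (repeat split; try (eexists; eassumption); lra);
    rewrite (is_derive_unique _ _ _ A1), (is_derive_unique _ _ _ A2).
  - field. lra.
  - field. repeat split; try lra; nra.
Qed.

Lemma curve_derive_line (t e : C) (x : R) :
  curve_derive (fun y => t + RtoC y * e)%C x e.
Proof.
  split; simpl; auto_derive; trivial; ring.
Qed.

Lemma curve_derive_shift (g : R -> C) (x : R) (v : C) :
  curve_derive (fun y => g (x + y)) 0 v -> curve_derive g x v.
Proof.
  intros [A1 A2]; split.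
  - apply is_derive_ext with (fun y => fst (g (x + (y - x)))).
    { intros y; do 2 f_equal; ring. }
    replace (fst v) with (1 * fst v) by ring.
    apply (is_derive_comp (fun y => fst (g (x + y))) (fun y => y - x)).
    + now replace (x - x) with 0 by ring.
    + auto_derive; trivial; ring.
  - apply is_derive_ext with (fun y => snd (g (x + (y - x)))).
    { intros y; do 2 f_equal; ring. }
    replace (snd v) with (1 * snd v) by ring.
    apply (is_derive_comp (fun y => snd (g (x + y))) (fun y => y - x)).
    + now replace (x - x) with 0 by ring.
    + auto_derive; trivial; ring.
Qed.

Lemma curve_derive_continuous (g : R -> C) (x : R) (v : C) :
  curve_derive g x v -> filterlim g (locally x) (locally (g x)).
Proof.
  intros [A1 A2].
  apply filterlim_locally; intros eps.
  assert (B1 := proj1 (filterlim_locally _ _) (ex_derive_continuous _ _ (ex_intro _ _ A1)) eps).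
  assert (B2 := proj1 (filterlim_locally _ _) (ex_derive_continuous _ _ (ex_intro _ _ A2)) eps).
  generalize (filter_and _ _ B1 B2); apply filter_imp; intros y [H1 H2]; now split.
Qed.

(* Directional derivatives agreeing with one complex number in every direction:
   this is all that is used of complex differentiability. *)
Definition hol_derive (f : C -> C) (t v : C) : Prop :=
  forall e : C, curve_derive (fun x => f (t + RtoC x * e)%C) 0 (e * v)%C.

Lemma line_at_0 (t e : C) : (t + RtoC 0 * e)%C = t.
Proof. ring. Qed.

Lemma hol_derive_value (f : C -> C) (t v w : C) :
  hol_derive f t v -> v = w -> hol_derive f t w.
Proof. now intros H <-. Qed.

Lemma hol_derive_ext (f g : C -> C) (t v : C) :
  (forall z, f z = g z) -> hol_derive f t v -> hol_derive g t v.
Proof. intros E H e; eapply curve_derive_ext, H; intros y; apply E. Qed.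

Lemma hol_derive_const (c t : C) : hol_derive (fun _ => c) t 0%C.
Proof.
  intros e; eapply curve_derive_value; [apply curve_derive_const|ring].
Qed.

Lemma hol_derive_id (t : C) : hol_derive (fun z => z) t 1%C.
Proof.
  intros e; eapply curve_derive_value; [apply curve_derive_line|ring].
Qed.

Lemma hol_derive_plus (f g : C -> C) (t v w : C) :
  hol_derive f t v -> hol_derive g t w ->
  hol_derive (fun z => f z + g z)%C t (v + w)%C.
Proof.
  intros A B e; eapply curve_derive_value.
  - apply curve_derive_plus; [apply A|apply B].
  - ring.
Qed.

Lemma hol_derive_opp (f : C -> C) (t v : C) :
  hol_derive f t v -> hol_derive (fun z => - f z)%C t (- v)%C.
Proof.
  intros A e; eapply curve_derive_value.
  - apply curve_derive_opp, A.
  - ring.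
Qed.

Lemma hol_derive_mult (f g : C -> C) (t v w : C) :
  hol_derive f t v -> hol_derive g t w ->
  hol_derive (fun z => f z * g z)%C t (v * g t + f t * w)%C.
Proof.
  intros A B e; eapply curve_derive_value.
  - apply curve_derive_mult; [apply A|apply B].
  - cbv beta; rewrite line_at_0; ring.
Qed.

Lemma hol_derive_inv (f : C -> C) (t v : C) :
  hol_derive f t v -> f t <> 0%C ->
  hol_derive (fun z => / f z)%C t (- v / (f t * f t))%C.
Proof.
  intros A H e; eapply curve_derive_value.
  - apply curve_derive_inv; [apply A|cbv beta; now rewrite line_at_0].
  - cbv beta; rewrite line_at_0; field; trivial.
Qed.

Lemma hol_derive_exp (f : C -> C) (t v : C) :
  hol_derive f t v -> hol_derive (fun z => Cexp (f z)) t (v * Cexp (f t))%C.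
Proof.
  intros A e; eapply curve_derive_value.
  - apply curve_derive_exp, A.
  - cbv beta; rewrite line_at_0; ring.
Qed.

Lemma hol_derive_log (f : C -> C) (t v : C) :
  hol_derive f t v -> 0 < fst (f t) ->
  hol_derive (fun z => Clog (f z)) t (v / f t)%C.
Proof.
  intros A H e; eapply curve_derive_value.
  - apply curve_derive_log; [apply A|cbv beta; now rewrite line_at_0].
  - cbv beta; rewrite line_at_0; field. intros E; rewrite E in H; simpl in H; lra.
Qed.

Lemma hol_derive_pow (f : C -> C) (t v : C) (m : nat) :
  hol_derive f t v ->
  hol_derive (fun z => f z ^ m)%C t (RtoC (INR m) * f t ^ pred m * v)%C.
Proof.
  intros A; induction m as [|m IH].
  - eapply hol_derive_value; [apply (hol_derive_const 1)|simpl; ring].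
  - apply hol_derive_ext with (fun z => f z * f z ^ m)%C.
    { intros z; now rewrite Cpow_S. }
    eapply hol_derive_value; [apply hol_derive_mult; eassumption|].
    rewrite S_INR, RtoC_plus. destruct m as [|m]; simpl; ring.
Qed.

Lemma hol_derive_line (f f1 : C -> C) (t e : C) (x : R) :
  hol_derive f (t + RtoC x * e)%C (f1 (t + RtoC x * e)%C) ->
  curve_derive (fun y => f (t + RtoC y * e)%C) x (e * f1 (t + RtoC x * e))%C.
Proof.
  intros H; apply curve_derive_shift.
  eapply curve_derive_ext, H.
  intros y; simpl; f_equal; rewrite RtoC_plus; ring.
Qed.

Lemma ball_Rabs_lt (x y e : R) : ball x e y -> Rabs (y - x) < e.
Proof. exact (fun H => H). Qed.

Lemma Rabs_lt_ball (x y e : R) : Rabs (y - x) < e -> ball x e y.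
Proof. exact (fun H => H). Qed.

Lemma filterlim_C {T : Type} (F : (T -> Prop) -> Prop) {FF : Filter F} (f : T -> C) (l : C) :
  filterlim f F (locally l) <->
  filterlim (fun x => fst (f x)) F (locally (fst l)) /\
  filterlim (fun x => snd (f x)) F (locally (snd l)).
Proof.
  split.
  - intros H; split; apply filterlim_locally; intros eps;
      generalize (proj1 (filterlim_locally _ _) H eps); apply filter_imp; intros x [A B]; assumption.
  - intros [A B]. apply filterlim_locally; intros eps.
    generalize (filter_and _ _ (proj1 (filterlim_locally _ _) A eps) (proj1 (filterlim_locally _ _) B eps)).
    apply filter_imp; intros x [X Y]; now split.
Qed.

Lemma filterlim_Rmult {T : Type} (F : (T -> Prop) -> Prop) {FF : Filter F} (f g : T -> R) (a b : R) :
  filterlim f F (locally a) -> filterlim g F (locally b) ->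
  filterlim (fun x => f x * g x) F (locally (a * b)).
Proof.
  intros A B. apply (filterlim_comp_2 f g Rmult A B (filterlim_mult (K := R_AbsRing) a b)).
Qed.

Lemma filterlim_Rplus {T : Type} (F : (T -> Prop) -> Prop) {FF : Filter F} (f g : T -> R) (a b : R) :
  filterlim f F (locally a) -> filterlim g F (locally b) ->
  filterlim (fun x => f x + g x) F (locally (a + b)).
Proof.
  intros A B. apply (filterlim_comp_2 f g Rplus A B (filterlim_plus (V := R_NormedModule) a b)).
Qed.

Lemma filterlim_R_comp {T : Type} (F : (T -> Prop) -> Prop) (f : T -> R) (g : R -> R) (a : R) :
  filterlim f F (locally a) -> ex_derive g a ->
  filterlim (fun x => g (f x)) F (locally (g a)).
Proof.
  intros A B. eapply filterlim_comp; [exact A|]. exact (ex_derive_continuous g a B).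
Qed.

(** * Second-order comparison at a point *)

(** If [g2 > 0], then [g1] is positive just to the right of 0, and the mean value theorem makes [g]
    exceed [g 0] there. *)
Lemma local_max_test (g g1 : R -> R) (g2 : R) :
  locally 0 (fun x => is_derive g x (g1 x)) -> is_derive g1 0 g2 ->
  locally 0 (fun x => g x <= g 0) -> g1 0 = 0 /\ g2 <= 0.
Proof.
  intros [d1 D] D2 [d2 M].
  assert (dp1 := cond_pos d1). assert (dp2 := cond_pos d2).
  assert (Z : g1 0 = 0).
  { assert (D0 : is_derive g 0 (g1 0)) by (apply D, ball_center).
    apply is_derive_Reals in D0.
    change (g1 0) with (derive_pt g 0 (exist _ (g1 0) D0)).
    apply (deriv_maximum g (- d2) d2 0); [lra|lra|].
    intros x A B. apply M, Rabs_lt_ball. rewrite Rminus_0_r. apply Rabs_lt_between; lra. }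
  split; [exact Z|].
  destruct (Rle_or_lt g2 0) as [L|L]; [exact L|exfalso].
  apply is_derive_Reals in D2.
  destruct (D2 (g2 / 2)) as [d Hd]; [lra|].
  assert (dp := cond_pos d).
  set (h := Rmin d (Rmin d1 d2) / 2).
  assert (h0 : 0 < h) by (unfold h; repeat apply Rmin_case; lra).
  assert (h1 : h < d) by (unfold h; pose proof (Rmin_l d (Rmin d1 d2)); lra).
  assert (h2 : h < d1).
  { unfold h; pose proof (Rmin_r d (Rmin d1 d2)); pose proof (Rmin_l d1 d2); lra. }
  assert (h3 : h < d2).
  { unfold h; pose proof (Rmin_r d (Rmin d1 d2)); pose proof (Rmin_r d1 d2); lra. }
  destruct (MVT_cor2 g g1 0 h h0) as (c & Ec & Hc).
  { intros c Hc. apply is_derive_Reals, D, Rabs_lt_ball. rewrite Rabs_right; lra. }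
  assert (A : g h <= g 0).
  { apply M, Rabs_lt_ball. rewrite Rabs_right; lra. }
  assert (c0 : c <> 0) by lra.
  assert (Q := Hd c c0). rewrite Rabs_right in Q by lra.
  assert (Q1 := Q ltac:(lra)). rewrite Rplus_0_l, Z, Rminus_0_r in Q1.
  assert (P : 0 < g1 c).
  { replace (g1 c) with (g1 c / c * c) by (field; lra).
    apply Rmult_lt_0_compat; [|lra].
    revert Q1; unfold Rabs; destruct Rcase_abs; lra. }
  nra.
Qed.

Definition Cdot (u v : C) : R := fst u * fst v + snd u * snd v.

Lemma Cmod_sqr (z : C) : Cmod z * Cmod z = Cdot z z.
Proof.
  unfold Cmod, Cdot. rewrite sqrt_sqrt; [ring|nra].
Qed.

Lemma Cmod_Cexp (z : C) : Cmod (Cexp z) = exp (fst z).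
Proof.
  unfold Cmod, Cexp, Re, Im; simpl.
  assert (E := sin2_cos2 (snd z)). unfold Rsqr in E.
  transitivity (sqrt (exp (fst z) * exp (fst z))).
  - f_equal. transitivity (exp (fst z) * exp (fst z) *
      (sin (snd z) * sin (snd z) + cos (snd z) * cos (snd z))); [ring|rewrite E; ring].
  - apply sqrt_square; left; apply exp_pos.
Qed.

Lemma Cexp_neq_0 (z : C) : Cexp z <> 0%C.
Proof.
  intros H. assert (E := Cmod_Cexp z). rewrite H, Cmod_0 in E.
  assert (X := exp_pos (fst z)). lra.
Qed.

Lemma is_derive_Cmod (g : R -> C) (x : R) (v : C) :
  curve_derive g x v -> g x <> 0%C ->
  is_derive (fun y => Cmod (g y)) x (Cdot (g x) v / Cmod (g x)).
Proof.
  destruct (curve_pair g) as (a & b & ->); intros [A1 A2] H; simpl in *.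
  apply Cmod_gt_0 in H. unfold Cmod, Cdot in *; simpl in *.
  assert (P : 0 < a x * (a x * 1) + b x * (b x * 1)).
  { destruct (Rle_or_lt (a x * (a x * 1) + b x * (b x * 1)) 0) as [L|L]; [|exact L].
    rewrite sqrt_neg_0 in H by exact L; lra. }
  auto_derive.
  - repeat split; try (eexists; eassumption). lra.
  - rewrite (is_derive_unique _ _ _ A1), (is_derive_unique _ _ _ A2). field. lra.
Qed.

Lemma is_derive_Cdot (g h : R -> C) (x : R) (v w : C) :
  curve_derive g x v -> curve_derive h x w ->
  is_derive (fun y => Cdot (g y) (h y)) x (Cdot v (h x) + Cdot (g x) w).
Proof.
  destruct (curve_pair g) as (a & b & ->), (curve_pair h) as (c & d & ->).
  intros [A1 A2] [B1 B2]; unfold Cdot; simpl in *; auto_derive;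
    try (repeat split; eexists; eassumption);
    rewrite (is_derive_unique _ _ _ A1), (is_derive_unique _ _ _ B1),
      (is_derive_unique _ _ _ A2), (is_derive_unique _ _ _ B2); ring.
Qed.

Lemma is_derive_Cmod_2 (g g1 : R -> C) (x : R) (v : C) :
  curve_derive g x (g1 x) -> curve_derive g1 x v -> g x <> 0%C ->
  is_derive (fun y => Cdot (g y) (g1 y) / Cmod (g y)) x
    ((Cdot (g1 x) (g1 x) + Cdot (g x) v) / Cmod (g x)
     - Cdot (g x) (g1 x) * Cdot (g x) (g1 x) / (Cmod (g x) * Cmod (g x) * Cmod (g x))).
Proof.
  intros A B H.
  assert (P := proj1 (Cmod_gt_0 _) H).
  eapply is_derive_value.
  - apply (is_derive_div (fun y => Cdot (g y) (g1 y)) (fun y => Cmod (g y))).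
    + apply is_derive_Cdot; eassumption.
    + apply is_derive_Cmod; eassumption.
    + lra.
  - field; lra.
Qed.

Lemma is_derive_cosh_comp (b : R -> R) (x v : R) :
  is_derive b x v -> is_derive (fun y => cosh (b y)) x (v * sinh (b x)).
Proof.
  intros H. unfold cosh, sinh. auto_derive.
  - repeat split; eexists; eassumption.
  - replace (Derive _ x) with v by (symmetry; exact (is_derive_unique _ _ _ H)); field.
Qed.

Lemma is_derive_cosh_comp_2 (b b1 : R -> R) (x v : R) :
  is_derive b x (b1 x) -> is_derive b1 x v ->
  is_derive (fun y => b1 y * sinh (b y)) x (v * sinh (b x) + b1 x * b1 x * cosh (b x)).
Proof.
  intros H H1. unfold cosh, sinh. auto_derive.
  - repeat split; eexists; eassumption.
  - replace (Derive (fun y => b y) x) with (b1 x)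
      by (symmetry; exact (is_derive_unique _ _ _ H)).
    replace (Derive (fun y => b1 y) x) with v
      by (symmetry; exact (is_derive_unique _ _ _ H1)).
    field.
Qed.

(* With [r = |k|], [D = |k - 1|], the left-hand sides are the gradient and the
   Hessian diagonal of [|K| + |K - 1|]; [a] plays the part of [K''] and drops out
   of the Laplacian. *)
Lemma confocal_laplacian (k v a : C) (r D b1 b2 sh ch lap1 lap2 : R) :
  0 < r -> 0 < D -> 0 < sh -> ch * ch = 1 + sh * sh ->
  r * r = Cdot k k -> D * D = Cdot (k - 1)%C (k - 1)%C -> r + D = ch ->
  Cdot k v / r + Cdot (k - 1)%C v / D = b1 * sh ->
  Cdot k (Ci * v)%C / r + Cdot (k - 1)%C (Ci * v)%C / D = b2 * sh ->
  (Cdot v v + Cdot k a) / r - Cdot k v * Cdot k v / (r * r * r)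
   + ((Cdot v v + Cdot (k - 1)%C a) / D
      - Cdot (k - 1)%C v * Cdot (k - 1)%C v / (D * D * D))
   - (lap1 * sh + b1 * b1 * ch) <= 0 ->
  (Cdot (Ci * v)%C (Ci * v)%C + Cdot k (Ci * (Ci * a))%C) / r
     - Cdot k (Ci * v)%C * Cdot k (Ci * v)%C / (r * r * r)
   + ((Cdot (Ci * v)%C (Ci * v)%C + Cdot (k - 1)%C (Ci * (Ci * a))%C) / D
      - Cdot (k - 1)%C (Ci * v)%C * Cdot (k - 1)%C (Ci * v)%C / (D * D * D))
   - (lap2 * sh + b2 * b2 * ch) <= 0 ->
  0 <= lap1 + lap2.
Proof.
  destruct k as [k1 k2], v as [v1 v2], a as [a1 a2].
  unfold Cdot; simpl.
  intros Hr HD Hs Hc Er ED ET G1 G2 L1 L2.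
  replace (k1 + - (1)) with (k1 - 1) in * by ring.
  replace (k2 + - 0) with k2 in * by ring.
  replace (0 * v1 - 1 * v2) with (- v2) in * by ring.
  replace (0 * v2 + 1 * v1) with v1 in * by ring.
  replace (0 * (0 * a1 - 1 * a2) - 1 * (0 * a2 + 1 * a1)) with (- a1) in * by ring.
  replace (0 * (0 * a2 + 1 * a1) + 1 * (0 * a1 - 1 * a2)) with (- a2) in * by ring.
  set (V := v1 * v1 + v2 * v2) in *.
  (* The squared gradient of [|K| + |K - 1|] is [V * ((r + D)^2 - 1) / (r * D)], because
     [|k - (k - 1)| = 1]; and [(r + D)^2 - 1 = sh * sh]. *)
  assert (E1 : V = (b1 * b1 + b2 * b2) * (r * D)).
  { assert (X : V * (ch * ch - 1) = (b1 * b1 + b2 * b2) * (r * D) * (ch * ch - 1)).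
    { replace (ch * ch - 1) with (sh * sh) at 2 by lra.
      replace ((b1 * b1 + b2 * b2) * (r * D) * (sh * sh))
        with (((b1 * sh) * (b1 * sh) + (b2 * sh) * (b2 * sh)) * (r * D)) by ring.
      rewrite <- G1, <- G2.
      transitivity (V * ((k1 * k1 + k2 * k2) * D / r
         + ((k1 - 1) * (k1 - 1) + k2 * k2) * r / D
         + 2 * (k1 * (k1 - 1) + k2 * k2))).
      - rewrite <- Er, <- ED.
        replace (r * r * D / r) with (r * D) by (field; lra).
        replace (D * D * r / D) with (r * D) by (field; lra).
        rewrite <- ET. f_equal. nra.
      - unfold V; field; lra. }
    apply Rmult_eq_reg_r in X; [exact X|nra]. }
  (* Adding the two second-order inequalities: the Laplacian of [|K|] is [V / r] and that of
     [|K - 1|] is [V / D]. By [E3] their sum cancels the gradient term of [cosh]. *)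
  assert (E2 : V / r + V / D - (b1 * b1 + b2 * b2) * ch - (lap1 + lap2) * sh <= 0).
  { assert (X := Rplus_le_compat _ _ _ _ L1 L2); rewrite Rplus_0_r in X.
    eapply Rle_trans; [|exact X]; right; clear X L1 L2 G1 G2 E1.
    replace (V / r) with (2 * V / r - V * (k1 * k1 + k2 * k2) / (r * r * r))
      by (rewrite <- Er; field; lra).
    replace (V / D) with (2 * V / D - V * ((k1 - 1) * (k1 - 1) + k2 * k2) / (D * D * D))
      by (rewrite <- ED; field; lra).
    unfold V. field; lra. }
  assert (E3 : V / r + V / D = (b1 * b1 + b2 * b2) * ch).
  { rewrite E1, <- ET; field; lra. }
  nra.
Qed.

Lemma cosh_sqr (x : R) : cosh x * cosh x = 1 + sinh x * sinh x.
Proof.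
  unfold cosh, sinh. assert (H := exp_plus x (-x)).
  replace (x + - x) with 0 in H by ring. rewrite exp_0 in H. nra.
Qed.

(** Keeps a touching point away from the focus [1], where [|K - 1|] is not differentiable: the sum
    is only 1 there. *)
Lemma Cmod_sub_1_neq (k : C) (T : R) :
  1 < T -> Cmod k + Cmod (k - 1)%C = T -> (k - 1)%C <> 0%C.
Proof.
  intros HT E Z. rewrite Z in E.
  replace k with (k - 1 + 1)%C in E by ring. rewrite Z in E.
  rewrite Cplus_0_l, Cmod_1, Cmod_0 in E. lra.
Qed.

(* A strictly superharmonic function: its Laplacian is [- 2 * dl]. *)
Definition barrier (al dl c : R) (t : C) : R :=
  al * snd t + dl * (fst t * fst t - 2 * (snd t * snd t)) + c.

(** At a touching point the difference of the two sides has a local maximum along every line. The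
    test in the directions [1] and [Ci] supplies the hypotheses of [confocal_laplacian], which makes
    the Laplacian of the barrier nonnegative, whereas it is [- 2 * dl]. Positivity of the barrier
    gives [sinh > 0] and a confocal sum above 1. *)
Lemma no_touching (K K1 : C -> C) (k2 p : C) (al dl c : R) :
  0 < dl ->
  (forall e : C, locally 0 (fun x =>
     hol_derive K (p + RtoC x * e)%C (K1 (p + RtoC x * e)%C))) ->
  hol_derive K1 p k2 -> K p <> 0%C -> 0 < barrier al dl c p ->
  (forall e : C, locally 0 (fun x =>
     Cmod (K (p + RtoC x * e)%C) + Cmod (K (p + RtoC x * e) - 1)%C
     <= cosh (barrier al dl c (p + RtoC x * e)%C))) ->
  Cmod (K p) + Cmod (K p - 1)%C = cosh (barrier al dl c p) -> False.
Proof.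
  intros Hdl HK HK1 Kp Hb Hle Heq.
  assert (Hsh : 0 < sinh (barrier al dl c p)).
  { unfold sinh. assert (exp (- barrier al dl c p) < exp (barrier al dl c p))
      by (apply exp_increasing; lra). lra. }
  assert (Hch : 1 < cosh (barrier al dl c p)).
  { assert (H := cosh_sqr (barrier al dl c p)).
    assert (0 < cosh (barrier al dl c p)).
    { unfold cosh. assert (X := exp_pos (barrier al dl c p)).
      assert (Y := exp_pos (- barrier al dl c p)). lra. }
    nra. }
  assert (Kq : (K p - 1)%C <> 0%C) by (eapply Cmod_sub_1_neq; eassumption).
  pose (b1 := fun (e : C) (x : R) => al * snd e
    + dl * (2 * fst e * (fst p + x * fst e) - 4 * snd e * (snd p + x * snd e))).
  pose (b2 := fun e : C => dl * (2 * fst e * fst e - 4 * snd e * snd e)).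
  assert (D1 : forall e x, is_derive (fun y => barrier al dl c (p + RtoC y * e)%C) x (b1 e x)).
  { intros e x; unfold barrier, b1; simpl; auto_derive; trivial; ring. }
  assert (D2 : forall e x, is_derive (b1 e) x (b2 e)).
  { intros e x; unfold b1, b2; auto_derive; trivial; ring. }
  pose (second := fun e : C =>
    (Cdot (e * K1 p)%C (e * K1 p)%C + Cdot (K p) (e * (e * k2))%C) / Cmod (K p)
      - Cdot (K p) (e * K1 p)%C * Cdot (K p) (e * K1 p)%C
        / (Cmod (K p) * Cmod (K p) * Cmod (K p))
    + ((Cdot (e * K1 p)%C (e * K1 p)%C + Cdot (K p - 1)%C (e * (e * k2))%C)
        / Cmod (K p - 1)%C
      - Cdot (K p - 1)%C (e * K1 p)%C * Cdot (K p - 1)%C (e * K1 p)%C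
        / (Cmod (K p - 1)%C * Cmod (K p - 1)%C * Cmod (K p - 1)%C))
    - (b2 e * sinh (barrier al dl c p)
       + b1 e 0 * b1 e 0 * cosh (barrier al dl c p))).
  assert (Key : forall e : C,
    Cdot (K p) (e * K1 p)%C / Cmod (K p)
      + Cdot (K p - 1)%C (e * K1 p)%C / Cmod (K p - 1)%C
      = b1 e 0 * sinh (barrier al dl c p) /\
    second e <= 0).
  { intros e.
    pose (g := fun x => K (p + RtoC x * e)%C).
    pose (h := fun x => (K (p + RtoC x * e) - 1)%C).
    pose (g1 := fun x => (e * K1 (p + RtoC x * e))%C).
    pose (b := fun x => barrier al dl c (p + RtoC x * e)%C).
    assert (G : locally 0 (fun x => curve_derive g x (g1 x))).
    { generalize (HK e); apply filter_imp; intros x Hx.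
      apply (hol_derive_line K K1), Hx. }
    assert (Hh : locally 0 (fun x => curve_derive h x (g1 x))).
    { revert G; apply filter_imp; intros x Hx.
      eapply curve_derive_value; [apply curve_derive_plus, (curve_derive_const (-(1))%C); exact Hx|].
      ring. }
    assert (G1 : curve_derive g1 0 (e * (e * k2))%C).
    { eapply curve_derive_value.
      - apply curve_derive_mult; [apply curve_derive_const|apply HK1].
      - cbv beta; ring. }
    assert (g0 : g 0 = K p) by (unfold g; now rewrite line_at_0).
    assert (h0 : h 0 = (K p - 1)%C) by (unfold h; now rewrite line_at_0).
    assert (g10 : g1 0 = (e * K1 p)%C) by (unfold g1; now rewrite line_at_0).
    assert (b0 : b 0 = barrier al dl c p) by (unfold b; now rewrite line_at_0).
    assert (NZ : forall f : R -> C, f 0 <> 0%C -> (exists v, curve_derive f 0 v) ->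
       locally 0 (fun x => f x <> 0%C)).
    { intros f f0 [v Hv]. apply curve_derive_continuous in Hv.
      apply (Hv (fun z => z <> 0%C)). assert (P := proj1 (Cmod_gt_0 _) f0).
      assert (P2 : 0 < Cmod (f 0) / 2) by lra.
      exists (mkposreal _ P2). intros y [Y1 Y2] Z. subst y.
      change (Rabs (0 - fst (f 0)) < Cmod (f 0) / 2) in Y1.
      change (Rabs (0 - snd (f 0)) < Cmod (f 0) / 2) in Y2.
      assert (Q := Cmod_2Rmax (f 0)). assert (Q2 := Rmax_Cmod (f 0)).
      rewrite Rminus_0_l, Rabs_Ropp in Y1, Y2.
      assert (S2 : sqrt 2 < 3 / 2).
      { replace (3/2) with (sqrt (9/4)); [apply sqrt_lt_1; lra|].
        replace (9/4) with ((3/2) * (3/2)) by field. apply sqrt_square; lra. }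
      assert (0 < sqrt 2) by (apply sqrt_lt_R0; lra).
      assert (Rmax (Rabs (fst (f 0))) (Rabs (snd (f 0))) < Cmod (f 0) / 2)
        by (apply Rmax_lub_lt; assumption).
      nra. }
    destruct (local_max_test (fun x => Cmod (g x) + Cmod (h x) - cosh (b x))
      (fun x => Cdot (g x) (g1 x) / Cmod (g x) + Cdot (h x) (g1 x) / Cmod (h x)
                - b1 e x * sinh (b x))
      (second e)) as [Z1 Z2].
    - assert (N1 : locally 0 (fun x => g x <> 0%C)).
      { apply NZ; [now rewrite g0|eexists; apply (locally_singleton _ _ G)]. }
      assert (N2 : locally 0 (fun x => h x <> 0%C)).
      { apply NZ; [now rewrite h0|eexists; apply (locally_singleton _ _ Hh)]. }
      generalize (filter_and _ _ (filter_and _ _ G Hh) (filter_and _ _ N1 N2)).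
      apply filter_imp; intros x [[X1 X2] [X3 X4]].
      apply (is_derive_minus (K := R_AbsRing) (V := R_NormedModule)
               (fun x => Cmod (g x) + Cmod (h x)) (fun x => cosh (b x))).
      + apply (is_derive_plus (K := R_AbsRing) (V := R_NormedModule)
               (fun x => Cmod (g x)) (fun x => Cmod (h x)));
          apply is_derive_Cmod; assumption.
      + apply is_derive_cosh_comp, D1.
    - unfold second. apply (is_derive_minus (K := R_AbsRing) (V := R_NormedModule)
               (fun x => Cdot (g x) (g1 x) / Cmod (g x) + Cdot (h x) (g1 x) / Cmod (h x))
               (fun x => b1 e x * sinh (b x))).
      + rewrite <- h0, <- g10, <- g0.
        apply (is_derive_plus (K := R_AbsRing) (V := R_NormedModule)
               (fun x => Cdot (g x) (g1 x) / Cmod (g x))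
               (fun x => Cdot (h x) (g1 x) / Cmod (h x)));
          apply is_derive_Cmod_2; try assumption.
        * apply (locally_singleton _ _ G).
        * now rewrite g0.
        * apply (locally_singleton _ _ Hh).
        * now rewrite h0.
      + rewrite <- b0. apply is_derive_cosh_comp_2; [apply D1|apply D2].
    - generalize (Hle e); apply filter_imp; intros x Hx.
      rewrite g0, h0, b0, Heq. unfold g, h, b. lra.
    - rewrite g0, h0, g10, b0 in Z1. split; [lra|exact Z2]. }
  destruct (Key 1%C) as [A1 A2], (Key Ci) as [B1 B2].
  replace (1 * K1 p)%C with (K1 p) in A1 by ring.
  unfold second in A2, B2.
  replace (1 * K1 p)%C with (K1 p) in A2 by ring.
  replace (1 * (1 * k2))%C with k2 in A2 by ring.
  assert (X : 0 <= b2 1%C + b2 Ci).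
  { eapply (confocal_laplacian (K p) (K1 p) k2 (Cmod (K p)) (Cmod (K p - 1)%C));
      try eassumption.
    - now apply Cmod_gt_0.
    - now apply Cmod_gt_0.
    - apply cosh_sqr.
    - apply Cmod_sqr.
    - apply Cmod_sqr. }
  unfold b2 in X; simpl in X. lra.
Qed.

(** * Maxima of upper semicontinuous functions, and the inverse of cosh *)

Definition upper_half (q : C) : Prop := 0 <= snd q.

Definition upper_semicontinuous_at (F : C -> R) (p : C) : Prop :=
  forall eps : R, 0 < eps ->
    within upper_half (locally p) (fun q => F q < F p + eps).

Lemma list_max {A : Type} (F : A -> R) (l : list A) (a0 : A) :
  exists a, List.In a (a0 :: l)%list /\ forall b, List.In b (a0 :: l)%list -> F b <= F a.
Proof.
  revert a0; induction l as [|a1 l IH]; intros a0.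
  - exists a0; split; [now left|]. intros b [->|[]]; lra.
  - destruct (IH a1) as (a & Ha & Hm).
    destruct (Rle_or_lt (F a) (F a0)) as [L|L].
    + exists a0; split; [now left|]. intros b [->|Hb]; [lra|].
      specialize (Hm b Hb); lra.
    + exists a; split; [now right|]. intros b [->|Hb]; [lra|auto].
Qed.

(** Without a maximum, each point [p] of the rectangle has a better point [Q p] whose value exceeds
    [F] on a whole neighbourhood of [p]. Among the values at finitely many such [Q p], taken from a
    cover, the largest would be exceeded by another of them. *)
Lemma upper_semicontinuous_max (F : C -> R) (X Y : R) :
  0 <= X -> 0 <= Y ->
  (forall p : C, 0 <= snd p -> upper_semicontinuous_at F p) ->
  exists p : C, Rabs (fst p) <= X /\ 0 <= snd p <= Y /\
    forall q : C, Rabs (fst q) <= X -> 0 <= snd q <= Y -> F q <= F p.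
Proof.
  intros HX HY U. apply NNPP; intros N.
  pose (inr := fun p : C => Rabs (fst p) <= X /\ 0 <= snd p <= Y).
  assert (G : forall p, exists q, exists d : posreal, inr p -> inr q /\
     forall z : C, Rabs (fst z - fst p) < d -> Rabs (snd z - snd p) < d ->
      0 <= snd z -> F z < F q).
  { intros p. destruct (classic (inr p)) as [Hp|Hp].
    2:{ exists p, (mkposreal 1 Rlt_0_1); tauto. }
    assert (E : exists q, inr q /\ F p < F q).
    { apply NNPP; intros M; apply N. destruct Hp as [P1 P2]. exists p; repeat split; try tauto.
      intros q Q1 Q2. apply Rnot_lt_le; intros L; apply M. exists q; now repeat split. }
    destruct E as (q & Hq & L).
    destruct (U p (proj1 (proj2 Hp)) (F q - F p)) as (d & B); [lra|].
    exists q, d; intros _; split; [exact Hq|].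
    intros z Z1 Z2 Z3. specialize (B z (conj Z1 Z2) Z3). lra. }
  apply functional_choice in G; destruct G as (Q & G).
  apply functional_choice in G; destruct G as (D & G).
  apply (compactness_list 2 (- X, (0, tt)) (X, (Y, tt))
           (fun t => D (fst t, fst (snd t)))).
  intros (l & Hl).
  (* Centres outside the rectangle, about which [G] says nothing, are filtered out; the origin,
     which lies in the rectangle, keeps the list nonempty. *)
  destruct (list_max (fun t : Compactness.Tn 2 R => F (Q (fst t, fst (snd t))))
    (List.filter (fun t : Compactness.Tn 2 R =>
       if Rle_dec (Rabs (fst t)) X then
         if Rle_dec 0 (fst (snd t)) then if Rle_dec (fst (snd t)) Y then true else false
         else false else false) l) (0, (0, tt)))
    as (m & Hm & Mx).
  assert (Hin : inr (fst m, fst (snd m))).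
  { destruct Hm as [<-|Hm].
    - unfold inr; simpl. rewrite Rabs_R0; lra.
    - apply List.filter_In in Hm. destruct Hm as [_ Hm].
      destruct Rle_dec; [|discriminate]. destruct Rle_dec; [|discriminate].
      destruct Rle_dec; [|discriminate]. now split. }
  destruct (G _ Hin) as [Hq _].
  set (q := Q (fst m, fst (snd m))) in *.
  assert (bq : bounded_n 2 (- X, (0, tt)) (X, (Y, tt)) (fst q, (snd q, tt))).
  { destruct Hq as [Q1 Q2]. simpl. apply Rabs_le_between in Q1. tauto. }
  destruct (Hl _ bq) as ([t1 [t2 []]] & T1 & T2 & T3).
  simpl in T2, T3.
  assert (Ht : inr (t1, t2)).
  { split; simpl; [apply Rabs_le_between|]; tauto. }
  destruct (G _ Ht) as [_ B].
  assert (L : F q < F (Q (t1, t2))).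
  { apply B; simpl; try tauto. exact (proj1 (proj2 Hq)). }
  assert (M : F (Q (t1, t2)) <= F q).
  { apply (Mx (t1, (t2, tt))). right. apply List.filter_In; split; [exact T1|].
    destruct Ht as [H1 H2]; simpl in H1, H2 |- *.
    destruct Rle_dec; [|tauto]. destruct Rle_dec; [|tauto]. destruct Rle_dec; tauto. }
  lra.
Qed.

Definition acosh (x : R) : R := ln (x + sqrt (x * x - 1)).

Lemma cosh_acosh (x : R) : 1 <= x -> cosh (acosh x) = x.
Proof.
  intros H. unfold cosh, acosh.
  assert (S : 0 <= sqrt (x * x - 1)) by apply sqrt_pos.
  assert (Q : sqrt (x * x - 1) * sqrt (x * x - 1) = x * x - 1) by (apply sqrt_sqrt; nra).
  rewrite exp_Ropp, exp_ln by lra.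
  field_simplify_eq; [nra|lra].
Qed.

Lemma acosh_nonneg (x : R) : 1 <= x -> 0 <= acosh x.
Proof.
  intros H. unfold acosh. rewrite <- ln_1. apply ln_le; [lra|].
  assert (S : 0 <= sqrt (x * x - 1)) by apply sqrt_pos. lra.
Qed.

Lemma acosh_le (x y : R) : 1 <= x -> x <= y -> acosh x <= acosh y.
Proof.
  intros H L. unfold acosh.
  assert (S : 0 <= sqrt (x * x - 1)) by apply sqrt_pos.
  apply ln_le; [lra|]. apply Rplus_le_compat; [exact L|]. apply sqrt_le_1_alt; nra.
Qed.

Lemma acosh_cosh (b : R) : 0 <= b -> acosh (cosh b) = b.
Proof.
  intros H. unfold acosh. assert (E := cosh_sqr b).
  replace (cosh b * cosh b - 1) with (sinh b * sinh b) by lra.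
  assert (0 <= sinh b).
  { unfold sinh. destruct H as [H|<-].
    - assert (exp (- b) < exp b) by (apply exp_increasing; lra). lra.
    - rewrite Ropp_0; lra. }
  rewrite sqrt_square by assumption.
  replace (cosh b + sinh b) with (exp b) by (unfold cosh, sinh; field).
  apply ln_exp.
Qed.

Lemma cosh_ge_1 (b : R) : 1 <= cosh b.
Proof.
  assert (E := cosh_sqr b). assert (0 < cosh b).
  { unfold cosh. assert (X := exp_pos b). assert (Y := exp_pos (- b)). lra. }
  nra.
Qed.

Lemma acosh_le_iff (x b : R) : 1 <= x -> 0 <= b -> (acosh x <= b <-> x <= cosh b).
Proof.
  intros Hx Hb; split; intros H.
  - apply Rnot_lt_le; intros L.
    assert (A : acosh (cosh b) <= acosh x) by (apply acosh_le; [apply cosh_ge_1|lra]).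
    rewrite acosh_cosh in A by exact Hb.
    assert (acosh x = b) as E by lra.
    rewrite <- E, cosh_acosh in L; lra.
  - rewrite <- (acosh_cosh b Hb). now apply acosh_le.
Qed.

Lemma acosh_continuous (x : R) : 1 <= x ->
  forall eps, 0 < eps -> exists d, 0 < d /\ forall y, 1 <= y -> y < x + d -> acosh y < acosh x + eps.
Proof.
  intros Hx eps He.
  pose (b := acosh x + eps / 2).
  assert (Hb : acosh x < b) by (unfold b; lra).
  assert (P := acosh_nonneg x Hx).
  exists (cosh b - x). split.
  - destruct (Rle_or_lt (cosh b) x) as [L|L]; [|lra].
    apply acosh_le in L; [|apply cosh_ge_1]. rewrite acosh_cosh in L; lra.
  - intros y Hy L. assert (y <= cosh b) by lra.
    apply acosh_le_iff in H; [unfold b in H|..]; lra.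
Qed.

(* [|k| + |k e^(- i th) - 1|] when [r = |k|] and [c = cos (arg k - th)]. *)
Definition focal_sum (r c : R) : R := r + sqrt (1 + r * r - 2 * r * c).

Lemma focal_sum_ge_1 (r c : R) : 0 <= r -> -1 <= c <= 1 -> 1 <= focal_sum r c.
Proof.
  intros Hr Hc. unfold focal_sum.
  destruct (Rle_or_lt r 1) as [L|L].
  - assert (sqrt ((1 - r) * (1 - r)) <= sqrt (1 + r * r - 2 * r * c)) by (apply sqrt_le_1_alt; nra).
    rewrite sqrt_square in H; lra.
  - assert (S := sqrt_pos (1 + r * r - 2 * r * c)). lra.
Qed.

Lemma focal_sum_le (r c : R) : 0 <= r -> -1 <= c <= 1 -> focal_sum r c <= 1 + 2 * r.
Proof.
  intros Hr Hc. unfold focal_sum.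
  assert (sqrt (1 + r * r - 2 * r * c) <= sqrt ((1 + r) * (1 + r))) by (apply sqrt_le_1_alt; nra).
  rewrite sqrt_square in H; lra.
Qed.

Lemma focal_sum_m1 (r : R) : 0 <= r -> focal_sum r (-1) = 1 + 2 * r.
Proof.
  intros Hr. unfold focal_sum.
  replace (1 + r * r - 2 * r * -1) with ((1 + r) * (1 + r)) by ring.
  rewrite sqrt_square; lra.
Qed.

Lemma focal_sum_antitone (r c c' : R) : 0 <= r -> c' <= c -> focal_sum r c <= focal_sum r c'.
Proof.
  intros Hr Hc. unfold focal_sum.
  apply Rplus_le_compat_l, sqrt_le_1_alt; nra.
Qed.

Lemma focal_sum_Cexp (l : C) (th : R) :
  Cmod (Cexp (l - (0, th))%C) + Cmod (Cexp (l - (0, th)) - 1)%C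
  = focal_sum (exp (fst l)) (cos (snd l - th)).
Proof.
  rewrite Cmod_Cexp. unfold focal_sum.
  destruct l as [x y]; unfold Cmod, Cexp, Re, Im; simpl.
  replace (x + - 0) with x by ring. replace (y + - th) with (y - th) by ring.
  assert (E := sin2_cos2 (y - th)). unfold Rsqr in E.
  do 2 f_equal.
  transitivity (1 + exp x * exp x * (sin (y - th) * sin (y - th) + cos (y - th) * cos (y - th))
    - 2 * exp x * cos (y - th)); [ring|rewrite E; ring].
Qed.

(** * Choice of the nearest boundary phase *)

Lemma cos_sub_2PI (x : R) : cos (x - 2 * PI) = cos x.
Proof. rewrite cos_minus, cos_2PI, sin_2PI; ring. Qed.

(** At this distance the open intervals of radius [PI] about the phases are disjoint, so each
    argument has at most one phase within [PI]. *)
Definition spaced (S : R -> Prop) : Prop :=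
  forall u v : R, S u -> S v -> u = v \/ 2 * PI <= Rabs (u - v).

(** The default [-1] is the limit of [cos (al - th)] as the distance to the phase tends to [PI], so
    nothing jumps where a phase goes out of reach. *)
Lemma nearest_cos_exists (S : R -> Prop) : exists chi : R -> R, forall al : R,
  (exists th, S th /\ Rabs (al - th) < PI /\ chi al = cos (al - th)) \/
  ((forall th, S th -> PI <= Rabs (al - th)) /\ chi al = -1).
Proof.
  apply (functional_choice (fun al v =>
    (exists th, S th /\ Rabs (al - th) < PI /\ v = cos (al - th)) \/
    ((forall th, S th -> PI <= Rabs (al - th)) /\ v = -1))).
  intros al. destruct (classic (exists th, S th /\ Rabs (al - th) < PI)) as [(th & H1 & H2)|N].
  - exists (cos (al - th)); left; now exists th.
  - exists (-1); right; split; [|reflexivity].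
    intros th Hth; apply Rnot_lt_le; intros L; apply N; now exists th.
Qed.

Definition nearest_cos (S : R -> Prop) : R -> R :=
  proj1_sig (constructive_indefinite_description _ (nearest_cos_exists S)).

Lemma nearest_cos_spec (S : R -> Prop) (al : R) :
  (exists th, S th /\ Rabs (al - th) < PI /\ nearest_cos S al = cos (al - th)) \/
  ((forall th, S th -> PI <= Rabs (al - th)) /\ nearest_cos S al = -1).
Proof.
  exact (proj2_sig (constructive_indefinite_description _ (nearest_cos_exists S)) al).
Qed.

Lemma nearest_cos_bound (S : R -> Prop) (al : R) : -1 <= nearest_cos S al <= 1.
Proof.
  destruct (nearest_cos_spec S al) as [(th & _ & _ & ->)|[_ ->]]; [apply COS_bound|lra].
Qed.

Lemma nearest_cos_eq (S : R -> Prop) (al th : R) :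
  spaced S -> S th -> Rabs (al - th) < PI -> nearest_cos S al = cos (al - th).
Proof.
  intros HS Hth L. destruct (nearest_cos_spec S al) as [(u & Hu & L' & ->)|[N _]].
  - destruct (HS th u Hth Hu) as [->|D]; [reflexivity|exfalso].
    revert D L L'; unfold Rabs; repeat destruct Rcase_abs; lra.
  - specialize (N th Hth). lra.
Qed.

(** If another phase [u] is the one within [PI] of [al], it is at least a full turn from [th].
    Removing that turn puts [al - th], up to sign, into [[0, PI]] and no farther from 0 than
    [al - u], on an interval where the cosine decreases. *)
Lemma nearest_cos_le (S : R -> Prop) (al th : R) :
  spaced S -> S th -> Rabs (al - th) <= 2 * PI -> nearest_cos S al <= cos (al - th).
Proof.
  intros HS Hth L. assert (HP := PI_RGT_0).
  destruct (nearest_cos_spec S al) as [(u & Hu & L' & ->)|[_ ->]]; [|apply COS_bound].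
  destruct (HS th u Hth Hu) as [->|D]; [lra|].
  apply Rabs_le_between in L. apply Rabs_lt_between in L'.
  destruct (Rle_or_lt u th) as [O|O].
  - rewrite Rabs_right in D by lra.
    rewrite <- (cos_neg (al - th)), <- (cos_sub_2PI (- (al - th))), <- (cos_neg (- (al - th) - 2 * PI)).
    apply cos_decr_1; lra.
  - rewrite Rabs_left in D by lra.
    rewrite <- (cos_neg (al - u)), <- (cos_sub_2PI (al - th)), <- (cos_neg (al - th - 2 * PI)).
    apply cos_decr_1; lra.
Qed.

(** * Comparison in the half plane for functions with stepped boundary phase *)

(* [L] is a logarithm, on the closed upper half plane, of a function whose modulus
   [r] may vanish on the real axis (where [L] is junk); on each interval between
   real zeros the argument is constant, and distinct values of it are at least
   [2 * PI] apart. *)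
Record stepped_phase (nu : R) (L : C -> C) (r : C -> R) : Prop := {
  sp_hol : exists L1 L2 : C -> C, forall t : C, 0 < snd t ->
    hol_derive L t (L1 t) /\ hol_derive L1 t (L2 t);
  sp_nonneg : forall t : C, upper_half t -> 0 <= r t;
  sp_pos : forall t : C, 0 < snd t -> r t <> 0;
  sp_mod : forall t : C, upper_half t -> r t <> 0 -> r t = exp (fst (L t));
  sp_cont : forall t : C, upper_half t ->
    filterlim r (within upper_half (locally t)) (locally (r t));
  sp_arg : forall t : C, upper_half t -> r t <> 0 ->
    filterlim (fun z => snd (L z)) (within upper_half (locally t)) (locally (snd (L t)));
  sp_axis : forall x : R, r (x, 0) <= 1;
  sp_growth : exists M : R, forall t : C, upper_half t -> r t <= M * exp (nu * snd t);
  sp_step : forall x x' : R, r (x, 0) <> 0 -> r (x', 0) <> 0 ->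
    snd (L (x, 0)) = snd (L (x', 0)) \/
    2 * PI <= Rabs (snd (L (x, 0)) - snd (L (x', 0)))
}.

Arguments sp_hol {nu L r} _.
Arguments sp_nonneg {nu L r} _.
Arguments sp_pos {nu L r} _.
Arguments sp_mod {nu L r} _.
Arguments sp_cont {nu L r} _.
Arguments sp_arg {nu L r} _.
Arguments sp_axis {nu L r} _.
Arguments sp_growth {nu L r} _.
Arguments sp_step {nu L r} _.

Definition axis_phase (L : C -> C) (r : C -> R) (th : R) : Prop :=
  exists x : R, r (x, 0) <> 0 /\ th = snd (L (x, 0)).

Definition glued_sum (L : C -> C) (r : C -> R) (t : C) : R :=
  focal_sum (r t) (nearest_cos (axis_phase L r) (snd (L t))).

Lemma locally_Rabs_lt (f : C -> R) (p : C) (l d : R) :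
  0 < d -> filterlim f (within upper_half (locally p)) (locally l) ->
  within upper_half (locally p) (fun q => Rabs (f q - l) < d).
Proof.
  intros Hd H. apply (proj1 (filterlim_locally f l)) with (eps := mkposreal d Hd) in H.
  exact H.
Qed.

Lemma within_impl {T : Type} (F : (T -> Prop) -> Prop) {FF : Filter F} (D P Q : T -> Prop) :
  (forall q, D q -> P q -> Q q) -> within D F P -> within D F Q.
Proof. intros H. unfold within. apply filter_imp; auto. Qed.

Lemma axis_phase_spaced (nu : R) (L : C -> C) (r : C -> R) : stepped_phase nu L r -> spaced (axis_phase L r).
Proof.
  intros H u v (x & Hx & ->) (y & Hy & ->). now apply (sp_step H).
Qed.

Lemma glued_sum_ge_1 (nu : R) (L : C -> C) (r : C -> R) (t : C) :
  stepped_phase nu L r -> upper_half t -> 1 <= glued_sum L r t.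
Proof.
  intros H Ht. apply focal_sum_ge_1; [now apply (sp_nonneg H)|apply nearest_cos_bound].
Qed.

Lemma glued_sum_le (nu : R) (L : C -> C) (r : C -> R) (t : C) :
  stepped_phase nu L r -> upper_half t -> glued_sum L r t <= 1 + 2 * r t.
Proof.
  intros H Ht. apply focal_sum_le; [now apply (sp_nonneg H)|apply nearest_cos_bound].
Qed.

(** On the axis the point of modulus [r <= 1] lies on the segment joining the two foci [0] and
    [e^(i th)], where the sum of distances is minimal. *)
Lemma glued_sum_axis (nu : R) (L : C -> C) (r : C -> R) (x : R) :
  stepped_phase nu L r -> glued_sum L r (x, 0) = 1.
Proof.
  intros H. assert (P : upper_half (x, 0)) by (unfold upper_half; simpl; lra).
  assert (r0 := sp_nonneg H _ P). assert (r1 := sp_axis H x).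
  unfold glued_sum. destruct (Req_dec (r (x, 0)) 0) as [Z|Z].
  - rewrite Z. unfold focal_sum. replace (1 + 0 * 0 - 2 * 0 * _) with 1 by ring.
    rewrite sqrt_1; ring.
  - rewrite nearest_cos_eq with (th := snd (L (x, 0))).
    + rewrite Rminus_diag, cos_0. unfold focal_sum.
      replace (1 + r (x, 0) * r (x, 0) - 2 * r (x, 0) * 1)
        with ((1 - r (x, 0)) * (1 - r (x, 0))) by ring.
      rewrite sqrt_square; lra.
    + now apply (axis_phase_spaced nu).
    + now exists x.
    + rewrite Rminus_diag, Rabs_R0; apply PI_RGT_0.
Qed.

(** Two regimes. If the value at [p] is [1 + 2 * r p], the largest possible for that modulus, the
    continuous bound [1 + 2 * r] suffices; this covers the zeros, where the argument is junk, and
    the gaps between phases. Otherwise one phase is within [PI] of the argument, remains the chosen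
    one nearby, and the function is continuous. *)
Lemma glued_sum_upper (nu : R) (L : C -> C) (r : C -> R) (p : C) :
  stepped_phase nu L r -> upper_half p -> upper_semicontinuous_at (glued_sum L r) p.
Proof.
  intros H Hp eps He.
  assert (Small : glued_sum L r p = 1 + 2 * r p ->
    within upper_half (locally p) (fun q => glued_sum L r q < glued_sum L r p + eps)).
  { intros E. rewrite E.
    assert (Q := locally_Rabs_lt _ _ _ (eps / 2) ltac:(lra) (sp_cont H p Hp)).
    revert Q; apply (within_impl (locally p)); intros q U Hq.
    assert (X := glued_sum_le _ _ _ q H U). apply Rabs_lt_between in Hq. lra. }
  destruct (Req_dec (r p) 0) as [Z|Z].
  - apply Small. unfold glued_sum; rewrite Z. unfold focal_sum.
    replace (1 + 0 * 0 - 2 * 0 * _) with 1 by ring. rewrite sqrt_1; ring.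
  - destruct (nearest_cos_spec (axis_phase L r) (snd (L p))) as [(th & Hth & Lt & E)|[N E]].
    2:{ apply Small. unfold glued_sum. rewrite E.
        apply focal_sum_m1. now apply (sp_nonneg H). }
    assert (A := sp_arg H p Hp Z). assert (B := sp_cont H p Hp).
    assert (Cn : filterlim (fun q => focal_sum (r q) (cos (snd (L q) - th)))
      (within upper_half (locally p)) (locally (glued_sum L r p))).
    { unfold glued_sum; rewrite E. unfold focal_sum.
      assert (Fc : filterlim (fun q => cos (snd (L q) - th)) (within upper_half (locally p))
         (locally (cos (snd (L p) - th)))).
      { apply (filterlim_R_comp _ (fun q => snd (L q)) (fun al => cos (al - th))); [exact A|].
        auto_derive; trivial. }
      apply (filterlim_Rplus _); [exact B|].
      apply (filterlim_comp _ _ _ (fun q => 1 + r q * r q - 2 * r q * cos (snd (L q) - th))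
               sqrt _ (locally (1 + r p * r p - 2 * r p * cos (snd (L p) - th)))); [|apply continuous_sqrt].
      apply (filterlim_Rplus _).
      - apply (filterlim_R_comp _ r (fun x => 1 + x * x)); [exact B|auto_derive; trivial].
      - apply (filterlim_R_comp _ (fun q => 2 * r q * cos (snd (L q) - th)) Ropp); [|auto_derive; trivial].
        apply (filterlim_Rmult _); [|exact Fc].
        apply (filterlim_Rmult _); [apply filterlim_const|exact B]. }
    apply (locally_Rabs_lt _ _ _ eps He) in Cn.
    assert (dpos : 0 < PI - Rabs (snd (L p) - th)) by lra.
    apply (locally_Rabs_lt _ _ _ _ dpos) in A.
    generalize (filter_and _ _ Cn A). apply (within_impl (locally p)).
    intros q U [Q1 Q2].
    unfold glued_sum at 1. rewrite nearest_cos_eq with (th := th).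
    + apply Rabs_lt_between in Q1; lra.
    + now apply (axis_phase_spaced nu).
    + exact Hth.
    + replace (snd (L q) - th) with ((snd (L q) - snd (L p)) + (snd (L p) - th)) by ring.
      eapply Rle_lt_trans; [apply Rabs_triang|lra].
Qed.

(* Near an interior point, the glued function lies above the modulus sum of a single
   branch, with equality at the point: in a gap between phases use the branch
   shifted to the opposite phase. *)
Lemma glued_sum_support (nu : R) (L : C -> C) (r : C -> R) (p : C) :
  stepped_phase nu L r -> 0 < snd p ->
  exists th : R,
    nearest_cos (axis_phase L r) (snd (L p)) = cos (snd (L p) - th) /\
    within upper_half (locally p) (fun q =>
      nearest_cos (axis_phase L r) (snd (L q)) <= cos (snd (L q) - th)).
Proof.
  intros H Hp. assert (Up : upper_half p) by (unfold upper_half; lra).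
  assert (HP := PI_RGT_0).
  assert (A := sp_arg H p Up (sp_pos H p Hp)).
  assert (Sp := axis_phase_spaced _ _ _ H).
  destruct (classic (exists th, axis_phase L r th /\ Rabs (snd (L p) - th) <= PI))
    as [(th & Hth & Lt)|N].
  - exists th; split.
    + destruct Lt as [Lt|Eq]; [now apply nearest_cos_eq|].
      assert (E : cos (snd (L p) - th) = -1).
      { revert Eq; unfold Rabs; destruct Rcase_abs; intros Eq.
        - rewrite <- cos_neg, Eq; apply cos_PI.
        - rewrite Eq; apply cos_PI. }
      rewrite E. apply Rle_antisym; [|apply nearest_cos_bound].
      rewrite <- E. apply nearest_cos_le; auto. lra.
    + generalize (locally_Rabs_lt _ _ _ PI HP A); apply (within_impl (locally p)).
      intros q U Hq. apply nearest_cos_le; auto.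
      replace (snd (L q) - th) with ((snd (L q) - snd (L p)) + (snd (L p) - th)) by ring.
      eapply Rle_trans; [apply Rabs_triang|lra].
  - exists (snd (L p) + PI).
    (* Otherwise there are three distinct phases at distances between [PI] and [PI + 1]. Two of them
       lie on the same side, hence less than 1 apart, against the spacing [2 * PI]. *)
    assert (Gap : exists eta, 0 < eta /\
      forall th, axis_phase L r th -> PI + eta <= Rabs (snd (L p) - th)).
    { apply NNPP; intros M.
      assert (Near : forall eta, 0 < eta -> exists th, axis_phase L r th /\
         PI < Rabs (snd (L p) - th) < PI + eta).
      { intros eta He. apply NNPP; intros K. apply M. exists eta; split; [exact He|].
        intros th Hth. apply Rnot_lt_le; intros LL.
        apply K; exists th; repeat split; auto.
        apply Rnot_le_lt; intros LL2; apply N; now exists th. }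
      destruct (Near 1 Rlt_0_1) as (t1 & T1 & A1).
      destruct (Near (Rmin 1 (Rabs (snd (L p) - t1) - PI))) as (t2 & T2 & A2).
      { apply Rmin_case; lra. }
      assert (A2' := Rmin_l 1 (Rabs (snd (L p) - t1) - PI)).
      assert (A2'' := Rmin_r 1 (Rabs (snd (L p) - t1) - PI)).
      destruct (Near (Rmin 1 (Rabs (snd (L p) - t2) - PI))) as (t3 & T3 & A3).
      { apply Rmin_case; lra. }
      assert (A3' := Rmin_l 1 (Rabs (snd (L p) - t2) - PI)).
      assert (A3'' := Rmin_r 1 (Rabs (snd (L p) - t2) - PI)).
      assert (D12 : t1 <> t2) by (intros ->; lra).
      assert (D23 : t2 <> t3) by (intros ->; lra).
      assert (D13 : t1 <> t3) by (intros ->; lra).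
      assert (P4 := PI_4). assert (P3 := PI2_3_2).
      destruct (Sp t1 t2 T1 T2) as [?|S12]; [tauto|].
      destruct (Sp t2 t3 T2 T3) as [?|S23]; [tauto|].
      destruct (Sp t1 t3 T1 T3) as [?|S13]; [tauto|].
      clear A2' A2'' A3' A3'' M N Near.
      revert A1 A2 A3 S12 S23 S13. unfold Rmin. unfold Rabs.
      repeat destruct Rcase_abs; repeat destruct Rle_dec; lra. }
    destruct Gap as (eta & He & Gap). split.
    + destruct (nearest_cos_spec (axis_phase L r) (snd (L p))) as [(th & Hth & Lt & _)|[_ ->]].
      * specialize (Gap th Hth); lra.
      * replace (snd (L p) - (snd (L p) + PI)) with (- PI) by ring.
        now rewrite cos_neg, cos_PI.
    + generalize (locally_Rabs_lt _ _ _ eta He A); apply (within_impl (locally p)).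
      intros q U Hq.
      destruct (nearest_cos_spec (axis_phase L r) (snd (L q))) as [(th & Hth & Lt & _)|[_ ->]].
      * specialize (Gap th Hth). exfalso.
        assert (T := Rabs_triang (snd (L p) - snd (L q)) (snd (L q) - th)).
        rewrite (Rabs_minus_sym (snd (L p))) in T.
        replace (snd (L p) - snd (L q) + (snd (L q) - th)) with (snd (L p) - th) in T by ring.
        lra.
      * apply COS_bound.
Qed.

Lemma line_locally (P : C -> Prop) (p e : C) :
  locally p P -> locally 0 (fun x => P (p + RtoC x * e)%C).
Proof.
  intros H. assert (Hc := curve_derive_continuous _ _ _ (curve_derive_line p e 0)).
  apply Hc. now rewrite line_at_0.
Qed.

Lemma interior_locally (p : C) : 0 < snd p -> locally p (fun q => 0 < snd q).
Proof.
  intros H. exists (mkposreal _ H). intros q [_ Q].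
  apply ball_Rabs_lt, Rabs_lt_between in Q. simpl in Q. lra.
Qed.

Lemma upper_semicontinuous_sub_acosh (G : C -> R) (al dl c : R) (p : C) :
  (forall q, upper_half q -> 1 <= G q) -> upper_half p -> upper_semicontinuous_at G p ->
  upper_semicontinuous_at (fun q => acosh (G q) - barrier al dl c q) p.
Proof.
  intros G1 Hp U eps He.
  destruct (acosh_continuous (G p) (G1 p Hp) (eps / 2)) as (d & Hd & A); [lra|].
  assert (B : filterlim (barrier al dl c) (locally p) (locally (barrier al dl c p))).
  { destruct (proj1 (filterlim_C _ (fun q : C => q) p) (filterlim_id _ (locally p))) as [F1 F2].
    unfold barrier. apply (filterlim_Rplus _); [|apply filterlim_const].
    apply (filterlim_Rplus _); apply (filterlim_Rmult _); try apply filterlim_const; try assumption.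
    apply (filterlim_Rplus _).
    - apply (filterlim_R_comp _ _ (fun x => x * x)); [exact F1|auto_derive; trivial].
    - apply (filterlim_R_comp _ _ (fun x => - (2 * (x * x)))); [exact F2|auto_derive; trivial]. }
  assert (eh : 0 < eps / 2) by lra.
  apply (proj1 (filterlim_locally _ _)) with (eps := mkposreal _ eh) in B.
  unfold upper_semicontinuous_at, within in *.
  generalize (filter_and _ _ (U d Hd) B). apply filter_imp.
  intros q [Q1 Q2] Hq. specialize (Q1 Hq). specialize (A (G q) (G1 q Hq) Q1).
  apply ball_Rabs_lt, Rabs_lt_between in Q2. simpl in Q2. lra.
Qed.

Lemma cosh_ge_linear (b : R) : (1 + b) / 2 <= cosh b.
Proof.
  unfold cosh. assert (A := exp_ineq1_le b). assert (B := exp_pos (- b)). lra.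
Qed.

(** The glued function need not be smooth where the chosen phase changes. The supporting branch [K]
    is holomorphic, lies below it and agrees with it at [p], so it inherits the touching. *)
Lemma no_interior_excess (nu : R) (L : C -> C) (r : C -> R) (al dl c : R) (p : C) :
  stepped_phase nu L r -> 0 < dl -> 0 < snd p -> 0 < barrier al dl c p ->
  locally p (fun q => glued_sum L r q <= cosh (barrier al dl c q)) ->
  glued_sum L r p = cosh (barrier al dl c p) -> False.
Proof.
  intros H Hdl Hp Hb Hle Heq.
  destruct (sp_hol H) as (L1 & L2 & HL).
  destruct (glued_sum_support _ _ _ p H Hp) as (th & E & Near).
  pose (K := fun t => Cexp (L t - (0, th))%C).
  pose (K1 := fun t => (L1 t * K t)%C).
  assert (HK : forall t, 0 < snd t -> hol_derive K t (K1 t)).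
  { intros t Ht. unfold K1, K. eapply hol_derive_value.
    - apply hol_derive_exp, hol_derive_plus; [apply (HL t Ht)|apply (hol_derive_const (- (0, th))%C)].
    - unfold Cminus. ring. }
  assert (Val : forall t, 0 < snd t ->
    Cmod (K t) + Cmod (K t - 1)%C = focal_sum (r t) (cos (snd (L t) - th))).
  { intros t Ht. unfold K. rewrite focal_sum_Cexp, <- (sp_mod H t); [reflexivity| |].
    - unfold upper_half; lra.
    - now apply (sp_pos H). }
  assert (I := interior_locally p Hp).
  apply (no_touching K K1 (L2 p * K p + L1 p * K1 p)%C p al dl c); auto.
  - intros e. generalize (line_locally _ p e I); apply filter_imp.
    intros x Hx; now apply HK.
  - apply hol_derive_mult; [apply (HL p Hp)|now apply HK].
  - intros Z. 
    exact (Cexp_neq_0 _ Z).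
  - intros e. apply (line_locally (fun q => Cmod (K q) + Cmod (K q - 1)%C <= cosh (barrier al dl c q))).
    generalize (filter_and _ _ I (filter_and _ _ Hle Near)). apply filter_imp.
    intros q [Q1 [Q2 Q3]].
    assert (U : upper_half q) by (unfold upper_half; lra).
    specialize (Q3 U). rewrite Val by exact Q1.
    eapply Rle_trans; [|exact Q2]. apply focal_sum_antitone; [|exact Q3].
    now apply (sp_nonneg H).
  - rewrite Val by exact Hp. rewrite <- E. exact Heq.
Qed.

(** Maximum principle on a strip. The constant [2 * dl * (Y * Y)] compensates the negative term of
    the barrier, which is then at least [(nu + eps) * y + dl * x^2]. A positive maximum of the
    excess cannot occur on the axis, where the glued sum is 1, nor at height [Y], by assumption, nor
    far out, where [dl * x^2] wins over a bounded function; inside it contradicts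
    [no_interior_excess]. *)
Lemma glued_sum_strip (nu : R) (L : C -> C) (r : C -> R) (eps dl Y : R) (t : C) :
  stepped_phase nu L r -> 0 <= nu -> 0 < eps -> 0 < dl ->
  (forall x : R, glued_sum L r (x, Y) <= cosh ((nu + eps) * Y)) ->
  0 <= snd t <= Y ->
  acosh (glued_sum L r t) <= barrier (nu + eps) dl (2 * dl * (Y * Y)) t.
Proof.
  intros H Hnu He Hdl Top Ht.
  set (c := 2 * dl * (Y * Y)).
  assert (Bge : forall q : C, 0 <= snd q <= Y ->
     (nu + eps) * snd q + dl * (fst q * fst q) <= barrier (nu + eps) dl c q).
  { intros q Hq. unfold barrier, c. assert (snd q * snd q <= Y * Y) by nra. nra. }
  assert (Bpos : forall q : C, 0 <= snd q <= Y -> 0 <= barrier (nu + eps) dl c q).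
  { intros q Hq. specialize (Bge q Hq). assert (0 <= dl * (fst q * fst q)) by nra. nra. }
  destruct (sp_growth H) as (M & HM).
  set (Bd := 1 + 2 * (Rabs M * exp (nu * Y))).
  assert (HBd : forall q : C, 0 <= snd q <= Y -> glued_sum L r q <= Bd).
  { intros q Hq. assert (U : upper_half q) by (unfold upper_half; lra).
    eapply Rle_trans; [apply (glued_sum_le _ _ _ q H U)|]. unfold Bd.
    apply Rplus_le_compat_l, Rmult_le_compat_l; [lra|].
    eapply Rle_trans; [apply (HM q U)|].
    eapply Rle_trans; [apply Rmult_le_compat_r; [left; apply exp_pos|apply Rle_abs]|].
    apply Rmult_le_compat_l; [apply Rabs_pos|].
    destruct (Req_dec (nu * snd q) (nu * Y)) as [->|N]; [lra|].
    left; apply exp_increasing. nra. }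
  assert (Bd1 : 1 <= Bd).
  { unfold Bd. assert (0 <= Rabs M) by apply Rabs_pos.
    assert (0 < exp (nu * Y)) by apply exp_pos. nra. }
  assert (Far : forall q : C, 0 <= snd q <= Y -> 2 * Bd <= dl * (fst q * fst q) ->
    acosh (glued_sum L r q) <= barrier (nu + eps) dl c q).
  { intros q Hq F. assert (U : upper_half q) by (unfold upper_half; lra).
    apply acosh_le_iff; [eapply glued_sum_ge_1; eassumption|now apply Bpos|].
    eapply Rle_trans; [now apply HBd|].
    eapply Rle_trans; [|apply cosh_ge_linear].
    specialize (Bge q Hq). assert (0 <= (nu + eps) * snd q) by nra. lra. }
  (* The [+ 1] gives [1 <= X], so that [X * X] is at least [X] and hence at least [2 * Bd / dl]. *)
  set (X := Rmax (Rabs (fst t)) (2 * Bd / dl + 1)).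
  assert (X1 : Rabs (fst t) <= X) by apply Rmax_l.
  assert (X2 : 2 * Bd / dl + 1 <= X) by apply Rmax_r.
  assert (X3 : 0 < 2 * Bd / dl) by (apply Rdiv_lt_0_compat; lra).
  assert (X4 : 2 * Bd <= dl * (X * X)).
  { assert (2 * Bd / dl <= X * X) by nra.
    apply Rmult_le_compat_l with (r := dl) in H0; [|lra].
    replace (dl * (2 * Bd / dl)) with (2 * Bd) in H0 by (field; lra). exact H0. }
  destruct (upper_semicontinuous_max
    (fun q => acosh (glued_sum L r q) - barrier (nu + eps) dl c q) X Y)
    as (p & P1 & P2 & P3); [lra|lra| |].
  { intros q Hq. apply upper_semicontinuous_sub_acosh; [|exact Hq|].
    - intros z Hz. eapply glued_sum_ge_1; eassumption.
    - eapply glued_sum_upper; eassumption. }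
  destruct (Rle_or_lt (acosh (glued_sum L r p) - barrier (nu + eps) dl c p) 0) as [N|Pos].
  { specialize (P3 t X1 Ht). lra. }
  exfalso.
  set (lam := acosh (glued_sum L r p) - barrier (nu + eps) dl c p) in *.
  (* Raising the barrier by its maximal deficit [lam] makes it touch the glued sum from above at
     [p]. *)
  assert (Sh : forall q, barrier (nu + eps) dl (c + lam) q = barrier (nu + eps) dl c q + lam).
  { intros q; unfold barrier; ring. }
  assert (Up : upper_half p) by (unfold upper_half; lra).
  assert (Gp := glued_sum_ge_1 _ _ _ p H Up).
  assert (p0 : 0 < snd p).
  { destruct (Rle_lt_or_eq_dec 0 (snd p) (proj1 P2)) as [L0|E0]; [exact L0|exfalso].
    assert (Q := Bpos p P2). unfold lam in Pos.
    rewrite (surjective_pairing p), <- E0 in Pos at 1.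
    rewrite (glued_sum_axis _ _ _ _ H) in Pos.
    rewrite <- cosh_0, acosh_cosh in Pos; lra. }
  assert (pY : snd p < Y).
  { destruct (Rle_lt_or_eq_dec (snd p) Y (proj2 P2)) as [L0|E0]; [exact L0|exfalso].
    assert (Q : acosh (glued_sum L r p) <= (nu + eps) * Y).
    { apply acosh_le_iff; [exact Gp|nra|].
      rewrite (surjective_pairing p), E0. apply Top. }
    assert (Q2 := Bge p P2). assert (0 <= dl * (fst p * fst p)) by nra.
    unfold lam in Pos. rewrite E0 in Q2. lra. }
  assert (pX : Rabs (fst p) < X).
  { destruct (Rle_lt_or_eq_dec _ X P1) as [L0|E0]; [exact L0|exfalso].
    assert (Q : acosh (glued_sum L r p) <= barrier (nu + eps) dl c p).
    { apply Far; [exact P2|].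
      replace (fst p * fst p) with (X * X); [exact X4|].
      rewrite <- E0, <- Rabs_mult. apply Rabs_right. nra. }
    unfold lam in Pos. lra. }
  assert (Near : locally p (fun q => Rabs (fst q) <= X /\ 0 <= snd q <= Y)).
  { assert (R0 : 0 < Rmin (X - Rabs (fst p)) (Rmin (snd p) (Y - snd p))).
    { repeat apply Rmin_case; lra. }
    exists (mkposreal _ R0). intros q [Q1 Q2].
    apply ball_Rabs_lt in Q1. apply ball_Rabs_lt in Q2. simpl in Q1, Q2.
    assert (M1 := Rmin_l (X - Rabs (fst p)) (Rmin (snd p) (Y - snd p))).
    assert (M2 := Rmin_r (X - Rabs (fst p)) (Rmin (snd p) (Y - snd p))).
    assert (M3 := Rmin_l (snd p) (Y - snd p)). assert (M4 := Rmin_r (snd p) (Y - snd p)).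
    apply Rabs_lt_between in Q2. split; [|lra].
    replace (fst q) with ((fst q - fst p) + fst p) by ring.
    eapply Rle_trans; [apply Rabs_triang|lra]. }
  apply (no_interior_excess nu L r (nu + eps) dl (c + lam) p H Hdl p0).
  - rewrite Sh. assert (Q := Bpos p P2). lra.
  - revert Near; apply filter_imp. intros q [Q1 Q2].
    assert (U : upper_half q) by (unfold upper_half; lra).
    assert (Q := Bpos q Q2). rewrite Sh.
    apply acosh_le_iff; [eapply glued_sum_ge_1; eassumption|lra|].
    specialize (P3 q Q1 Q2). cbv beta in P3. fold lam in P3. lra.
  - rewrite Sh. unfold lam.
    replace (barrier (nu + eps) dl c p + (acosh (glued_sum L r p) - barrier (nu + eps) dl c p))
      with (acosh (glued_sum L r p)) by ring.
    now rewrite cosh_acosh.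
Qed.

(** A Phragmen-Lindelof argument: the extra rate [eps] absorbs the constant of the growth bound at a
    large height [Y]; then [eps] and [dl] are made negligible at the given point. *)
Lemma glued_sum_bound (nu : R) (L : C -> C) (r : C -> R) (t : C) :
  stepped_phase nu L r -> 0 <= nu -> upper_half t ->
  glued_sum L r t <= cosh (nu * snd t).
Proof.
  intros H Hnu Ht. unfold upper_half in Ht.
  assert (G1 := glued_sum_ge_1 _ _ _ t H Ht).
  apply acosh_le_iff; [exact G1|nra|].
  apply le_epsilon. intros e0 He0.
  set (eps := e0 / 2 / (1 + snd t)).
  assert (He : 0 < eps) by (unfold eps; apply Rdiv_lt_0_compat; lra).
  destruct (sp_growth H) as (M & HM).
  (* So that [exp (eps * Y) >= 2 + 4 * Rabs M]. Half of [exp ((nu + eps) * Y)] then dominates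
     [1 + 2 * Rabs M * exp (nu * Y)], the bound for the glued sum at this height. *)
  set (Y := Rmax (snd t) ((1 + 4 * Rabs M) / eps)).
  assert (Y1 : snd t <= Y) by apply Rmax_l.
  assert (Y2 : (1 + 4 * Rabs M) / eps <= Y) by apply Rmax_r.
  assert (M0 := Rabs_pos M).
  assert (Top : forall x : R, glued_sum L r (x, Y) <= cosh ((nu + eps) * Y)).
  { intros x. assert (U : upper_half (x, Y)) by (unfold upper_half; simpl; lra).
    eapply Rle_trans; [apply (glued_sum_le _ _ _ _ H U)|].
    assert (R1 := HM _ U). simpl in R1.
    assert (R2 : r (x, Y) <= Rabs M * exp (nu * Y)).
    { eapply Rle_trans; [exact R1|]. apply Rmult_le_compat_r; [left; apply exp_pos|apply Rle_abs]. }
    unfold cosh. assert (Z := exp_pos (- (nu * Y + eps * Y))).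
    rewrite Rmult_plus_distr_r, exp_plus.
    assert (A := exp_ineq1_le (eps * Y)).
    assert (B : 1 + 4 * Rabs M <= eps * Y).
    { apply Rmult_le_compat_l with (r := eps) in Y2; [|lra].
      replace (eps * ((1 + 4 * Rabs M) / eps)) with (1 + 4 * Rabs M) in Y2 by (field; lra). lra. }
    assert (D : 1 <= exp (nu * Y)).
    { eapply Rle_trans; [|apply exp_ineq1_le]. nra. }
    assert (exp (nu * Y) * (2 + 4 * Rabs M) <= exp (nu * Y) * exp (eps * Y)).
    { apply Rmult_le_compat_l; lra. }
    nra. }
  (* Chosen after [Y]: the quadratic part of the barrier costs at most [e0 / 2] at [t], and
     [eps * snd t] costs the other half. *)
  set (dl := e0 / 2 / (1 + (fst t * fst t + 2 * (Y * Y)))).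
  assert (Dp : 0 < 1 + (fst t * fst t + 2 * (Y * Y))) by nra.
  assert (Hdl : 0 < dl) by (unfold dl; apply Rdiv_lt_0_compat; lra).
  eapply Rle_trans; [apply (glued_sum_strip nu L r eps dl Y t H Hnu He Hdl Top (conj Ht Y1))|].
  unfold barrier.
  assert (E1 : eps * snd t <= e0 / 2).
  { replace (e0 / 2) with (eps * (1 + snd t)) by (unfold eps; field; lra). nra. }
  assert (E2 : dl * (fst t * fst t + 2 * (Y * Y)) <= e0 / 2).
  { replace (e0 / 2) with (dl * (1 + (fst t * fst t + 2 * (Y * Y)))) by (unfold dl; field; lra). nra. }
  assert (0 <= dl * (snd t * snd t)) by nra.
  lra.
Qed.

(** * Passage to the axis: the ellipse and its second-order limit *)

Lemma ellipse_bound (k : C) (c : R) :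
  Cmod k + Cmod (k - 1)%C <= c ->
  4 * (snd k * snd k) * (c * c)
  <= (c * c - 1) * (c * c - (2 * fst k - 1) * (2 * fst k - 1)).
Proof.
  intros H. assert (r0 := Cmod_ge_0 k). assert (D0 := Cmod_ge_0 (k - 1)%C).
  assert (Er := Cmod_sqr k). assert (ED := Cmod_sqr (k - 1)%C).
  assert (Tr := Cmod_triangle (k - 1)%C 1%C). rewrite Cmod_1 in Tr.
  replace (k - 1 + 1)%C with k in Tr by ring.
  assert (Ts := Cmod_triangle k (- (k - 1))%C). rewrite Cmod_opp in Ts.
  replace (k + - (k - 1))%C with (RtoC 1) in Ts by ring. rewrite Cmod_1 in Ts.
  assert (Tq := Cmod_triangle (- k)%C 1%C). rewrite Cmod_opp, Cmod_1 in Tq.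
  replace (- k + 1)%C with (- (k - 1))%C in Tq by ring. rewrite Cmod_opp in Tq.
  unfold Cdot in *; simpl in *.
  set (r := Cmod k) in *. set (D := Cmod (k - 1)%C) in *.
  set (a := fst k) in *. set (b := snd k) in *.
  (* Elliptic coordinates [r + D] and [r - D] for the foci 0 and 1. In them the claim factors as
     [(c^2 - (r + D)^2) * (c^2 - (r - D)^2) >= 0]. Cleared of denominators it remains meaningful for
     the degenerate ellipse [c = 1]. *)
  assert (E1 : 2 * a - 1 = (r + D) * (r - D)) by nra.
  assert (E2 : 4 * (b * b) = ((r + D) * (r + D) - 1) * (1 - (r - D) * (r - D))).
  { replace (4 * (b * b)) with (4 * (r * r) - (2 * a - 1 + 1) * (2 * a - 1 + 1)) by nra.
    rewrite E1. ring. }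
  rewrite E1, E2.
  assert (F : 0 <= (c * c - (r + D) * (r + D)) * (c * c - (r - D) * (r - D))).
  { apply Rmult_le_pos; nra. }
  nra.
Qed.

(** Quotients extended continuously to 0: they allow an inequality between second-order quantities
    to be divided by [y * y] when only first derivatives are at hand. *)
Lemma derive_factor (f : R -> R) (l : R) : is_derive f 0 l -> f 0 = 0 ->
  exists phi : R -> R, (forall y, f y = y * phi y) /\ phi 0 = l /\ continuous phi 0.
Proof.
  intros H Z. exists (fun y => if Req_EM_T y 0 then l else f y / y). repeat split.
  - intros y; destruct (Req_EM_T y 0) as [->|N]; [rewrite Z; ring|field; exact N].
  - destruct (Req_EM_T 0 0); tauto.
  - apply is_derive_Reals in H. apply filterlim_locally; intros eps.
    destruct (H eps (cond_pos eps)) as (d & Hd). exists d. intros y Hy.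
    apply ball_Rabs_lt in Hy. apply Rabs_lt_ball. rewrite Rminus_0_r in Hy.
    destruct (Req_EM_T 0 0) as [_|N0]; [|tauto].
    destruct (Req_EM_T y 0) as [E|N].
    + rewrite Rminus_diag, Rabs_R0. apply cond_pos.
    + specialize (Hd y N). rewrite Rplus_0_l, Z, Rminus_0_r in Hd.
      now apply Hd.
Qed.

Lemma continuous_le_right (u v : R -> R) :
  continuous u 0 -> continuous v 0 ->
  locally 0 (fun y => 0 < y -> u y <= v y) -> u 0 <= v 0.
Proof.
  intros Cu Cv H. apply le_epsilon; intros eps He.
  assert (e2 : 0 < eps / 2) by lra.
  assert (A := proj1 (filterlim_locally _ _) Cu (mkposreal _ e2)).
  assert (B := proj1 (filterlim_locally _ _) Cv (mkposreal _ e2)).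
  destruct (filter_and _ _ H (filter_and _ _ A B)) as (d & Hd).
  assert (dp := cond_pos d).
  destruct (Hd (d / 2)) as [X [Y Z]].
  { apply Rabs_lt_ball. rewrite Rabs_right; lra. }
  apply ball_Rabs_lt, Rabs_lt_between in Y. apply ball_Rabs_lt, Rabs_lt_between in Z.
  simpl in Y, Z. lra.
Qed.

(* In terms of [h = exp (L / 2)] this is [h'^2 + (nu / 2)^2 h^2 <= (nu / 2)^2]. *)
Theorem stepped_phase_bernstein (nu : R) (L : C -> C) (r : C -> R) (x0 l : R) :
  stepped_phase nu L r -> 0 <= nu -> r (x0, 0) <> 0 ->
  hol_derive L (x0, 0) (RtoC l) ->
  r (x0, 0) * (l * l + nu * nu) <= nu * nu.
Proof.
  intros H Hnu Hr HL.
  assert (U0 : upper_half (x0, 0)) by (unfold upper_half; simpl; lra).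
  set (th := snd (L (x0, 0))).
  set (r0 := r (x0, 0)) in *.
  assert (r0p : 0 < r0).
  { assert (Q := sp_nonneg H _ U0). fold r0 in Q. lra. }
  assert (El : forall y : R, ((x0, 0%R) + RtoC y * Ci)%C = (x0, y)).
  { intros y; apply injective_projections; simpl; ring. }
  (* The branch of [K] rotated by the phase at [x0], followed vertically: it starts at the real
     point [r0] with velocity [i * l * r0]. *)
  pose (k := fun y : R => Cexp (L ((x0, 0%R) + RtoC y * Ci) - (0%R, th))%C).
  assert (k0 : k 0 = RtoC r0).
  { unfold k. rewrite line_at_0.
    assert (E := sp_mod H _ U0 Hr). fold r0 in E. rewrite E.
    unfold Cexp, Re, Im; simpl.
    replace (fst (L (x0, 0)) + - 0) with (fst (L (x0, 0))) by ring.
    replace (snd (L (x0, 0)) + - th) with 0 by (unfold th; ring).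
    rewrite cos_0, sin_0. apply injective_projections; simpl; ring. }
  assert (Dk : curve_derive k 0 (0, l * r0)).
  { eapply curve_derive_value.
    - apply curve_derive_exp, curve_derive_plus; [apply HL|apply (curve_derive_const (- (0%R, th))%C)].
    - cbv beta. unfold k in k0. unfold Cminus in k0 |- *.
      rewrite k0. apply injective_projections; simpl; ring. }
  assert (Bound : locally 0 (fun y => 0 < y -> Cmod (k y) + Cmod (k y - 1)%C <= cosh (nu * y))).
  { assert (A := sp_arg H _ U0 Hr).
    apply (locally_Rabs_lt _ _ _ _ PI_RGT_0) in A.
    generalize (line_locally _ _ Ci A). apply filter_imp. intros y Hy yp.
    assert (U : upper_half (@pair R R x0 y)) by (unfold upper_half; simpl; lra).
    unfold k. rewrite El in Hy |- *. specialize (Hy U). fold th in Hy.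
    rewrite focal_sum_Cexp. rewrite <- (sp_mod H _ U).
    2:{ apply (sp_pos H). exact yp. }
    assert (G := glued_sum_bound nu L r _ H Hnu U). unfold glued_sum in G.
    rewrite (nearest_cos_eq _ _ th) in G; [exact G| | |exact Hy].
    - eapply axis_phase_spaced; eassumption.
    - exists x0. split; [exact Hr|reflexivity]. }
  destruct Dk as [D1 D2]. simpl in D1, D2.
  destruct (derive_factor (fun y => snd (k y)) (l * r0) D2) as (phi & P1 & P2 & P3).
  { rewrite k0; reflexivity. }
  destruct (derive_factor (fun y => sinh (nu * y)) nu) as (psi & Q1 & Q2 & Q3).
  { unfold sinh. auto_derive; trivial. rewrite Rmult_0_r, Ropp_0, exp_0. field. }
  { rewrite Rmult_0_r. apply sinh_0. }
  assert (Cc : continuous (fun y => cosh (nu * y)) 0).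
  { apply (ex_derive_continuous (fun y => cosh (nu * y))). unfold cosh. auto_derive; trivial. }
  assert (Cr : continuous (fun y => fst (k y)) 0).
  { apply (ex_derive_continuous (fun y => fst (k y))). eexists; exact D1. }
  assert (Mul : forall u v : R -> R, continuous u 0 -> continuous v 0 ->
      continuous (fun t => u t * v t) 0) by (intros; now apply (continuous_mult (K := R_AbsRing))).
  assert (Sub : forall u v : R -> R, continuous u 0 -> continuous v 0 ->
      continuous (fun t => u t - v t) 0) by (intros; now apply (continuous_minus (V := R_NormedModule))).
  assert (Cst : forall a : R, continuous (fun _ : R => a) 0) by (intros; apply continuous_const).
  assert (Lim := continuous_le_right
    (fun y => 4 * (phi y * phi y) * (cosh (nu * y) * cosh (nu * y)))
    (fun y => psi y * psi y * (cosh (nu * y) * cosh (nu * y)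
                 - (2 * fst (k y) - 1) * (2 * fst (k y) - 1)))).
  cbv beta in Lim. rewrite P2, Q2, k0, Rmult_0_r, cosh_0 in Lim. change (fst (RtoC r0)) with r0 in Lim.
  (* The ellipse inequality for [c = cosh (nu * y)] has [Im k = y * phi y] on the left and
     [c^2 - 1 = (y * psi y)^2] on the right. Dividing by [y^2] and letting [y] tend to 0 leaves
     this; [1 - (2 * r0 - 1)^2 = 4 * r0 * (1 - r0)] then gives the claim. *)
  assert (Fin : 4 * (l * r0 * (l * r0)) * (1 * 1)
     <= nu * nu * (1 * 1 - (2 * r0 - 1) * (2 * r0 - 1))).
  { apply Lim.
    - apply Mul; [apply Mul; [apply Cst|now apply Mul]|now apply Mul].
    - apply Mul; [now apply Mul|]. apply Sub; [now apply Mul|].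
      assert (continuous (fun y => 2 * fst (k y) - 1) 0).
      { apply (Sub (fun y => 2 * fst (k y)) (fun _ => 1)); [|apply Cst].
        apply (Mul (fun _ => 2)); [apply Cst|exact Cr]. }
      now apply Mul.
    - revert Bound; apply filter_imp. intros y B yp. specialize (B yp).
      apply ellipse_bound in B. rewrite P1 in B.
      assert (S := cosh_sqr (nu * y)). rewrite Q1 in S.
      replace (cosh (nu * y) * cosh (nu * y) - 1) with (y * psi y * (y * psi y)) in B by lra.
      apply Rmult_le_reg_l with (y * y); [nra|].
      eapply Rle_trans; [|eapply Rle_trans; [exact B|]]; right; ring. }
  apply Rmult_le_reg_l with r0; [exact r0p|]. nra.
Qed.

(** * Complex exponential, logarithm and powers *)

Lemma Cexp_plus (u v : C) : Cexp (u + v)%C = (Cexp u * Cexp v)%C.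
Proof.
  unfold Cexp, Re, Im; simpl. rewrite exp_plus, cos_plus, sin_plus.
  apply injective_projections; simpl; ring.
Qed.

Lemma Cexp_0 : Cexp 0%C = 1%C.
Proof.
  unfold Cexp, Re, Im; simpl. rewrite exp_0, cos_0, sin_0.
  apply injective_projections; simpl; ring.
Qed.

Lemma Cexp_opp (z : C) : Cexp (- z)%C = (/ Cexp z)%C.
Proof.
  assert (E := Cexp_plus z (- z)%C). replace (z + - z)%C with (RtoC 0) in E by ring.
  rewrite Cexp_0 in E. assert (N := Cexp_neq_0 z).
  transitivity (/ Cexp z * (Cexp z * Cexp (- z)))%C; [field; exact N|].
  rewrite <- E. ring.
Qed.

Lemma exp_Clog (w : C) : w <> 0%C -> exp (fst (Clog w)) = Cmod w.
Proof.
  intros H. apply Cmod_gt_0 in H. assert (E := Cmod_sqr w). unfold Cdot in E.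
  unfold Clog; simpl. rewrite <- E.
  rewrite ln_mult by exact H. replace ((ln (Cmod w) + ln (Cmod w)) / 2) with (ln (Cmod w)) by field.
  now apply exp_ln.
Qed.

Lemma Re_pos_neq_0 (w : C) : 0 < fst w -> w <> 0%C.
Proof. intros H ->; simpl in H; lra. Qed.

Lemma Cexp_Clog (w : C) : 0 < fst w -> Cexp (Clog w) = w.
Proof.
  intros H. assert (N := Re_pos_neq_0 w H).
  assert (P := exp_Clog w N). assert (E := Cmod_sqr w).
  assert (Q := proj1 (Cmod_gt_0 w) N).
  unfold Cexp, Re, Im. rewrite P. change (snd (Clog w)) with (atan (snd w / fst w)). rewrite cos_atan, sin_atan.
  destruct w as [a b]; unfold Cdot in E; simpl in *.
  assert (S : sqrt (1 + Rsqr (b / a)) = Cmod (a, b) / a).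
  { rewrite <- (sqrt_square (Cmod (a, b) / a)).
    - f_equal. unfold Rsqr. apply Rmult_eq_reg_r with (a * a); [|nra].
      transitivity (a * a + b * b); [field; lra|rewrite <- E; field; lra].
    - apply Rmult_le_pos; [lra|left; now apply Rinv_0_lt_compat]. }
  rewrite S. apply injective_projections; simpl; field; lra.
Qed.

Lemma filterlim_Cplus {T : Type} (F : (T -> Prop) -> Prop) {FF : Filter F} (f g : T -> C) (a b : C) :
  filterlim f F (locally a) -> filterlim g F (locally b) ->
  filterlim (fun x => f x + g x)%C F (locally (a + b)%C).
Proof.
  rewrite !filterlim_C by exact FF. intros [A1 A2] [B1 B2]; split; now apply filterlim_Rplus.
Qed.

Lemma filterlim_Copp {T : Type} (F : (T -> Prop) -> Prop) {FF : Filter F} (f : T -> C) (a : C) :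
  filterlim f F (locally a) -> filterlim (fun x => - f x)%C F (locally (- a)%C).
Proof.
  rewrite !filterlim_C by exact FF. intros [A1 A2]; split;
    (apply (filterlim_R_comp F _ Ropp); [assumption|auto_derive; trivial]).
Qed.

Lemma filterlim_Cmult {T : Type} (F : (T -> Prop) -> Prop) {FF : Filter F} (f g : T -> C) (a b : C) :
  filterlim f F (locally a) -> filterlim g F (locally b) ->
  filterlim (fun x => f x * g x)%C F (locally (a * b)%C).
Proof.
  rewrite !filterlim_C by exact FF. intros [A1 A2] [B1 B2]; split; simpl.
  - apply (filterlim_Rplus F (fun x => fst (f x) * fst (g x)) (fun x => - (snd (f x) * snd (g x)))
      (fst a * fst b) (- (snd a * snd b))); [now apply filterlim_Rmult|].
    apply (filterlim_R_comp F _ Ropp); [now apply filterlim_Rmult|auto_derive; trivial].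
  - apply (filterlim_Rplus F (fun x => fst (f x) * snd (g x)) (fun x => snd (f x) * fst (g x)));
      now apply filterlim_Rmult.
Qed.

Lemma filterlim_one_minus {T : Type} (F : (T -> Prop) -> Prop) {FF : Filter F} (f : T -> C) (a d : C) :
  filterlim f F (locally a) -> filterlim (fun x => 1 - d * f x)%C F (locally (1 - d * a)%C).
Proof.
  intros H. unfold Cminus. apply (filterlim_Cplus F); [apply filterlim_const|].
  apply (filterlim_Copp F), (filterlim_Cmult F); [apply filterlim_const|exact H].
Qed.

Lemma filterlim_Cinv {T : Type} (F : (T -> Prop) -> Prop) {FF : Filter F} (f : T -> C) (a : C) :
  filterlim f F (locally a) -> a <> 0%C -> filterlim (fun x => / f x)%C F (locally (/ a)%C).
Proof.
  rewrite !filterlim_C by exact FF. intros [A1 A2] N.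
  assert (P : fst a ^ 2 + snd a ^ 2 <> 0).
  { intros E; apply N. apply injective_projections; simpl; nra. }
  assert (S : filterlim (fun x => / (fst (f x) ^ 2 + snd (f x) ^ 2)) F
     (locally (/ (fst a ^ 2 + snd a ^ 2)))).
  { apply (filterlim_R_comp F (fun x => fst (f x) ^ 2 + snd (f x) ^ 2) Rinv).
    - apply (filterlim_Rplus F);
      (apply (filterlim_R_comp F _ (fun y => y ^ 2)); [assumption|auto_derive; trivial]).
    - auto_derive; exact P. }
  split; simpl; apply (filterlim_Rmult F); try assumption.
  apply (filterlim_R_comp F _ Ropp); [assumption|auto_derive; trivial].
Qed.

Lemma filterlim_Cexp {T : Type} (F : (T -> Prop) -> Prop) {FF : Filter F} (f : T -> C) (a : C) :
  filterlim f F (locally a) -> filterlim (fun x => Cexp (f x)) F (locally (Cexp a)).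
Proof.
  rewrite !filterlim_C by exact FF. intros [A1 A2].
  split; unfold Cexp, Re, Im; simpl; apply (filterlim_Rmult F);
    (eapply filterlim_R_comp; [assumption|auto_derive; trivial]).
Qed.

Lemma filterlim_Clog {T : Type} (F : (T -> Prop) -> Prop) {FF : Filter F} (f : T -> C) (a : C) :
  filterlim f F (locally a) -> 0 < fst a -> filterlim (fun x => Clog (f x)) F (locally (Clog a)).
Proof.
  rewrite !filterlim_C by exact FF. intros [A1 A2] H.
  split; unfold Clog; simpl.
  - apply (filterlim_R_comp F (fun x => fst (f x) * fst (f x) + snd (f x) * snd (f x)) (fun y => ln y / 2)).
    + apply (filterlim_Rplus F); now apply filterlim_Rmult.
    + auto_derive. nra.
  - apply (filterlim_R_comp F (fun x => snd (f x) / fst (f x)) atan).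
    + apply (filterlim_Rmult F); [assumption|].
      apply (filterlim_R_comp F _ Rinv); [assumption|auto_derive; lra].
    + auto_derive; trivial.
Qed.

Lemma filterlim_Cmod {T : Type} (F : (T -> Prop) -> Prop) {FF : Filter F} (f : T -> C) (a : C) :
  filterlim f F (locally a) -> filterlim (fun x => Cmod (f x)) F (locally (Cmod a)).
Proof.
  rewrite !filterlim_C by exact FF. intros [A1 A2]. unfold Cmod.
  apply (filterlim_comp _ _ _ (fun x => fst (f x) ^ 2 + snd (f x) ^ 2) sqrt F
    (locally (fst a ^ 2 + snd a ^ 2))).
  - apply (filterlim_Rplus F);
      (apply (filterlim_R_comp F _ (fun y => y ^ 2)); [assumption|auto_derive; trivial]).
  - apply continuous_sqrt.
Qed.

Lemma filterlim_Cpow {T : Type} (F : (T -> Prop) -> Prop) {FF : Filter F} (f : T -> C) (a : C) (m : nat) :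
  filterlim f F (locally a) -> filterlim (fun x => f x ^ m)%C F (locally (a ^ m)%C).
Proof.
  intros H; induction m as [|m IH].
  - apply filterlim_const.
  - rewrite Cpow_S. apply filterlim_ext with (fun x => f x * f x ^ m)%C.
    { intros x; now rewrite Cpow_S. }
    now apply filterlim_Cmult.
Qed.

(* The principal power, extended by [0 ^ 0 = 1] and [0 ^ s = 0]. *)
Definition Cpower (w : C) (s : R) : C :=
  if Ceq_dec w 0%C then (if Req_EM_T s 0 then 1%C else 0%C) else Cexp (RtoC s * Clog w)%C.

Definition right_half (w : C) : Prop := w = 0%C \/ 0 < fst w.

Lemma Cpower_neq_0_eq (w : C) (s : R) : w <> 0%C -> Cpower w s = Cexp (RtoC s * Clog w)%C.
Proof. intros H; unfold Cpower; destruct Ceq_dec; tauto. Qed.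

Lemma Cpower_0_r (w : C) : Cpower w 0 = 1%C.
Proof.
  unfold Cpower. destruct Ceq_dec; [destruct Req_EM_T; tauto|].
  replace (RtoC 0 * Clog w)%C with (RtoC 0) by ring. apply Cexp_0.
Qed.

Lemma Cpower_0_l (s : R) : s <> 0 -> Cpower 0%C s = 0%C.
Proof.
  intros H. unfold Cpower. destruct Ceq_dec; [|tauto]. destruct Req_EM_T; tauto.
Qed.

Lemma Cpower_neq_0 (w : C) (s : R) : w <> 0%C -> Cpower w s <> 0%C.
Proof. intros H; rewrite Cpower_neq_0_eq by exact H; apply Cexp_neq_0. Qed.

(** Holds for every nonzero [w]: the real part of [Clog] is [ln |w|] everywhere, only its argument
    is confined to the right half plane. *)
Lemma Cmod_Cpower (w : C) (s : R) : w <> 0%C -> Cmod (Cpower w s) = exp (s * ln (Cmod w)).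
Proof.
  intros H. rewrite Cpower_neq_0_eq, Cmod_Cexp by exact H. simpl.
  assert (E := exp_Clog w H). apply (f_equal ln) in E. rewrite ln_exp in E.
  rewrite <- E. unfold Clog; simpl. f_equal; ring.
Qed.

Lemma filterlim_Cpower {T : Type} (F : (T -> Prop) -> Prop) {FF : Filter F} (f : T -> C) (a : C) (s : R) :
  filterlim f F (locally a) -> right_half a -> 0 <= s ->
  filterlim (fun x => Cpower (f x) s) F (locally (Cpower a s)).
Proof.
  intros H [->|Ha] Hs.
  - destruct (Req_dec s 0) as [->|Ns].
    + rewrite Cpower_0_r. apply filterlim_ext with (fun _ => RtoC 1).
      { intros x; now rewrite Cpower_0_r. }
      apply filterlim_const.
    + rewrite Cpower_0_l by exact Ns.
      assert (A := filterlim_Cmod F f 0%C H). rewrite Cmod_0 in A.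
      assert (B : forall eps : posreal, F (fun x => Cmod (Cpower (f x) s) < eps)).
      { intros eps. assert (P : 0 < exp (ln eps / s)) by apply exp_pos.
        generalize (proj1 (filterlim_locally _ _) A (mkposreal _ P)). apply filter_imp.
        intros x Hx. apply ball_Rabs_lt in Hx. simpl in Hx.
        rewrite Rminus_0_r, Rabs_right in Hx by (apply Rle_ge, Cmod_ge_0).
        destruct (Ceq_dec (f x) 0%C) as [Z|Z].
        - rewrite Z, Cpower_0_l, Cmod_0 by exact Ns. apply cond_pos.
        - rewrite Cmod_Cpower by exact Z. apply Cmod_gt_0 in Z.
          rewrite <- (exp_ln eps (cond_pos eps)). apply exp_increasing.
          apply ln_increasing in Hx; [|exact Z]. rewrite ln_exp in Hx.
          apply Rmult_lt_compat_l with (r := s) in Hx; [|lra].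
          replace (s * (ln eps / s)) with (ln eps) in Hx by (field; lra). exact Hx. }
      apply filterlim_locally; intros eps. generalize (B eps). apply filter_imp.
      intros x Hx. assert (Q := Rmax_Cmod (Cpower (f x) s)).
      assert (Q1 := Rmax_l (Rabs (fst (Cpower (f x) s))) (Rabs (snd (Cpower (f x) s)))).
      assert (Q2 := Rmax_r (Rabs (fst (Cpower (f x) s))) (Rabs (snd (Cpower (f x) s)))).
      split; apply Rabs_lt_ball; simpl; rewrite Rminus_0_r; lra.
  - assert (N := Re_pos_neq_0 a Ha).
    rewrite Cpower_neq_0_eq by exact N.
    apply filterlim_ext_loc with (fun x => Cexp (RtoC s * Clog (f x))%C).
    + destruct (proj1 (filterlim_C F f a) H) as [H1 _].
      generalize (proj1 (filterlim_locally _ _) H1 (mkposreal _ Ha)). apply filter_imp.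
      intros x Hx. apply ball_Rabs_lt, Rabs_lt_between in Hx. simpl in Hx.
      rewrite Cpower_neq_0_eq; [reflexivity|]. intros E; rewrite E in Hx; simpl in Hx; lra.
    + apply (filterlim_Cexp F). apply (filterlim_Cmult F); [apply filterlim_const|].
      now apply filterlim_Clog.
Qed.

(** * Boundary phases of the factors *)

(* Sums and products over the indices [1 .. N]. *)
Fixpoint Rsum (u : nat -> R) (N : nat) : R :=
  match N with O => 0 | S n => Rsum u n + u (S n) end.

Fixpoint Csum (u : nat -> C) (N : nat) : C :=
  match N with O => RtoC 0 | S n => (Csum u n + u (S n))%C end.

Fixpoint Cprod (u : nat -> C) (N : nat) : C :=
  match N with O => RtoC 1 | S n => (Cprod u n * u (S n))%C end.

Definition circ (x : R) : C := Cexp (0, x).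

Lemma Cmod_circ (x : R) : Cmod (circ x) = 1.
Proof. unfold circ; rewrite Cmod_Cexp; simpl; apply exp_0. Qed.

Lemma circ_plus (x y : R) : circ (x + y) = (circ x * circ y)%C.
Proof.
  unfold circ; rewrite <- Cexp_plus; f_equal.
  apply injective_projections; simpl; ring.
Qed.

Lemma circ_opp (x : R) : circ (- x) = (/ circ x)%C.
Proof.
  unfold circ; rewrite <- Cexp_opp; f_equal.
  apply injective_projections; simpl; ring.
Qed.

Lemma circ_0 : circ 0 = 1%C.
Proof. exact Cexp_0. Qed.

Lemma circ_neq_0 (x : R) : circ x <> 0%C.
Proof. apply Cexp_neq_0. Qed.

Lemma circ_surjective (u : C) : Cmod u = 1 -> exists x : R, - PI <= x <= PI /\ u = circ x.
Proof.
  intros H. assert (E := Cmod_sqr u). rewrite H in E. unfold Cdot in E.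
  assert (B : -1 <= fst u <= 1) by nra.
  assert (S : sin (acos (fst u)) * sin (acos (fst u)) = snd u * snd u).
  { assert (Q := sin2_cos2 (acos (fst u))). unfold Rsqr in Q. rewrite cos_acos in Q by exact B. lra. }
  assert (T : snd u = sin (acos (fst u)) \/ snd u = - sin (acos (fst u))).
  { destruct (Req_dec (snd u) (sin (acos (fst u)))); [now left|right].
    assert (Z : (snd u - sin (acos (fst u))) * (snd u + sin (acos (fst u))) = 0) by nra.
    apply Rmult_integral in Z. lra. }
  assert (A := acos_bound (fst u)).
  destruct T as [T|T]; [exists (acos (fst u))|exists (- acos (fst u))];
    (split; [lra|]); apply injective_projections; unfold circ, Cexp, Re, Im; simpl;
    rewrite exp_0, ?cos_neg, ?sin_neg, ?cos_acos, ?T by exact B; ring.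
Qed.

Lemma Cconj_unit (u : C) : Cmod u = 1 -> Cconj u = (/ u)%C.
Proof.
  intros H. assert (E := Cmod_sqr u). rewrite H in E. unfold Cdot in E.
  apply injective_projections; unfold Cconj, Cinv; simpl;
    replace (fst u * (fst u * 1) + snd u * (snd u * 1)) with 1 by lra; field.
Qed.

Lemma circ_1_multiple (a : R) : circ (2 * a) = 1%C -> exists j : Z, a = IZR j * PI.
Proof.
  intros H. apply sin_eq_0_0.
  apply (f_equal fst) in H. unfold circ, Cexp, Re, Im in H; simpl in H.
  rewrite exp_0, Rmult_1_l, cos_2a_sin in H. nra.
Qed.

(** The reason for writing factors as [1 - d z]: when [|d z| <= 1] they never leave the domain of
    the principal logarithm, except at their zero. *)
Lemma Re_lt_1_of_unit_disk (u : C) : Cmod u <= 1 -> (1 - u)%C <> 0%C -> 0 < fst (1 - u)%C.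
Proof.
  intros H N. simpl. assert (E := Cmod_sqr u). unfold Cdot in E.
  assert (P := Cmod_ge_0 u).
  destruct (Rlt_or_le (fst u) 1) as [L|L]; [lra|exfalso; apply N].
  assert (fst u = 1) by nra. assert (snd u = 0) by nra.
  apply injective_projections; simpl; lra.
Qed.

Lemma right_half_one_minus (u : C) : Cmod u <= 1 -> right_half (1 - u)%C.
Proof.
  intros H. destruct (Ceq_dec (1 - u)%C 0%C) as [E|N]; [now left|right].
  now apply Re_lt_1_of_unit_disk.
Qed.

Lemma Clog_arg_bound (w : C) : Rabs (snd (Clog w)) < PI / 2.
Proof.
  unfold Clog; simpl. assert (H := atan_bound (snd w / fst w)).
  apply Rabs_lt_between; lra.
Qed.

Lemma Cexp_conj (z : C) : Cconj (Cexp z) = Cexp (Cconj z).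
Proof.
  unfold Cexp, Cconj, Re, Im; simpl. rewrite cos_neg, sin_neg.
  apply injective_projections; simpl; ring.
Qed.

Lemma circ_twice_arg (w : C) : 0 < fst w -> circ (2 * snd (Clog w)) = (w / Cconj w)%C.
Proof.
  intros H. rewrite <- (Cexp_Clog w H) at 2 3.
  rewrite Cexp_conj. unfold Cdiv. rewrite <- Cexp_opp, <- Cexp_plus.
  unfold circ. f_equal. apply injective_projections; simpl; ring.
Qed.

(** An argument of [e^(- i x / 2) (1 - d e^(i x))], the contribution of one simple factor to the
    argument of [A]. *)
Definition half_arg (d : C) (x : R) : R := - x / 2 + snd (Clog (1 - d * circ x)%C).

Definition blaschke (d z : C) : C := ((z - Cconj d) / (1 - d * z))%C.

Lemma Cmod_d_circ (d : C) (x : R) : Cmod (d * circ x)%C = Cmod d.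
Proof. rewrite Cmod_mult, Cmod_circ; ring. Qed.

Lemma one_minus_neq_0 (u : C) : Cmod u < 1 -> (1 - u)%C <> 0%C.
Proof.
  intros H E. assert (u = 1%C) by (replace u with (1 - (1 - u))%C by ring; rewrite E; ring).
  rewrite H0, Cmod_1 in H; lra.
Qed.

Lemma circ_half_arg (d : C) (x : R) : 0 < fst (1 - d * circ x)%C ->
  circ (2 * half_arg d x)
  = (/ circ x * ((1 - d * circ x) / Cconj (1 - d * circ x)))%C.
Proof.
  intros H. unfold half_arg.
  replace (2 * (- x / 2 + snd (Clog (1 - d * circ x)%C)))
    with (- x + 2 * snd (Clog (1 - d * circ x)%C)) by field.
  rewrite circ_plus, circ_opp, circ_twice_arg by exact H. reflexivity.
Qed.

Lemma conj_one_minus (d : C) (x : R) :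
  Cconj (1 - d * circ x)%C = (1 - Cconj d / circ x)%C.
Proof.
  rewrite Cminus_conj, Cmult_conj, (Cconj_unit (circ x) (Cmod_circ x)).
  replace (Cconj 1) with (RtoC 1); [reflexivity|].
  apply injective_projections; simpl; ring.
Qed.

Lemma Cconj_neq_0 (u : C) : u <> 0%C -> Cconj u <> 0%C.
Proof.
  intros H E. apply H. rewrite <- (Cconj_conj u), E. apply injective_projections; simpl; ring.
Qed.

(** A factor with its zero on the circle is its own reflection: [(1 - u) / conj (1 - u) = - u] for
    [|u| = 1]. So its argument is constant modulo [PI]. *)
Lemma circ_half_arg_boundary (d : C) (x : R) :
  Cmod d = 1 -> (1 - d * circ x)%C <> 0%C -> circ (2 * half_arg d x) = (- d)%C.
Proof.
  intros Hd N.
  assert (Nd : d <> 0%C) by (intros ->; rewrite Cmod_0 in Hd; lra).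
  assert (Ne := circ_neq_0 x).
  rewrite circ_half_arg.
  2:{ apply Re_lt_1_of_unit_disk; [rewrite Cmod_d_circ; lra|exact N]. }
  rewrite conj_one_minus, (Cconj_unit d Hd).
  assert (Nc : (d * circ x - 1)%C <> 0%C).
  { intros E; apply N. replace (1 - d * circ x)%C with (- (d * circ x - 1))%C by ring.
    rewrite E; ring. }
  field. repeat split; auto.
Qed.

(** With [P = e^(- i x / 2) (1 - d e^(i x))] this says [P / conj P = 1 / blaschke]. Multiplication
    by the Blaschke factor conjugates [P], which is why [beta] is made of such factors. *)
Lemma circ_half_arg_interior (d : C) (x : R) :
  Cmod d < 1 -> circ (2 * half_arg d x) = (/ blaschke d (circ x))%C.
Proof.
  intros Hd.
  assert (N : (1 - d * circ x)%C <> 0%C) by (apply one_minus_neq_0; rewrite Cmod_d_circ; exact Hd).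
  assert (Ne := circ_neq_0 x).
  rewrite circ_half_arg.
  2:{ apply Re_lt_1_of_unit_disk; [rewrite Cmod_d_circ; lra|exact N]. }
  assert (Nc := Cconj_neq_0 _ N). rewrite conj_one_minus in Nc |- *.
  assert (N2 : (circ x - Cconj d)%C <> 0%C).
  { intros E; apply Nc. replace (1 - Cconj d / circ x)%C with ((circ x - Cconj d) / circ x)%C by (field; auto).
    rewrite E; field; auto. }
  unfold blaschke. field. repeat split; auto.
Qed.

(** One-sided, so that gaps of several factors add without cancelling. *)
Definition step_gap (v : R) : Prop := v = 0 \/ PI <= v.

Lemma step_gap_plus (u v : R) : step_gap u -> step_gap v -> step_gap (u + v).
Proof. assert (H := PI_RGT_0). unfold step_gap; lra. Qed.

Lemma step_gap_scale (c v : R) : 1 <= c -> step_gap v -> step_gap (c * v).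
Proof. assert (H := PI_RGT_0). intros Hc [->|Hv]; [left; ring|right; nra]. Qed.

(* A multiple of [PI] lying within [PI / 2] of a nonincreasing quantity is
   nonincreasing. *)
Lemma step_gap_rounding (a a' rho rho' : R) :
  circ (2 * (a - a')) = 1%C -> Rabs (a - rho) < PI / 2 -> Rabs (a' - rho') < PI / 2 ->
  rho' <= rho -> step_gap (a - a').
Proof.
  intros H A A' L. assert (HP := PI_RGT_0).
  destruct (circ_1_multiple _ H) as [j Hj].
  apply Rabs_lt_between in A. apply Rabs_lt_between in A'.
  assert (G : -1 * PI < IZR j * PI) by (rewrite <- Hj; lra).
  apply Rmult_lt_reg_r in G; [|exact HP]. apply lt_IZR in G.
  unfold step_gap. rewrite Hj.
  assert (j = 0 \/ 1 <= j)%Z as [->|J] by lia; [left; ring|right].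
  apply IZR_le in J. nra.
Qed.

Lemma half_arg_boundary_gap (d : C) (x x' : R) :
  Cmod d = 1 -> (1 - d * circ x)%C <> 0%C -> (1 - d * circ x')%C <> 0%C -> x <= x' ->
  step_gap (half_arg d x - half_arg d x').
Proof.
  intros Hd N N' L.
  (* [half_arg] differs from the decreasing function [- x / 2] by a principal argument, which is
     smaller than [PI / 2]. *)
  apply step_gap_rounding with (- x / 2) (- x' / 2).
  - replace (2 * (half_arg d x - half_arg d x')) with (2 * half_arg d x + - (2 * half_arg d x')) by ring.
    rewrite circ_plus, circ_opp, !circ_half_arg_boundary by assumption.
    field. intros ->. rewrite Cmod_0 in Hd. lra.
  - unfold half_arg. replace (- x / 2 + _ - - x / 2) with (snd (Clog (1 - d * circ x)%C)) by ring.
    apply Clog_arg_bound.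
  - unfold half_arg. replace (- x' / 2 + _ - - x' / 2) with (snd (Clog (1 - d * circ x')%C)) by ring.
    apply Clog_arg_bound.
  - lra.
Qed.

Lemma curve_derive_circ (x : R) : curve_derive circ x (Ci * circ x)%C.
Proof.
  eapply curve_derive_value.
  - apply (curve_derive_exp (fun y => (0, y)) x Ci). split; simpl; auto_derive; trivial.
  - reflexivity.
Qed.

(* The logarithmic derivative [z p' / p] of [p = 1 - d z]. *)
Definition pole_term (d z : C) : C := (- (d * z) / (1 - d * z))%C.

(** The Poisson kernel: [1 - 2 Re (- u / (1 - u)) = Re ((1 + u) / (1 - u))] with [u = d z]. *)
Lemma pole_term_Re (d z : C) : (1 - d * z)%C <> 0%C ->
  1 - 2 * fst (pole_term d z)
  = (1 - Cmod d * Cmod d * (Cmod z * Cmod z)) / (Cmod (1 - d * z)%C * Cmod (1 - d * z)%C).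
Proof.
  intros N.
  assert (E := Cmod_sqr (d * z)%C). rewrite Cmod_mult in E.
  replace (Cmod d * Cmod d * (Cmod z * Cmod z)) with (Cmod d * Cmod z * (Cmod d * Cmod z)) by ring.
  unfold pole_term. set (u := (d * z)%C) in *. rewrite E, (Cmod_sqr (1 - u)%C).
  assert (P : 0 < Cdot (1 - u)%C (1 - u)%C).
  { rewrite <- Cmod_sqr. apply Cmod_gt_0 in N. nra. }
  destruct u as [a b]. unfold Cdot in *; simpl in *. field. nra.
Qed.

Lemma curve_derive_log_circ (d : C) (x : R) : 0 < fst (1 - d * circ x)%C ->
  curve_derive (fun y => Clog (1 - d * circ y)%C) x (Ci * pole_term d (circ x))%C.
Proof.
  intros H. eapply curve_derive_value.
  - apply curve_derive_log; [|exact H].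
    apply curve_derive_plus; [apply (curve_derive_const 1)|].
    apply curve_derive_opp, curve_derive_mult; [apply (curve_derive_const d)|apply curve_derive_circ].
  - unfold pole_term. field. now apply Re_pos_neq_0.
Qed.

(** Its derivative is minus one half of the Poisson kernel of [pole_term_Re], which is positive for
    [|d| < 1]. *)
Lemma half_arg_decreasing (d : C) (x x' : R) :
  Cmod d < 1 -> x <= x' -> half_arg d x' <= half_arg d x.
Proof.
  intros Hd [L| ->]; [|lra].
  assert (N : forall y, (1 - d * circ y)%C <> 0%C).
  { intros y. apply one_minus_neq_0. rewrite Cmod_d_circ; exact Hd. }
  assert (P : forall y, 0 < fst (1 - d * circ y)%C).
  { intros y. apply Re_lt_1_of_unit_disk; [rewrite Cmod_d_circ; lra|apply N]. }
  destruct (MVT_cor2 (half_arg d) (fun y => - / 2 + fst (pole_term d (circ y))) x x' L)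
    as (c & Ec & _).
  { intros y _. apply is_derive_Reals.
    assert (D := proj2 (curve_derive_log_circ d y (P y))).
    eapply is_derive_value.
    - apply (is_derive_plus (K := R_AbsRing) (V := R_NormedModule) (fun y => - y / 2)
        (fun y => snd (Clog (1 - d * circ y)%C))); [|exact D].
      auto_derive; trivial.
    - generalize (pole_term d (circ y)); intros q; unfold plus; simpl; field. }
  assert (Q := pole_term_Re d (circ c) (N c)). rewrite Cmod_circ in Q.
  assert (0 <= (1 - Cmod d * Cmod d * (1 * 1)) /
     (Cmod (1 - d * circ c)%C * Cmod (1 - d * circ c)%C)).
  { assert (D0 := Cmod_ge_0 d). assert (W := proj1 (Cmod_gt_0 _) (N c)).
    left; apply Rdiv_lt_0_compat; nra. }
  nra.
Qed.

(** * Blaschke factors *)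

Lemma blaschke_modulus (d z : C) : (1 - d * z)%C <> 0%C ->
  Cmod (1 - d * z)%C * Cmod (1 - d * z)%C - Cmod (z - Cconj d)%C * Cmod (z - Cconj d)%C
  = (1 - Cmod d * Cmod d) * (1 - Cmod z * Cmod z).
Proof.
  intros N. rewrite !Cmod_sqr. destruct d, z; unfold Cdot; simpl. ring.
Qed.

Lemma Cmod_blaschke_sqr (d z : C) : Cmod d < 1 -> Cmod z <= 1 -> exists w : R, 0 < w /\
  1 - Cmod (blaschke d z) * Cmod (blaschke d z)
  = w * ((1 - Cmod d * Cmod d) * (1 - Cmod z * Cmod z)).
Proof.
  intros Hd Hz. assert (D0 := Cmod_ge_0 d). assert (Z0 := Cmod_ge_0 z).
  assert (N : (1 - d * z)%C <> 0%C) by (apply one_minus_neq_0; rewrite Cmod_mult; nra).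
  rewrite <- blaschke_modulus by exact N.
  unfold blaschke. rewrite Cmod_div by exact N. apply Cmod_gt_0 in N.
  exists (/ (Cmod (1 - d * z)%C * Cmod (1 - d * z)%C)). split; [|field; lra].
  apply Rinv_0_lt_compat; nra.
Qed.

Lemma blaschke_le_1 (d z : C) : Cmod d < 1 -> Cmod z <= 1 -> Cmod (blaschke d z) <= 1.
Proof.
  intros Hd Hz. destruct (Cmod_blaschke_sqr d z Hd Hz) as (w & Hw & E).
  assert (D0 := Cmod_ge_0 d). assert (Z0 := Cmod_ge_0 z).
  assert (0 <= w * ((1 - Cmod d * Cmod d) * (1 - Cmod z * Cmod z)))
    by (apply Rmult_le_pos; [lra|apply Rmult_le_pos; nra]).
  assert (B := Cmod_ge_0 (blaschke d z)). nra.
Qed.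

Lemma blaschke_lt_1 (d z : C) : Cmod d < 1 -> Cmod z < 1 -> Cmod (blaschke d z) < 1.
Proof.
  intros Hd Hz. destruct (Cmod_blaschke_sqr d z Hd (Rlt_le _ _ Hz)) as (w & Hw & E).
  assert (D0 := Cmod_ge_0 d). assert (Z0 := Cmod_ge_0 z).
  assert (0 < w * ((1 - Cmod d * Cmod d) * (1 - Cmod z * Cmod z)))
    by (apply Rmult_lt_0_compat; [lra|apply Rmult_lt_0_compat; nra]).
  assert (B := Cmod_ge_0 (blaschke d z)). nra.
Qed.

Lemma blaschke_unit (d z : C) : Cmod d < 1 -> Cmod z = 1 -> Cmod (blaschke d z) = 1.
Proof.
  intros Hd Hz. destruct (Cmod_blaschke_sqr d z Hd (Req_le _ _ Hz)) as (w & Hw & E).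
  rewrite Hz in E. assert (B := Cmod_ge_0 (blaschke d z)). nra.
Qed.

(** * Twice differentiable functions on the half plane, finite sums and products *)

Definition hol2 (f : C -> C) : Prop :=
  exists f1 f2 : C -> C, forall t : C, 0 < snd t ->
    hol_derive f t (f1 t) /\ hol_derive f1 t (f2 t).

Lemma hol2_const (c : C) : hol2 (fun _ => c).
Proof.
  exists (fun _ => RtoC 0), (fun _ => RtoC 0); intros t _; split; apply hol_derive_const.
Qed.

Lemma hol2_id : hol2 (fun z => z).
Proof.
  exists (fun _ => RtoC 1), (fun _ => RtoC 0); intros t _; split;
    [apply hol_derive_id|apply hol_derive_const].
Qed.

Lemma hol2_plus (f g : C -> C) : hol2 f -> hol2 g -> hol2 (fun z => f z + g z)%C.
Proof.
  intros (f1 & f2 & F) (g1 & g2 & G).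
  exists (fun z => f1 z + g1 z)%C, (fun z => f2 z + g2 z)%C; intros t Ht.
  destruct (F t Ht), (G t Ht); split; now apply hol_derive_plus.
Qed.

Lemma hol2_opp (f : C -> C) : hol2 f -> hol2 (fun z => - f z)%C.
Proof.
  intros (f1 & f2 & F).
  exists (fun z => - f1 z)%C, (fun z => - f2 z)%C; intros t Ht.
  destruct (F t Ht); split; now apply hol_derive_opp.
Qed.

Lemma hol2_mult (f g : C -> C) : hol2 f -> hol2 g -> hol2 (fun z => f z * g z)%C.
Proof.
  intros (f1 & f2 & F) (g1 & g2 & G).
  exists (fun z => f1 z * g z + f z * g1 z)%C,
    (fun z => (f2 z * g z + f1 z * g1 z) + (f1 z * g1 z + f z * g2 z))%C; intros t Ht.
  destruct (F t Ht), (G t Ht); split.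
  - now apply hol_derive_mult.
  - apply hol_derive_plus;
      [apply (hol_derive_mult f1 g)|apply (hol_derive_mult f g1)]; assumption.
Qed.

Lemma hol2_inv (f : C -> C) : hol2 f -> (forall t, 0 < snd t -> f t <> 0%C) ->
  hol2 (fun z => / f z)%C.
Proof.
  intros (f1 & f2 & F) N.
  exists (fun z => - f1 z * (/ f z * / f z))%C.
  exists (fun z => (- f2 z) * (/ f z * / f z)
     + (- f1 z) * ((- f1 z / (f z * f z)) * / f z + / f z * (- f1 z / (f z * f z))))%C.
  intros t Ht. destruct (F t Ht) as [A B]. specialize (N t Ht). split.
  - eapply hol_derive_value; [now apply hol_derive_inv|field; exact N].
  - apply (hol_derive_mult (fun z => - f1 z)%C (fun z => / f z * / f z)%C);
      [now apply hol_derive_opp|].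
    apply (hol_derive_mult (fun z => / f z)%C (fun z => / f z)%C); now apply hol_derive_inv.
Qed.

Lemma hol2_exp (f : C -> C) : hol2 f -> hol2 (fun z => Cexp (f z)).
Proof.
  intros (f1 & f2 & F).
  exists (fun z => f1 z * Cexp (f z))%C,
    (fun z => f2 z * Cexp (f z) + f1 z * (f1 z * Cexp (f z)))%C; intros t Ht.
  destruct (F t Ht); split.
  - now apply hol_derive_exp.
  - apply (hol_derive_mult f1 (fun z => Cexp (f z))); [assumption|now apply hol_derive_exp].
Qed.

Lemma hol2_log (f : C -> C) : hol2 f -> (forall t, 0 < snd t -> 0 < fst (f t)) ->
  hol2 (fun z => Clog (f z)).
Proof.
  intros (f1 & f2 & F) P.
  assert (N := fun t Ht => Re_pos_neq_0 _ (P t Ht)).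
  exists (fun z => f1 z * / f z)%C, (fun z => f2 z * / f z + f1 z * (- f1 z / (f z * f z)))%C.
  intros t Ht. destruct (F t Ht) as [A B]. split.
  - apply hol_derive_log; auto.
  - apply (hol_derive_mult f1 (fun z => / f z)%C); [assumption|]. apply hol_derive_inv; auto.
Qed.

Lemma hol2_ext (f g : C -> C) : (forall z, f z = g z) -> hol2 f -> hol2 g.
Proof.
  intros E (f1 & f2 & F). exists f1, f2. intros t Ht. destruct (F t Ht); split; [|assumption].
  eapply hol_derive_ext; eassumption.
Qed.

Lemma hol2_pow (f : C -> C) (m : nat) : hol2 f -> hol2 (fun z => f z ^ m)%C.
Proof.
  intros F; induction m as [|m IH].
  - apply (hol2_const 1).
  - apply hol2_ext with (fun z => f z * f z ^ m)%C; [intros z; now rewrite Cpow_S|].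
    now apply hol2_mult.
Qed.

Lemma hol2_Csum (u : nat -> C -> C) (N : nat) :
  (forall k, (1 <= k <= N)%nat -> hol2 (u k)) -> hol2 (fun z => Csum (fun k => u k z) N).
Proof.
  induction N as [|N IH]; intros H; simpl.
  - apply hol2_const.
  - apply hol2_plus; [apply IH; intros; apply H; lia|apply H; lia].
Qed.

Lemma hol2_Cprod (u : nat -> C -> C) (N : nat) :
  (forall k, (1 <= k <= N)%nat -> hol2 (u k)) -> hol2 (fun z => Cprod (fun k => u k z) N).
Proof.
  induction N as [|N IH]; intros H; simpl.
  - apply hol2_const.
  - apply hol2_mult; [apply IH; intros; apply H; lia|apply H; lia].
Qed.

Lemma filterlim_Csum {T : Type} (F : (T -> Prop) -> Prop) {FF : Filter F}
  (u : nat -> T -> C) (l : nat -> C) (N : nat) :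
  (forall k, (1 <= k <= N)%nat -> filterlim (u k) F (locally (l k))) ->
  filterlim (fun x => Csum (fun k => u k x) N) F (locally (Csum l N)).
Proof.
  induction N as [|N IH]; intros H; simpl.
  - apply filterlim_const.
  - apply (filterlim_Cplus F); [apply IH; intros; apply H; lia|apply H; lia].
Qed.

Lemma filterlim_Cprod {T : Type} (F : (T -> Prop) -> Prop) {FF : Filter F}
  (u : nat -> T -> C) (l : nat -> C) (N : nat) :
  (forall k, (1 <= k <= N)%nat -> filterlim (u k) F (locally (l k))) ->
  filterlim (fun x => Cprod (fun k => u k x) N) F (locally (Cprod l N)).
Proof.
  induction N as [|N IH]; intros H; simpl.
  - apply filterlim_const.
  - apply (filterlim_Cmult F); [apply IH; intros; apply H; lia|apply H; lia].
Qed.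

Lemma Cprod_eq_0 (u : nat -> C) (N : nat) :
  Cprod u N = 0%C -> exists k, (1 <= k <= N)%nat /\ u k = 0%C.
Proof.
  induction N as [|N IH]; simpl; intros E.
  - apply (f_equal fst) in E; simpl in E; lra.
  - destruct (Ceq_dec (Cprod u N) 0%C) as [Z|Z].
    + destruct (IH Z) as (k & Hk & Ek). exists k; split; [lia|exact Ek].
    + destruct (Ceq_dec (u (S N)) 0%C) as [Y|Y]; [exists (S N); split; [lia|exact Y]|].
      exfalso. now apply (Cmult_neq_0 _ _ Z Y).
Qed.

Lemma Cprod_0 (u : nat -> C) (N k : nat) :
  (1 <= k <= N)%nat -> u k = 0%C -> Cprod u N = 0%C.
Proof.
  induction N as [|N IH]; simpl; intros Hk E; [lia|].
  destruct (PeanoNat.Nat.eq_dec k (S N)) as [->|Nk].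
  - rewrite E; ring.
  - rewrite IH by (lia || assumption). ring.
Qed.

(** Here [d k] stands for [1 / a_k]: the factor [1 - d z] differs from [z - a] by the constant
    [- a]. *)
Definition admissible (N : nat) (d : nat -> C) (s : nat -> R) : Prop :=
  forall k, (1 <= k <= N)%nat ->
    Cmod (d k) <= 1 /\ 1 <= s k /\ (Cmod (d k) < 1 -> exists n : nat, s k = INR n).

Definition power_product (d : nat -> C) (s : nat -> R) (N : nat) (z : C) : C :=
  Cprod (fun k => Cpower (1 - d k * z)%C (s k)) N.

(* [m k] is the multiplicity of the zero [1 / d k] when it lies off the closed
   disk, and 0 when it lies on the circle. *)
Definition outer_multiplicity (N : nat) (d : nat -> C) (s : nat -> R) (m : nat -> nat) : Prop :=
  forall k, (1 <= k <= N)%nat ->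
    (Cmod (d k) < 1 -> s k = INR (m k)) /\ (Cmod (d k) = 1 -> m k = 0%nat).

Lemma outer_multiplicity_exists (N : nat) (d : nat -> C) (s : nat -> R) :
  admissible N d s -> exists m, outer_multiplicity N d s m.
Proof.
  intros H. apply (functional_choice (fun k n => (1 <= k <= N)%nat ->
    (Cmod (d k) < 1 -> s k = INR n) /\ (Cmod (d k) = 1 -> n = 0%nat))).
  intros k. destruct (classic ((1 <= k <= N)%nat)) as [Hk|Hk]; [|exists 0%nat; tauto].
  destruct (H k Hk) as (_ & _ & E).
  destruct (Rlt_or_le (Cmod (d k)) 1) as [L|L].
  - destruct (E L) as [n Hn]. exists n. intros _; split; [auto|lra].
  - exists 0%nat; intros _; split; [lra|auto].
Qed.

Definition reflection (om : C) (d : nat -> C) (m : nat -> nat) (N : nat) (z : C) : C :=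
  (om * Cprod (fun k => blaschke (d k) z ^ m k) N)%C.

Lemma blaschke_pow_le_1 (d z : C) (m : nat) :
  (Cmod d < 1 \/ m = 0%nat) -> Cmod z <= 1 -> Cmod (blaschke d z ^ m)%C <= 1.
Proof.
  intros [Hd| ->] Hz; [|simpl; rewrite Cmod_1; lra].
  rewrite Cmod_pow. rewrite <- (pow1 m). apply pow_incr.
  split; [apply Cmod_ge_0|now apply blaschke_le_1].
Qed.

Lemma blaschke_pow_unit (d z : C) (m : nat) :
  (Cmod d < 1 \/ m = 0%nat) -> Cmod z = 1 -> Cmod (blaschke d z ^ m)%C = 1.
Proof.
  intros [Hd| ->] Hz; [|simpl; apply Cmod_1].
  rewrite Cmod_pow, blaschke_unit by assumption. apply pow1.
Qed.

Lemma multiplicity_cases (N : nat) (d : nat -> C) (s : nat -> R) (m : nat -> nat) (k : nat) :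
  admissible N d s -> outer_multiplicity N d s m -> (1 <= k <= N)%nat ->
  Cmod (d k) < 1 \/ m k = 0%nat.
Proof.
  intros H M Hk. destruct (H k Hk) as (A & _), (M k Hk) as (_ & B).
  destruct A as [A|A]; auto.
Qed.

Lemma blaschke_product_le_1 (d : nat -> C) (m : nat -> nat) (N : nat) (z : C) :
  (forall k, (1 <= k <= N)%nat -> Cmod (d k) < 1 \/ m k = 0%nat) -> Cmod z <= 1 ->
  Cmod (Cprod (fun k => blaschke (d k) z ^ m k)%C N) <= 1.
Proof.
  intros H Hz; induction N as [|N IH]; simpl.
  - rewrite Cmod_1; lra.
  - rewrite Cmod_mult.
    assert (A := IH ltac:(intros; apply H; lia)).
    assert (B := blaschke_pow_le_1 (d (S N)) z (m (S N)) (H (S N) ltac:(lia)) Hz).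
    assert (A0 := Cmod_ge_0 (Cprod (fun k => blaschke (d k) z ^ m k)%C N)).
    assert (B0 := Cmod_ge_0 (blaschke (d (S N)) z ^ m (S N))%C). nra.
Qed.

Lemma blaschke_product_unit (d : nat -> C) (m : nat -> nat) (N : nat) (z : C) :
  (forall k, (1 <= k <= N)%nat -> Cmod (d k) < 1 \/ m k = 0%nat) -> Cmod z = 1 ->
  Cmod (Cprod (fun k => blaschke (d k) z ^ m k)%C N) = 1.
Proof.
  intros H Hz; induction N as [|N IH]; simpl.
  - apply Cmod_1.
  - rewrite Cmod_mult, IH, blaschke_pow_unit; [ring| |exact Hz|].
    + apply H; lia.
    + intros; apply H; lia.
Qed.

(** Needed to keep [1 + beta] free of zeros in the disk: either [beta] is the constant [omega], and
    one point decides whether it is [-1], or [|beta| < 1] inside. *)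
Lemma blaschke_product_dichotomy (d : nat -> C) (m : nat -> nat) (N : nat) :
  (forall k, (1 <= k <= N)%nat -> Cmod (d k) < 1 \/ m k = 0%nat) ->
  (forall z, Cprod (fun k => blaschke (d k) z ^ m k)%C N = 1%C) \/
  (forall z, Cmod z < 1 -> Cmod (Cprod (fun k => blaschke (d k) z ^ m k)%C N) < 1).
Proof.
  intros H; induction N as [|N IH]; simpl; [now left|].
  assert (H' : forall k, (1 <= k <= N)%nat -> Cmod (d k) < 1 \/ m k = 0%nat) by (intros; apply H; lia).
  destruct (IH H') as [E|L].
  - destruct (m (S N)) as [|n] eqn:Em.
    + left; intros z. rewrite E; simpl; ring.
    + right; intros z Hz. rewrite E, Cmult_1_l, Cmod_pow.
      destruct (H (S N) ltac:(lia)) as [D|D]; [|congruence].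
      assert (A := blaschke_lt_1 _ z D Hz). assert (A0 := Cmod_ge_0 (blaschke (d (S N)) z)).
      simpl. assert (Cmod (blaschke (d (S N)) z) ^ n <= 1).
      { rewrite <- (pow1 n). apply pow_incr; lra. }
      assert (0 <= Cmod (blaschke (d (S N)) z) ^ n) by (apply pow_le; exact A0). nra.
  - right; intros z Hz. rewrite Cmod_mult.
    assert (A := L z Hz).
    assert (B := blaschke_pow_le_1 (d (S N)) z (m (S N)) (H (S N) ltac:(lia)) ltac:(lra)).
    assert (A0 := Cmod_ge_0 (Cprod (fun k => blaschke (d k) z ^ m k)%C N)).
    assert (B0 := Cmod_ge_0 (blaschke (d (S N)) z ^ m (S N))%C). nra.
Qed.

Lemma reflection_neq_m1 (om : C) (d : nat -> C) (m : nat -> nat) (N : nat) (z z0 : C) :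
  (forall k, (1 <= k <= N)%nat -> Cmod (d k) < 1 \/ m k = 0%nat) -> Cmod om = 1 ->
  reflection om d m N z0 <> (- (1))%C -> Cmod z < 1 -> reflection om d m N z <> (- (1))%C.
Proof.
  intros H Hom N0 Hz. unfold reflection in *.
  destruct (blaschke_product_dichotomy d m N H) as [E|L].
  - now rewrite E in N0 |- *.
  - intros E. apply (f_equal Cmod) in E.
    rewrite Cmod_mult, Hom, Cmod_opp, Cmod_1 in E. specialize (L z Hz). lra.
Qed.

Lemma Re_one_plus (b : C) : Cmod b <= 1 -> b <> (- (1))%C -> 0 < fst (1 + b)%C.
Proof.
  intros H N. replace (1 + b)%C with (1 - - b)%C by ring.
  apply Re_lt_1_of_unit_disk; [now rewrite Cmod_opp|].
  intros E; apply N. replace b with (- (1) + (1 - - b))%C by ring. rewrite E; ring.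
Qed.

(** * The function attached to a power product *)

Definition emap (t : C) : C := Cexp (- snd t, fst t).

Lemma emap_eq (t : C) : emap t = Cexp (Ci * t)%C.
Proof.
  unfold emap; f_equal; apply injective_projections; simpl; ring.
Qed.

Lemma emap_axis (x : R) : emap (x, 0) = circ x.
Proof. unfold emap, circ; simpl; now rewrite Ropp_0. Qed.

Lemma Cmod_emap (t : C) : Cmod (emap t) = exp (- snd t).
Proof. unfold emap; now rewrite Cmod_Cexp. Qed.

Lemma Cmod_emap_le_1 (t : C) : upper_half t -> Cmod (emap t) <= 1.
Proof.
  unfold upper_half; intros H. rewrite Cmod_emap, <- exp_0.
  destruct H as [H|<-]; [left; apply exp_increasing; lra|rewrite Ropp_0; lra].
Qed.

Lemma Cmod_emap_lt_1 (t : C) : 0 < snd t -> Cmod (emap t) < 1.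
Proof. intros H. rewrite Cmod_emap, <- exp_0. apply exp_increasing; lra. Qed.

Lemma hol_derive_emap (t : C) : hol_derive emap t (Ci * emap t)%C.
Proof.
  apply hol_derive_ext with (fun z => Cexp (Ci * z)%C); [intros z; now rewrite emap_eq|].
  rewrite emap_eq. apply hol_derive_exp. eapply hol_derive_value.
  - apply hol_derive_mult; [apply (hol_derive_const Ci)|apply hol_derive_id].
  - cbv beta; ring.
Qed.

Lemma hol2_emap : hol2 emap.
Proof.
  apply hol2_ext with (fun z => Cexp (Ci * z)%C); [intros z; now rewrite emap_eq|].
  apply hol2_exp, hol2_mult; [apply (hol2_const Ci)|apply hol2_id].
Qed.

Lemma filterlim_emap (p : C) : filterlim emap (within upper_half (locally p)) (locally (emap p)).
Proof.
  rewrite emap_eq.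
  apply filterlim_ext with (fun z => Cexp (Ci * z)%C); [intros z; now rewrite emap_eq|].
  apply (filterlim_Cexp _), (filterlim_Cmult _); [apply filterlim_const|].
  intros P H. unfold filtermap. apply (filter_le_within (F := locally p)). exact H.
Qed.

(** A logarithm of [e^(2 i gam) H^2 / M^2], for [omega = e^(- 2 i gam)] and [c0 = - ln (4 * M^2)].
    The rotation multiplies [H] by [e^(i gam)]; when no zero lies on the circle this makes it real
    on the axis, a sum of two conjugates. *)
Definition phase_log (c0 gam : R) (d : nat -> C) (s : nat -> R) (m : nat -> nat) (N : nat) (t : C) : C :=
  (2 * Csum (fun k => RtoC (s k) * Clog (1 - d k * emap t)) N
   + 2 * Clog (1 + reflection (circ (- (2 * gam))) d m N (emap t))
   + (- (RtoC (Rsum s N) * Ci) * t + (c0, 2 * gam)%R))%C.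

(** Written without [Clog], so that it is correct, namely 0, at the real zeros, where [phase_log] is
    junk. *)
Definition phase_modulus (M gam : R) (d : nat -> C) (s : nat -> R) (m : nat -> nat) (N : nat) (t : C) : R :=
  Cmod (power_product d s N (emap t)) * Cmod (power_product d s N (emap t))
  * (Cmod (1 + reflection (circ (- (2 * gam))) d m N (emap t))%C
     * Cmod (1 + reflection (circ (- (2 * gam))) d m N (emap t))%C)
  * exp (Rsum s N * snd t) / (4 * (M * M)).

Lemma fst_Csum (u : nat -> C) (N : nat) : fst (Csum u N) = Rsum (fun k => fst (u k)) N.
Proof. induction N as [|N IH]; simpl; [reflexivity|now rewrite IH]. Qed.

Lemma snd_Csum (u : nat -> C) (N : nat) : snd (Csum u N) = Rsum (fun k => snd (u k)) N.
Proof. induction N as [|N IH]; simpl; [reflexivity|now rewrite IH]. Qed.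

Lemma Rsum_ext (u v : nat -> R) (N : nat) :
  (forall k, (1 <= k <= N)%nat -> u k = v k) -> Rsum u N = Rsum v N.
Proof.
  induction N as [|N IH]; simpl; intros H; [reflexivity|].
  rewrite IH, (H (S N)); [reflexivity|lia|intros; apply H; lia].
Qed.

Lemma Rsum_plus (u v : nat -> R) (N : nat) :
  Rsum (fun k => u k + v k) N = Rsum u N + Rsum v N.
Proof. induction N as [|N IH]; simpl; [ring|rewrite IH; ring]. Qed.

Lemma Rsum_scal (c : R) (u : nat -> R) (N : nat) :
  Rsum (fun k => c * u k) N = c * Rsum u N.
Proof. induction N as [|N IH]; simpl; [ring|rewrite IH; ring]. Qed.

Lemma Rsum_nonneg (u : nat -> R) (N : nat) :
  (forall k, (1 <= k <= N)%nat -> 0 <= u k) -> 0 <= Rsum u N.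
Proof.
  induction N as [|N IH]; simpl; intros H; [lra|].
  assert (A := IH ltac:(intros; apply H; lia)). assert (B := H (S N) ltac:(lia)). lra.
Qed.

Lemma power_product_neq_0 (d : nat -> C) (s : nat -> R) (N : nat) (z : C) :
  (forall k, (1 <= k <= N)%nat -> (1 - d k * z)%C <> 0%C) -> power_product d s N z <> 0%C.
Proof.
  intros H E. destruct (Cprod_eq_0 _ _ E) as (k & Hk & Ek).
  exact (Cpower_neq_0 _ _ (H k Hk) Ek).
Qed.

Lemma power_product_factor_neq_0 (d : nat -> C) (s : nat -> R) (N k : nat) (z : C) :
  s k <> 0 -> (1 <= k <= N)%nat -> power_product d s N z <> 0%C -> (1 - d k * z)%C <> 0%C.
Proof.
  intros Hs Hk H E. apply H. apply Cprod_0 with k; [exact Hk|].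
  rewrite E. now apply Cpower_0_l.
Qed.

Lemma Cexp_Csum (u : nat -> C) (N : nat) : Cexp (Csum u N) = Cprod (fun k => Cexp (u k)) N.
Proof. induction N as [|N IH]; simpl; [apply Cexp_0|now rewrite Cexp_plus, IH]. Qed.

Lemma Cprod_ext (u v : nat -> C) (N : nat) :
  (forall k, (1 <= k <= N)%nat -> u k = v k) -> Cprod u N = Cprod v N.
Proof.
  induction N as [|N IH]; simpl; intros H; [reflexivity|].
  rewrite IH, (H (S N)); [reflexivity|lia|intros; apply H; lia].
Qed.

Lemma power_product_exp (d : nat -> C) (s : nat -> R) (N : nat) (z : C) :
  (forall k, (1 <= k <= N)%nat -> (1 - d k * z)%C <> 0%C) ->
  power_product d s N z = Cexp (Csum (fun k => RtoC (s k) * Clog (1 - d k * z))%C N).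
Proof.
  intros H. rewrite Cexp_Csum. apply Cprod_ext. intros k Hk.
  apply Cpower_neq_0_eq; auto.
Qed.

Lemma power_product_bounded (N : nat) (d : nat -> C) (s : nat -> R) :
  admissible N d s -> exists B : R, forall z, Cmod z <= 1 -> Cmod (power_product d s N z) <= B.
Proof.
  unfold power_product; induction N as [|N IH]; intros H; simpl.
  - exists 1; intros; rewrite Cmod_1; lra.
  - destruct IH as [B HB]; [intros k Hk; apply H; lia|].
    destruct (H (S N)) as (D & S1 & _); [lia|].
    exists (B * exp (s (S N) * ln 2)). intros z Hz. rewrite Cmod_mult.
    apply Rmult_le_compat; try apply Cmod_ge_0; [now apply HB|].
    destruct (Ceq_dec (1 - d (S N) * z)%C 0%C) as [E|E].
    + rewrite E, Cpower_0_l, Cmod_0 by lra. left; apply exp_pos.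
    + rewrite Cmod_Cpower by exact E.
      assert (U : Cmod (1 - d (S N) * z)%C <= 2).
      { unfold Cminus. eapply Rle_trans; [apply Cmod_triangle|].
        rewrite Cmod_1, Cmod_opp, Cmod_mult.
        assert (A := Cmod_ge_0 (d (S N))). assert (A' := Cmod_ge_0 z). nra. }
      apply Cmod_gt_0 in E. assert (ln (Cmod (1 - d (S N) * z)%C) <= ln 2) by (apply ln_le; assumption).
      assert (s (S N) * ln (Cmod (1 - d (S N) * z)%C) <= s (S N) * ln 2) by (apply Rmult_le_compat_l; lra).
      destruct H1 as [H1| ->]; [left; now apply exp_increasing|lra].
Qed.

(** [hs_reflection] rules out that [beta] is constantly [-1], in which case [H] would vanish
    identically. *)
Record half_plane_setup (M gam : R) (d : nat -> C) (s : nat -> R) (m : nat -> nat) (N : nat) : Prop := {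
  hs_adm : admissible N d s;
  hs_mult : outer_multiplicity N d s m;
  hs_pos : 0 < M;
  hs_bound : forall x : R, Cmod (power_product d s N (circ x)) <= M;
  hs_reflection : exists x0 : R, reflection (circ (- (2 * gam))) d m N (circ x0) <> (- (1))%C
}.

Arguments hs_adm {M gam d s m N} _.
Arguments hs_mult {M gam d s m N} _.
Arguments hs_pos {M gam d s m N} _.
Arguments hs_bound {M gam d s m N} _.
Arguments hs_reflection {M gam d s m N} _.

Lemma factor_Cmod_le_1 (d z : C) : Cmod d <= 1 -> Cmod z <= 1 -> Cmod (d * z)%C <= 1.
Proof.
  intros A B. rewrite Cmod_mult. assert (X := Cmod_ge_0 d). assert (Y := Cmod_ge_0 z). nra.
Qed.

Lemma Cinv_1 : (/ 1)%C = 1%C.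
Proof. apply injective_projections; simpl; field. Qed.

Section Instance.

Context (M gam : R) (d : nat -> C) (s : nat -> R) (m : nat -> nat) (N : nat).

Notation refl := (reflection (circ (- (2 * gam))) d m N).
Notation setup := (half_plane_setup M gam d s m N).

Lemma setup_cases : setup -> forall k, (1 <= k <= N)%nat -> Cmod (d k) < 1 \/ m k = 0%nat.
Proof.
  intros H k. apply multiplicity_cases with s; [apply (hs_adm H)|apply (hs_mult H)].
Qed.

Lemma setup_reflection_le_1 (z : C) : setup -> Cmod z <= 1 -> Cmod (refl z) <= 1.
Proof.
  intros H Hz. unfold reflection. rewrite Cmod_mult, Cmod_circ, Rmult_1_l.
  apply blaschke_product_le_1; [now apply setup_cases|exact Hz].
Qed.

Lemma setup_interior_factor (k : nat) (t : C) : setup -> (1 <= k <= N)%nat -> 0 < snd t ->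
  0 < fst (1 - d k * emap t)%C.
Proof.
  intros H Hk Ht. destruct (hs_adm H k Hk) as (D & _).
  assert (A := Cmod_emap_lt_1 t Ht).
  assert (U : Cmod (d k * emap t)%C < 1).
  { rewrite Cmod_mult. assert (X := Cmod_ge_0 (d k)). assert (Y := Cmod_ge_0 (emap t)). nra. }
  apply Re_lt_1_of_unit_disk; [lra|now apply one_minus_neq_0].
Qed.

Lemma setup_interior_reflection (t : C) : setup -> 0 < snd t -> 0 < fst (1 + refl (emap t))%C.
Proof.
  intros H Ht. destruct (hs_reflection H) as [x0 N0].
  apply Re_one_plus.
  - apply setup_reflection_le_1; [exact H|]. left; now apply Cmod_emap_lt_1.
  - eapply reflection_neq_m1; [now apply setup_cases|apply Cmod_circ|exact N0|now apply Cmod_emap_lt_1].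
Qed.

Lemma phase_modulus_neq_0_factors (t : C) : setup -> upper_half t -> phase_modulus M gam d s m N t <> 0 ->
  (forall k, (1 <= k <= N)%nat -> 0 < fst (1 - d k * emap t)%C) /\ 0 < fst (1 + refl (emap t))%C.
Proof.
  intros H Ht Hr.
  assert (Z1 : power_product d s N (emap t) <> 0%C).
  { intros E; apply Hr. unfold phase_modulus. rewrite E, Cmod_0. unfold Rdiv; ring. }
  assert (Z2 : (1 + refl (emap t))%C <> 0%C).
  { intros E; apply Hr. unfold phase_modulus. rewrite E, Cmod_0. unfold Rdiv; ring. }
  assert (U := Cmod_emap_le_1 t Ht).
  split.
  - intros k Hk. destruct (hs_adm H k Hk) as (D & S1 & _).
    apply Re_lt_1_of_unit_disk; [now apply factor_Cmod_le_1|].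
    eapply power_product_factor_neq_0; [|exact Hk|exact Z1]. lra.
  - apply Re_one_plus; [now apply setup_reflection_le_1|].
    intros E; apply Z2. rewrite E; ring.
Qed.

Lemma phase_modulus_eq (t : C) : setup ->
  (forall k, (1 <= k <= N)%nat -> 0 < fst (1 - d k * emap t)%C) -> 0 < fst (1 + refl (emap t))%C ->
  phase_modulus M gam d s m N t
  = exp (fst (phase_log (- ln (4 * (M * M))) gam d s m N t)).
Proof.
  intros H F B. assert (MP := hs_pos H).
  assert (X1 : Cmod (power_product d s N (emap t))
    = exp (fst (Csum (fun k => RtoC (s k) * Clog (1 - d k * emap t))%C N))).
  { rewrite power_product_exp, Cmod_Cexp; [reflexivity|]. intros k Hk; now apply Re_pos_neq_0, F. }
  assert (X2 := exp_Clog _ (Re_pos_neq_0 _ B)).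
  unfold phase_modulus, phase_log. rewrite X1, <- X2.
  set (S := Csum _ N). set (b := Clog _).
  replace (fst (2 * S + 2 * b + (- (RtoC (Rsum s N) * Ci) * t + (- ln (4 * (M * M)), 2 * gam)%R))%C)
    with (fst S + fst S + (fst b + fst b) + Rsum s N * snd t + - ln (4 * (M * M)))
    by (simpl; ring).
  rewrite !exp_plus, exp_Ropp, exp_ln by nra. unfold Rdiv. reflexivity.
Qed.

Lemma setup_continuous_factor (k : nat) (p : C) :
  filterlim (fun t => 1 - d k * emap t)%C (within upper_half (locally p)) (locally (1 - d k * emap p)%C).
Proof.
  apply (filterlim_one_minus _), filterlim_emap.
Qed.

Lemma setup_continuous_reflection (p : C) : setup -> upper_half p ->
  filterlim (fun t => 1 + refl (emap t))%C (within upper_half (locally p)) (locally (1 + refl (emap p))%C).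
Proof.
  intros H Hp. apply (filterlim_Cplus _); [apply filterlim_const|].
  unfold reflection. apply (filterlim_Cmult _); [apply filterlim_const|].
  apply (filterlim_Cprod _ (fun k t => blaschke (d k) (emap t) ^ m k)%C
           (fun k => blaschke (d k) (emap p) ^ m k)%C).
  intros k Hk. destruct (setup_cases H k Hk) as [D|D].
  - apply (filterlim_Cpow _). unfold blaschke, Cdiv, Cminus.
    apply (filterlim_Cmult _).
    + apply (filterlim_Cplus _); [apply filterlim_emap|apply filterlim_const].
    + apply (filterlim_Cinv _ (fun t => 1 - d k * emap t)%C); [apply setup_continuous_factor|].
      apply one_minus_neq_0. rewrite Cmod_mult.
      assert (U := Cmod_emap_le_1 p Hp). assert (X := Cmod_ge_0 (d k)).
      assert (Y := Cmod_ge_0 (emap p)). nra.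
  - rewrite D. simpl. apply filterlim_const.
Qed.

(** The weight [s k - INR (m k)] is 0 for an outer zero and [s k] for a zero on the circle. The
    groups are separated because a factor of the second kind has a stepped argument by itself, the
    outer ones only jointly with [gam] and the argument of [1 + beta]. The factor 2 comes from the
    square in [K]. *)
Lemma setup_phase_log_axis (c0 x : R) : setup ->
  (forall k, (1 <= k <= N)%nat -> 0 < fst (1 - d k * circ x)%C) ->
  snd (phase_log c0 gam d s m N (x, 0))
  = 2 * (Rsum (fun k => (s k - INR (m k)) * half_arg (d k) x) N
         + (gam + Rsum (fun k => INR (m k) * half_arg (d k) x) N + snd (Clog (1 + refl (circ x))%C))).
Proof.
  intros H F. unfold phase_log. rewrite emap_axis.
  assert (E : snd (Csum (fun k => RtoC (s k) * Clog (1 - d k * circ x))%C N) - Rsum s N * x / 2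
    = Rsum (fun k => (s k - INR (m k)) * half_arg (d k) x) N
      + Rsum (fun k => INR (m k) * half_arg (d k) x) N).
  { rewrite <- Rsum_plus, snd_Csum.
    replace (- (Rsum s N * x / 2)) with (- x / 2 * Rsum s N) by field.
    unfold Rminus at 1. replace (- (Rsum s N * x / 2)) with (- x / 2 * Rsum s N) by field.
    rewrite <- Rsum_scal, <- Rsum_plus. apply Rsum_ext. intros k _.
    unfold half_arg. generalize (Clog (1 - d k * circ x)%C). intros w. simpl. ring. }
  revert E. generalize (Csum (fun k => RtoC (s k) * Clog (1 - d k * circ x))%C N).
  generalize (Clog (1 + refl (circ x))%C). intros b S E.
  rewrite (Rplus_comm gam), Rplus_assoc, <- Rplus_assoc, <- E. simpl. field.
Qed.

Lemma setup_step (x x' : R) : setup -> x <= x' ->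
  (forall k, (1 <= k <= N)%nat -> (1 - d k * circ x)%C <> 0%C) -> refl (circ x) <> (- (1))%C ->
  (forall k, (1 <= k <= N)%nat -> (1 - d k * circ x')%C <> 0%C) -> refl (circ x') <> (- (1))%C ->
  step_gap (Rsum (fun k => (s k - INR (m k)) * half_arg (d k) x) N
         + (gam + Rsum (fun k => INR (m k) * half_arg (d k) x) N + snd (Clog (1 + refl (circ x))%C))
     - (Rsum (fun k => (s k - INR (m k)) * half_arg (d k) x') N
         + (gam + Rsum (fun k => INR (m k) * half_arg (d k) x') N + snd (Clog (1 + refl (circ x'))%C)))).
Proof.
  intros H L F B F' B'.
  assert (Part1 : step_gap (Rsum (fun k => (s k - INR (m k)) * half_arg (d k) x
                                   + (-1) * ((s k - INR (m k)) * half_arg (d k) x')) N)).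
  { assert (HA := hs_adm H). assert (HM := hs_mult H).
    assert (G : forall n, (n <= N)%nat -> step_gap (Rsum (fun k => (s k - INR (m k)) * half_arg (d k) x
                                   + (-1) * ((s k - INR (m k)) * half_arg (d k) x')) n)).
    { induction n as [|n IH]; intros Hn; simpl; [now left|].
      apply step_gap_plus; [apply IH; lia|].
      assert (Hk : (1 <= S n <= N)%nat) by lia.
      destruct (HA _ Hk) as (D & S1 & _), (HM _ Hk) as (M1 & M2).
      replace ((s (S n) - INR (m (S n))) * half_arg (d (S n)) x
               + -1 * ((s (S n) - INR (m (S n))) * half_arg (d (S n)) x'))
        with ((s (S n) - INR (m (S n))) * (half_arg (d (S n)) x - half_arg (d (S n)) x')) by ring.
      destruct D as [D|D].
      - rewrite (M1 D). left; ring.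
      - rewrite (M2 D). simpl INR. rewrite Rminus_0_r.
        apply step_gap_scale; [exact S1|]. apply half_arg_boundary_gap; auto. }
    now apply G. }
  (* The joint argument of the outer factors is a multiple of [PI]:
     [(1 + beta) / conj (1 + beta) = beta] on the circle, while the doubled arguments of the factors
     multiply to the inverse Blaschke product and [e^(2 i gam)] is the inverse of [omega]. *)
  assert (Turn : forall y, refl (circ y) <> (- (1))%C ->
     circ (2 * (gam + Rsum (fun k => INR (m k) * half_arg (d k) y) N
          + snd (Clog (1 + refl (circ y))%C))) = 1%C).
  { intros y By.
    assert (Un : Cmod (refl (circ y)) = 1).
    { unfold reflection. rewrite Cmod_mult, Cmod_circ, Rmult_1_l.
      apply blaschke_product_unit; [now apply setup_cases|apply Cmod_circ]. }
    assert (P := Re_one_plus _ (Req_le _ _ Un) By).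
    replace (2 * (gam + Rsum (fun k => INR (m k) * half_arg (d k) y) N + snd (Clog (1 + refl (circ y))%C)))
      with (2 * gam + (2 * Rsum (fun k => INR (m k) * half_arg (d k) y) N
          + 2 * snd (Clog (1 + refl (circ y))%C))) by ring.
    rewrite !circ_plus, circ_twice_arg by exact P.
    assert (Q : forall n, (n <= N)%nat -> circ (2 * Rsum (fun k => INR (m k) * half_arg (d k) y) n)
       = (/ Cprod (fun k => blaschke (d k) (circ y) ^ m k)%C n)%C).
    { induction n as [|n IH]; intros Hn; simpl.
      - rewrite Rmult_0_r, circ_0. symmetry; exact Cinv_1.
      - rewrite Rmult_plus_distr_l, circ_plus, IH by lia.
        assert (Pw : circ (2 * (INR (m (S n)) * half_arg (d (S n)) y))
           = (/ blaschke (d (S n)) (circ y) ^ m (S n))%C).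
        { destruct (setup_cases H (S n) ltac:(lia)) as [D|D].
          - assert (Nb : blaschke (d (S n)) (circ y) <> 0%C).
            { intros E. assert (W := blaschke_unit _ _ D (Cmod_circ y)). rewrite E, Cmod_0 in W; lra. }
            induction (m (S n)) as [|j IHj].
            + simpl. rewrite Rmult_0_l, Rmult_0_r, circ_0. symmetry; exact Cinv_1.
            + rewrite S_INR, Cpow_S.
              replace (2 * ((INR j + 1) * half_arg (d (S n)) y))
                with (2 * (INR j * half_arg (d (S n)) y) + 2 * half_arg (d (S n)) y) by ring.
              rewrite circ_plus, IHj, circ_half_arg_interior by exact D.
              field. split; [now apply Cpow_nz|exact Nb].
          - rewrite D. simpl. rewrite Rmult_0_l, Rmult_0_r, circ_0. symmetry; exact Cinv_1. }
        rewrite Pw. 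
        assert (U1 := blaschke_product_unit d m n (circ y)
          ltac:(intros; apply setup_cases; [exact H|lia]) (Cmod_circ y)).
        assert (U2 := blaschke_pow_unit (d (S n)) (circ y) (m (S n))
          (setup_cases H (S n) ltac:(lia)) (Cmod_circ y)).
        field. split; intros E; [rewrite E, Cmod_0 in U2; lra|rewrite E, Cmod_0 in U1; lra]. }
    rewrite (Q N (le_n N)).
    assert (U1 := blaschke_product_unit d m N (circ y) (setup_cases H) (Cmod_circ y)).
    assert (Conj : Cconj (1 + refl (circ y))%C = (1 + / refl (circ y))%C).
    { rewrite Cplus_conj, (Cconj_unit _ Un). f_equal. apply injective_projections; simpl; ring. }
    rewrite Conj. revert By Un. unfold reflection. rewrite circ_opp.
    set (Pr := Cprod _ N) in *. intros By Un.
    assert (N1 : Pr <> 0%C) by (intros E; rewrite E, Cmod_0 in U1; lra).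
    assert (N2 := circ_neq_0 (2 * gam)).
    field. repeat split; auto.
    + intros E. apply By. 
      assert (E2 : (/ circ (2 * gam) * Pr)%C = (- (1) + (Pr + circ (2 * gam)) / circ (2 * gam))%C) by (field; auto).
      rewrite E2. replace (Pr + circ (2 * gam))%C with (RtoC 0) by (rewrite <- E; ring). field; auto. }
  (* Rounding applies: the argument of [1 + beta] is below [PI / 2] in size, and what remains is
     nonincreasing since each outer [half_arg] is. *)
  assert (Part2 : step_gap
     ((gam + Rsum (fun k => INR (m k) * half_arg (d k) x) N + snd (Clog (1 + refl (circ x))%C))
     - (gam + Rsum (fun k => INR (m k) * half_arg (d k) x') N + snd (Clog (1 + refl (circ x'))%C)))).
  { apply step_gap_rounding with (gam + Rsum (fun k => INR (m k) * half_arg (d k) x) N)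
      (gam + Rsum (fun k => INR (m k) * half_arg (d k) x') N).
    - rewrite Rmult_minus_distr_l. unfold Rminus. rewrite circ_plus, (circ_opp (2 * (_ + _))).
      rewrite (Turn x B), (Turn x' B'), Cinv_1. ring.
    - match goal with |- Rabs ?e < _ => replace e with (snd (Clog (1 + refl (circ x))%C)) by ring end.
      apply Clog_arg_bound.
    - match goal with |- Rabs ?e < _ => replace e with (snd (Clog (1 + refl (circ x'))%C)) by ring end.
      apply Clog_arg_bound.
    - apply Rplus_le_compat_l.
      assert (G : forall n, (n <= N)%nat -> Rsum (fun k => INR (m k) * half_arg (d k) x') n
         <= Rsum (fun k => INR (m k) * half_arg (d k) x) n).
      { induction n as [|n IH]; intros Hn; simpl; [lra|].
        apply Rplus_le_compat; [apply IH; lia|].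
        destruct (setup_cases H (S n) ltac:(lia)) as [D|D].
        - apply Rmult_le_compat_l; [apply pos_INR|now apply half_arg_decreasing].
        - rewrite D; simpl; lra. }
      exact (G N (le_n N)). }
  rewrite Rsum_plus, Rsum_scal in Part1.
  assert (P := step_gap_plus _ _ Part1 Part2). revert P.
  match goal with |- step_gap ?a -> step_gap ?b => replace b with a; [auto|ring] end.
Qed.

End Instance.

Lemma factors_neq_0 (d : nat -> C) (N : nat) (z : C) :
  (forall k, (1 <= k <= N)%nat -> 0 < fst (1 - d k * z)%C) ->
  forall k, (1 <= k <= N)%nat -> (1 - d k * z)%C <> 0%C.
Proof. intros H k Hk. now apply Re_pos_neq_0, H. Qed.

Lemma Re_one_plus_neq (b : C) : 0 < fst (1 + b)%C -> b <> (- (1))%C.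
Proof. intros H E. rewrite E in H; simpl in H; lra. Qed.

Lemma filterlim_power_product {T : Type} (F : (T -> Prop) -> Prop) {FF : Filter F}
  (N : nat) (d : nat -> C) (s : nat -> R) (f : T -> C) (a : C) :
  admissible N d s -> Cmod a <= 1 -> filterlim f F (locally a) ->
  filterlim (fun x => power_product d s N (f x)) F (locally (power_product d s N a)).
Proof.
  intros H Ha Hf. unfold power_product.
  apply (filterlim_Cprod F (fun k x => Cpower (1 - d k * f x)%C (s k))
           (fun k => Cpower (1 - d k * a)%C (s k))).
  intros k Hk. destruct (H k Hk) as (D & S1 & _).
  apply (filterlim_Cpower F (fun x => 1 - d k * f x)%C).
  - now apply (filterlim_one_minus F).
  - apply right_half_one_minus. now apply factor_Cmod_le_1.
  - lra.
Qed.

Theorem setup_stepped_phase (M gam : R) (d : nat -> C) (s : nat -> R) (m : nat -> nat) (N : nat) :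
  half_plane_setup M gam d s m N ->
  stepped_phase (Rsum s N) (phase_log (- ln (4 * (M * M))) gam d s m N) (phase_modulus M gam d s m N).
Proof.
  intros H. assert (MP := hs_pos H). assert (HA := hs_adm H).
  assert (Nonneg : forall t, 0 <= phase_modulus M gam d s m N t).
  { intros t. unfold phase_modulus. apply Rmult_le_pos; [|left; apply Rinv_0_lt_compat; nra].
    apply Rmult_le_pos; [|left; apply exp_pos].
    repeat apply Rmult_le_pos; apply Cmod_ge_0. }
  split.
  - unfold phase_log. apply hol2_plus; [apply hol2_plus|].
    + apply hol2_mult; [apply (hol2_const 2)|].
      apply (hol2_Csum (fun k t => RtoC (s k) * Clog (1 - d k * emap t))%C). intros k Hk.
      apply hol2_mult; [apply (hol2_const (s k))|]. apply hol2_log.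
      * apply hol2_plus; [apply (hol2_const 1)|].
        apply hol2_opp, hol2_mult; [apply (hol2_const (d k))|apply hol2_emap].
      * intros t Ht. now apply (setup_interior_factor M gam d s m N).
    + apply hol2_mult; [apply (hol2_const 2)|]. apply hol2_log.
      * apply hol2_plus; [apply (hol2_const 1)|]. unfold reflection.
        apply hol2_mult; [apply (hol2_const (circ (- (2 * gam))))|].
        apply (hol2_Cprod (fun k t => blaschke (d k) (emap t) ^ m k)%C). intros k Hk.
        destruct (setup_cases _ _ _ _ _ _ H k Hk) as [D|D].
        -- apply hol2_pow. unfold blaschke. apply hol2_mult.
           ++ apply hol2_plus; [apply hol2_emap|apply (hol2_const (- Cconj (d k))%C)].
           ++ apply (hol2_inv (fun t => 1 - d k * emap t)%C).
              ** apply hol2_plus; [apply (hol2_const 1)|].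
                 apply hol2_opp, hol2_mult; [apply (hol2_const (d k))|apply hol2_emap].
              ** intros t Ht. apply Re_pos_neq_0. now apply (setup_interior_factor M gam d s m N).
        -- rewrite D. apply (hol2_const 1).
      * intros t Ht. now apply (setup_interior_reflection M gam d s m N).
    + apply hol2_plus; [|apply (hol2_const (- ln (4 * (M * M)), 2 * gam)%R)].
      apply hol2_mult; [apply (hol2_const (- (RtoC (Rsum s N) * Ci))%C)|apply hol2_id].
  - auto.
  - intros t Ht. rewrite (phase_modulus_eq _ _ _ _ _ _ t H).
    + assert (X := exp_pos (fst (phase_log (- ln (4 * (M * M))) gam d s m N t))). lra.
    + intros k Hk. now apply (setup_interior_factor M gam d s m N).
    + now apply (setup_interior_reflection M gam d s m N).
  - intros t Ht Hr. destruct (phase_modulus_neq_0_factors _ _ _ _ _ _ t H Ht Hr) as [F B].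
    now apply phase_modulus_eq.
  - intros t Ht. unfold phase_modulus, Rdiv. apply (filterlim_Rmult _); [|apply filterlim_const].
    assert (A : filterlim (fun t => Cmod (power_product d s N (emap t)))
       (within upper_half (locally t)) (locally (Cmod (power_product d s N (emap t))))).
    { apply (filterlim_Cmod _). apply (filterlim_power_product _); [exact HA|now apply Cmod_emap_le_1|].
      apply filterlim_emap. }
    assert (B := filterlim_Cmod _ _ _ (setup_continuous_reflection M gam d s m N t H Ht)).
    apply (filterlim_Rmult _).
    + apply (filterlim_Rmult _); now apply (filterlim_Rmult _).
    + apply (filterlim_R_comp _ (fun t => snd t) (fun y => exp (Rsum s N * y))).
      * intros P HP. apply (filter_le_within (F := locally t)). now apply continuous_snd.
      * auto_derive; trivial.
  - intros t Ht Hr. destruct (phase_modulus_neq_0_factors _ _ _ _ _ _ t H Ht Hr) as [F B].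
    apply (filterlim_C _ (phase_log (- ln (4 * (M * M))) gam d s m N)).
    unfold phase_log. apply (filterlim_Cplus _); [apply (filterlim_Cplus _)|].
    + apply (filterlim_Cmult _); [apply filterlim_const|].
      apply (filterlim_Csum _ (fun k t => RtoC (s k) * Clog (1 - d k * emap t))%C
               (fun k => RtoC (s k) * Clog (1 - d k * emap t))%C).
      intros k Hk. apply (filterlim_Cmult _); [apply filterlim_const|].
      apply (filterlim_Clog _); [apply setup_continuous_factor|now apply F].
    + apply (filterlim_Cmult _); [apply filterlim_const|].
      apply (filterlim_Clog _); [now apply (setup_continuous_reflection M gam d s m N)|exact B].
    + apply (filterlim_Cplus _); [|apply filterlim_const].
      apply (filterlim_Cmult _); [apply filterlim_const|].
      intros P HP. apply (filter_le_within (F := locally t)). exact HP.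
  (* On the axis the product has modulus at most [M] and [1 + beta] at most 2; this fixes the
     normalization [4 * (M * M)]. *)
  - intros x. unfold phase_modulus. rewrite emap_axis. simpl snd. rewrite Rmult_0_r, exp_0, Rmult_1_r.
    assert (A := hs_bound H x). assert (A0 := Cmod_ge_0 (power_product d s N (circ x))).
    set (g := Cmod (power_product d s N (circ x))) in *.
    assert (B : Cmod (1 + reflection (circ (- (2 * gam))) d m N (circ x))%C <= 2).
    { eapply Rle_trans; [apply Cmod_triangle|]. rewrite Cmod_1.
      assert (Q := setup_reflection_le_1 M gam d s m N (circ x) H (Req_le _ _ (Cmod_circ x))). lra. }
    assert (B0 := Cmod_ge_0 (1 + reflection (circ (- (2 * gam))) d m N (circ x))%C).
    set (b := Cmod (1 + _)%C) in *.
    apply Rmult_le_reg_r with (4 * (M * M)); [nra|].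
    unfold Rdiv. rewrite Rmult_assoc, Rinv_l, Rmult_1_r, Rmult_1_l by nra.
    rewrite (Rmult_comm 4). apply Rmult_le_compat; nra.
  - destruct (power_product_bounded N d s HA) as [B HB].
    exists (B * B * (2 * 2) / (4 * (M * M))). intros t Ht.
    assert (U := Cmod_emap_le_1 t Ht). specialize (HB _ U).
    assert (B1 : Cmod (1 + reflection (circ (- (2 * gam))) d m N (emap t))%C <= 2).
    { eapply Rle_trans; [apply Cmod_triangle|]. rewrite Cmod_1.
      assert (Q := setup_reflection_le_1 M gam d s m N (emap t) H U). lra. }
    unfold phase_modulus, Rdiv.
    assert (A0 := Cmod_ge_0 (power_product d s N (emap t))).
    assert (B0 := Cmod_ge_0 (1 + reflection (circ (- (2 * gam))) d m N (emap t))%C).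
    rewrite !(Rmult_assoc _ (/ (4 * (M * M))) _), (Rmult_assoc _ (exp _)).
    rewrite (Rmult_comm (/ _)).
    apply Rmult_le_compat_r.
    { apply Rmult_le_pos; [left; apply exp_pos|left; apply Rinv_0_lt_compat; nra]. }
    apply Rmult_le_compat; nra.
  - set (Lg := phase_log (- ln (4 * (M * M))) gam d s m N).
    set (rr := phase_modulus M gam d s m N).
    (* For ordered points the gap is signed; doubling turns the [PI] of [setup_step] into the
       [2 * PI] wanted for [K]. *)
    assert (Main : forall x x', x <= x' -> rr (x, 0) <> 0 ->
      rr (x', 0) <> 0 ->
      snd (Lg (x, 0)) =
      snd (Lg (x', 0)) \/
      2 * PI <= snd (Lg (x, 0)) -
      snd (Lg (x', 0))).
    { intros x x' L Hx Hx'.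
      assert (U : forall y, upper_half (y, 0)) by (intros y; unfold upper_half; simpl; lra).
      destruct (phase_modulus_neq_0_factors _ _ _ _ _ _ _ H (U x) Hx) as [F B].
      destruct (phase_modulus_neq_0_factors _ _ _ _ _ _ _ H (U x') Hx') as [F' B'].
      rewrite emap_axis in B, B'.
      assert (F1 : forall k, (1 <= k <= N)%nat -> 0 < fst (1 - d k * circ x)%C).
      { intros k Hk. rewrite <- emap_axis. now apply F. }
      assert (F1' : forall k, (1 <= k <= N)%nat -> 0 < fst (1 - d k * circ x')%C).
      { intros k Hk. rewrite <- emap_axis. now apply F'. }
      unfold Lg. rewrite !(setup_phase_log_axis M) by assumption.
      assert (S := setup_step M gam d s m N x x' H L (factors_neq_0 _ _ _ F1) (Re_one_plus_neq _ B)
                     (factors_neq_0 _ _ _ F1') (Re_one_plus_neq _ B')).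
      destruct S as [S|S]; [left|right]; lra. }
    intros x x' Hx Hx'.
    destruct (Rle_or_lt x x') as [L|L].
    + destruct (Main x x' L Hx Hx') as [E|E]; [now left|right].
      eapply Rle_trans; [exact E|apply Rle_abs].
    + destruct (Main x' x (Rlt_le _ _ L) Hx' Hx) as [E|E]; [left; now symmetry|right].
      rewrite Rabs_minus_sym. eapply Rle_trans; [exact E|apply Rle_abs].
Qed.

(** * Logarithmic derivatives on the axis and the polar inequality *)

Lemma hol_derive_Csum (u : nat -> C -> C) (v : nat -> C) (N : nat) (t : C) :
  (forall k, (1 <= k <= N)%nat -> hol_derive (u k) t (v k)) ->
  hol_derive (fun z => Csum (fun k => u k z) N) t (Csum v N).
Proof.
  induction N as [|N IH]; intros H; simpl.
  - apply hol_derive_const.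
  - apply hol_derive_plus; [apply IH; intros; apply H; lia|apply H; lia].
Qed.

Lemma hol_derive_Cprod_log (u : nat -> C -> C) (v : nat -> C) (N : nat) (t : C) :
  (forall k, (1 <= k <= N)%nat -> hol_derive (u k) t (u k t * v k)%C) ->
  hol_derive (fun z => Cprod (fun k => u k z) N) t (Cprod (fun k => u k t) N * Csum v N)%C.
Proof.
  induction N as [|N IH]; intros H; simpl.
  - eapply hol_derive_value; [apply (hol_derive_const 1)|ring].
  - eapply hol_derive_value.
    + apply hol_derive_mult; [apply IH; intros; apply H; lia|apply H; lia].
    + cbv beta. ring.
Qed.

Lemma hol_derive_factor (d t : C) :
  hol_derive (fun z => 1 - d * emap z)%C t (- (d * (Ci * emap t)))%C.
Proof.
  eapply hol_derive_value.
  - apply hol_derive_plus; [apply (hol_derive_const 1)|].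
    apply hol_derive_opp, hol_derive_mult; [apply (hol_derive_const d)|apply hol_derive_emap].
  - cbv beta. ring.
Qed.

Lemma two_Re (p : C) : (p + Cconj p)%C = RtoC (2 * fst p).
Proof. apply injective_projections; simpl; ring. Qed.

(** A Blaschke factor only rotates along the circle, at a rate given by the Poisson kernel: with
    [p = pole_term d z], [z B' / B = (1 - conj p) - p]. *)
Lemma hol_derive_blaschke (d : C) (x : R) : Cmod d < 1 ->
  hol_derive (fun t => blaschke d (emap t)) (x, 0)
    (blaschke d (circ x) * (Ci * RtoC (1 - 2 * fst (pole_term d (circ x)))))%C.
Proof.
  intros Hd. assert (N : (1 - d * circ x)%C <> 0%C).
  { apply one_minus_neq_0. now rewrite Cmod_d_circ. }
  assert (Ne := circ_neq_0 x).
  assert (Nc := Cconj_neq_0 _ N). rewrite conj_one_minus in Nc.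
  assert (N2 : (circ x - Cconj d)%C <> 0%C).
  { intros E; apply Nc.
    replace (1 - Cconj d / circ x)%C with ((circ x - Cconj d) / circ x)%C by (field; auto).
    rewrite E; field; auto. }
  eapply hol_derive_value.
  - unfold blaschke. apply hol_derive_mult.
    + apply hol_derive_plus; [apply hol_derive_emap|apply (hol_derive_const (- Cconj d)%C)].
    + apply hol_derive_inv; [apply hol_derive_factor|]. now rewrite emap_axis.
  - cbv beta. rewrite emap_axis.
    rewrite RtoC_minus, <- two_Re. unfold pole_term.
    assert (Ec : Cconj (- (d * circ x) / (1 - d * circ x))%C
       = (- (Cconj d / circ x) / (1 - Cconj d / circ x))%C).
    { rewrite Cdiv_conj, conj_one_minus, Copp_conj, Cmult_conj, (Cconj_unit _ (Cmod_circ x)) by exact N.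
      reflexivity. }
    rewrite Ec. unfold blaschke. field. repeat split; auto.
Qed.

Lemma Csum_scal (c : C) (u : nat -> C) (N : nat) :
  Csum (fun k => c * u k)%C N = (c * Csum u N)%C.
Proof. induction N as [|N IH]; simpl; [ring|rewrite IH; ring]. Qed.

Lemma Csum_RtoC (u : nat -> R) (N : nat) : Csum (fun k => RtoC (u k)) N = RtoC (Rsum u N).
Proof. induction N as [|N IH]; simpl; [reflexivity|now rewrite IH, RtoC_plus]. Qed.

(* [z G'(z) / G(z)] for [G = power_product d s N]. *)
Definition log_derivative (d : nat -> C) (s : nat -> R) (N : nat) (z : C) : C :=
  Csum (fun k => RtoC (s k) * pole_term (d k) z)%C N.

(** The rates of the outer factors add up to [n - 2 Re q] over all factors, because a zero on the
    circle contributes a vanishing Poisson kernel. *)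
Lemma hol_derive_reflection (om : C) (d : nat -> C) (s : nat -> R) (m : nat -> nat) (N : nat) (x : R) :
  admissible N d s -> outer_multiplicity N d s m ->
  (forall k, (1 <= k <= N)%nat -> (1 - d k * circ x)%C <> 0%C) ->
  hol_derive (fun t => reflection om d m N (emap t)) (x, 0)
    (reflection om d m N (circ x)
     * (Ci * RtoC (Rsum s N - 2 * fst (log_derivative d s N (circ x)))))%C.
Proof.
  intros HA HM HN. unfold reflection.
  eapply hol_derive_value.
  - apply hol_derive_mult; [apply (hol_derive_const om)|].
    apply (hol_derive_Cprod_log (fun k t => blaschke (d k) (emap t) ^ m k)%C
      (fun k => Ci * RtoC (INR (m k) * (1 - 2 * fst (pole_term (d k) (circ x)))))%C).
    intros k Hk. destruct (multiplicity_cases _ _ _ _ _ HA HM Hk) as [D|D].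
    + assert (P := hol_derive_pow _ _ _ (m k) (hol_derive_blaschke (d k) x D)).
      eapply hol_derive_value; [exact P|]. cbv beta. rewrite !emap_axis, RtoC_mult.
      destruct (m k) as [|j]; [simpl; ring|]. simpl pred. rewrite Cpow_S. ring.
    + rewrite D. eapply hol_derive_value; [apply (hol_derive_const 1)|].
      simpl. rewrite Rmult_0_l. ring.
  - cbv beta. rewrite !emap_axis, Csum_scal, Csum_RtoC.
    replace (Rsum (fun k => INR (m k) * (1 - 2 * fst (pole_term (d k) (circ x)))) N)
      with (Rsum s N - 2 * fst (log_derivative d s N (circ x))); [ring|].
    unfold log_derivative. rewrite fst_Csum.
    replace (Rsum s N - 2 * _)
      with (Rsum s N + (-2) * Rsum (fun k => fst (RtoC (s k) * pole_term (d k) (circ x))%C) N) by ring.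
    rewrite <- Rsum_scal, <- Rsum_plus. apply Rsum_ext. intros k Hk.
    destruct (HA k Hk) as (D & S1 & _), (HM k Hk) as (M1 & M2).
    replace (fst (RtoC (s k) * pole_term (d k) (circ x))%C) with (s k * fst (pole_term (d k) (circ x)))
      by (simpl; ring).
    destruct D as [D|D].
    + rewrite (M1 D). ring.
    + assert (Q := pole_term_Re (d k) (circ x) (HN k Hk)).
      rewrite D, Cmod_circ in Q. unfold Rdiv in Q.
      replace ((1 - 1 * 1 * (1 * 1)) * _) with 0 in Q by ring.
      rewrite Q, (M2 D). simpl INR. 
      replace (fst (pole_term (d k) (circ x))) with (1 / 2) by lra. field.
Qed.

Lemma hol_derive_phase_log (c0 gam x : R) (d : nat -> C) (s : nat -> R) (m : nat -> nat) (N : nat) (v : C) :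
  admissible N d s -> outer_multiplicity N d s m ->
  (forall k, (1 <= k <= N)%nat -> 0 < fst (1 - d k * circ x)%C) ->
  reflection (circ (- (2 * gam))) d m N (circ x) = v -> 0 < fst (1 + v)%C ->
  hol_derive (phase_log c0 gam d s m N) (x, 0)
    (2 * (Ci * log_derivative d s N (circ x))
     + 2 * (v * (Ci * RtoC (Rsum s N - 2 * fst (log_derivative d s N (circ x)))) / (1 + v))
     - RtoC (Rsum s N) * Ci)%C.
Proof.
  intros HA HM HF Hv Pv. unfold phase_log.
  assert (NZ := factors_neq_0 _ _ _ HF).
  eapply hol_derive_value.
  - apply hol_derive_plus; [apply hol_derive_plus|].
    + apply hol_derive_mult; [apply (hol_derive_const 2)|].
      apply (hol_derive_Csum (fun k t => RtoC (s k) * Clog (1 - d k * emap t))%C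
        (fun k => Ci * (RtoC (s k) * pole_term (d k) (circ x)))%C).
      intros k Hk. eapply hol_derive_value.
      * apply hol_derive_mult; [apply (hol_derive_const (s k))|].
        apply hol_derive_log; [apply hol_derive_factor|]. rewrite emap_axis. now apply HF.
      * cbv beta. rewrite emap_axis. unfold pole_term. field. now apply NZ.
    + apply hol_derive_mult; [apply (hol_derive_const 2)|].
      apply hol_derive_log.
      * apply hol_derive_plus; [apply (hol_derive_const 1)|].
        apply (hol_derive_reflection _ _ _ _ _ _ HA HM NZ).
      * rewrite emap_axis, Hv. exact Pv.
    + apply hol_derive_plus; [|apply (hol_derive_const (c0, 2 * gam)%R)].
      apply hol_derive_mult; [apply (hol_derive_const (- (RtoC (Rsum s N) * Ci))%C)|apply hol_derive_id].
  - cbv beta. rewrite emap_axis, Hv, Csum_scal. fold (log_derivative d s N (circ x)).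
    field. now apply Re_pos_neq_0.
Qed.

(** As [omega] is free, [beta] can take any unimodular value [v] at the point. The derivative [l] of
    the logarithm of [K] satisfies [(1 + v) (l + i n) = 2 i (q + v (n - conj q))]. Since [l] is
    real, [l^2 + n^2 = |l + i n|^2] is the factor in [stepped_phase_bernstein], and [|1 + v|^2]
    cancels against the same factor in [|K|]. At [v = -1] the function [H] vanishes at the point, so
    this value is left to a limit. *)
Theorem polar_bound (M x : R) (d : nat -> C) (s : nat -> R) (N : nat) (v : C) :
  admissible N d s -> 0 < M -> (forall y, Cmod (power_product d s N (circ y)) <= M) ->
  power_product d s N (circ x) <> 0%C -> Cmod v = 1 -> v <> (- (1))%C ->
  Cmod (power_product d s N (circ x))
  * Cmod (log_derivative d s N (circ x)
          + v * (RtoC (Rsum s N) - Cconj (log_derivative d s N (circ x))))%C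
  <= Rsum s N * M.
Proof.
  intros HA HM Hb Hg Hv Nv.
  destruct (outer_multiplicity_exists _ _ _ HA) as [m Hm].
  assert (Hc := fun k => multiplicity_cases N d s m k HA Hm).
  assert (U := blaschke_product_unit d m N (circ x) Hc (Cmod_circ x)).
  set (Pr := Cprod (fun k => blaschke (d k) (circ x) ^ m k)%C N) in *.
  assert (NPr : Pr <> 0%C) by (intros E; rewrite E, Cmod_0 in U; lra).
  (* [omega] has to be [v] divided by the Blaschke product at the point, and
     [omega = e^(- 2 i gam)]. *)
  destruct (circ_surjective (v / Pr)%C) as (phi & _ & Hphi).
  { rewrite Cmod_div, Hv, U by exact NPr. field. }
  set (gam := - phi / 2).
  assert (Ev : reflection (circ (- (2 * gam))) d m N (circ x) = v).
  { unfold reflection. fold Pr. replace (- (2 * gam)) with phi by (unfold gam; field).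
    rewrite <- Hphi. field. exact NPr. }
  assert (Setup : half_plane_setup M gam d s m N).
  { split; auto. exists x. rewrite Ev. exact Nv. }
  assert (Pv : 0 < fst (1 + v)%C) by (apply Re_one_plus; [lra|exact Nv]).
  assert (HF : forall k, (1 <= k <= N)%nat -> 0 < fst (1 - d k * circ x)%C).
  { intros k Hk. destruct (HA k Hk) as (D & S1 & _).
    apply Re_lt_1_of_unit_disk; [rewrite Cmod_d_circ; exact D|].
    eapply power_product_factor_neq_0; [|exact Hk|exact Hg]. lra. }
  assert (Hn : 0 <= Rsum s N).
  { apply Rsum_nonneg. intros k Hk. destruct (HA k Hk) as (_ & S1 & _). lra. }
  assert (D := hol_derive_phase_log (- ln (4 * (M * M))) gam x d s m N v HA Hm HF Ev Pv).
  set (q := log_derivative d s N (circ x)) in *.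
  set (n := Rsum s N) in *.
  set (l := (2 * (Ci * q) + 2 * (v * (Ci * RtoC (n - 2 * fst q)) / (1 + v)) - RtoC n * Ci)%C) in *.
  assert (Nz := Re_pos_neq_0 _ Pv).
  assert (Key : ((1 + v) * (l + RtoC n * Ci) = 2 * Ci * (q + v * (RtoC n - Cconj q)))%C).
  { unfold l. rewrite RtoC_minus, <- two_Re. field. exact Nz. }
  (* [v / (1 + v)] has real part 1/2 when [|v| = 1], so [Im l = 2 Re q + (n - 2 Re q) - n]. *)
  assert (Real : snd l = 0).
  { assert (Ev2 := Cmod_sqr v). rewrite Hv in Ev2. unfold Cdot in Ev2.
    simpl in Pv.
    assert (H1 : fst (v / (1 + v))%C = / 2).
    { simpl. apply Rmult_eq_reg_r with (2 * (1 + fst v)); [|lra].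
      replace ((1 + fst v) * ((1 + fst v) * 1) + (0 + snd v) * ((0 + snd v) * 1))
        with (2 * (1 + fst v)) by lra.
      replace (fst v * ((1 + fst v) / (2 * (1 + fst v))) - snd v * (- (0 + snd v) / (2 * (1 + fst v))))
        with ((fst v + (fst v * fst v + snd v * snd v)) / (2 * (1 + fst v))) by (field; lra).
      rewrite <- Ev2. field. lra. }
    unfold l. replace (v * (Ci * RtoC (n - 2 * fst q)) / (1 + v))%C
      with (v / (1 + v) * (Ci * RtoC (n - 2 * fst q)))%C by (field; exact Nz).
    revert H1. generalize (v / (1 + v))%C. intros w H1. simpl. rewrite H1. field. }
  assert (El : l = RtoC (fst l)) by (apply injective_projections; simpl; [reflexivity|exact Real]).
  rewrite El in D. clearbody l.
  assert (Hr : phase_modulus M gam d s m N (x, 0) <> 0).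
  { unfold phase_modulus. rewrite emap_axis, Ev. simpl snd. rewrite Rmult_0_r, exp_0.
    apply Cmod_gt_0 in Hg. apply Cmod_gt_0 in Nz.
    apply Rgt_not_eq. apply Rdiv_lt_0_compat; [|nra]. rewrite Rmult_1_r.
    repeat apply Rmult_lt_0_compat; assumption. }
  assert (B := stepped_phase_bernstein _ _ _ x (fst l) (setup_stepped_phase _ _ _ _ _ _ Setup) Hn Hr D).
  unfold phase_modulus in B. rewrite emap_axis, Ev in B. simpl snd in B.
  rewrite Rmult_0_r, exp_0, Rmult_1_r in B. fold n in B.
  set (g := Cmod (power_product d s N (circ x))) in *.
  set (w := (q + v * (RtoC n - Cconj q))%C) in *.
  assert (Mw : Cmod (1 + v)%C * Cmod (1 + v)%C * (fst l * fst l + n * n) = 4 * (Cmod w * Cmod w)).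
  { assert (E1 : Cmod (l + RtoC n * Ci)%C * Cmod (l + RtoC n * Ci)%C = fst l * fst l + n * n).
    { rewrite Cmod_sqr. unfold Cdot. simpl. rewrite Real. ring. }
    rewrite <- E1. apply (f_equal Cmod) in Key. rewrite !Cmod_mult, Cmod_Ci, Cmod_R in Key.
    rewrite (Rabs_right 2) in Key by lra.
    transitivity ((Cmod (1 + v)%C * Cmod (l + RtoC n * Ci)%C)
      * (Cmod (1 + v)%C * Cmod (l + RtoC n * Ci)%C)); [ring|].
    rewrite Key. ring. }
  assert (Fin : (g * Cmod w) * (g * Cmod w) <= (n * M) * (n * M)).
  { assert (MM : 0 < 4 * (M * M)) by nra.
    apply Rmult_le_compat_r with (r := 4 * (M * M)) in B; [|lra].
    replace (g * g * (Cmod (1 + v)%C * Cmod (1 + v)%C) / (4 * (M * M)) * (fst l * fst l + n * n) * (4 * (M * M)))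
      with (g * g * (Cmod (1 + v)%C * Cmod (1 + v)%C * (fst l * fst l + n * n))) in B by (field; lra).
    rewrite Mw in B. nra. }
  assert (G0 := Cmod_ge_0 w). assert (g0 := Cmod_ge_0 (power_product d s N (circ x))). fold g in g0.
  apply Rsqr_incr_0; unfold Rsqr; [exact Fin|nra|nra].
Qed.

(** * Inequalities on the circle *)

Lemma filterlim_circ (x : R) : filterlim circ (locally x) (locally (circ x)).
Proof. exact (curve_derive_continuous _ _ _ (curve_derive_circ x)). Qed.

Lemma filterlim_circ_shift (x : R) :
  filterlim (fun y => circ (x + y)) (locally 0) (locally (circ x)).
Proof.
  apply (filterlim_comp _ _ _ (fun y => x + y) circ (locally 0) (locally x)); [|apply filterlim_circ].
  replace (locally x) with (locally (x + 0)) by (f_equal; ring).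
  apply (ex_derive_continuous (fun y => x + y)). auto_derive; trivial.
Qed.

Lemma circ_neq_1 (y : R) : 0 < y < PI -> circ y <> 1%C.
Proof.
  intros Hy E. replace y with (2 * (y / 2)) in E by field.
  destruct (circ_1_multiple _ E) as [j Hj]. assert (P := PI_RGT_0).
  assert (A : 0 * PI < IZR j * PI) by lra. assert (B : IZR j * PI < 1 * PI) by lra.
  apply Rmult_lt_reg_r in A; [|exact P]. apply Rmult_lt_reg_r in B; [|exact P].
  apply lt_IZR in A. apply lt_IZR in B. lia.
Qed.

Lemma ball_0_lt (d : posreal) (y : R) : ball 0 d y -> y < d.
Proof.
  intros H. apply ball_Rabs_lt, Rabs_lt_between in H. lra.
Qed.

(** The inequality is continuous in [v], and [-1] is approached by [- circ y] as [y] decreases to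
    0. *)
Lemma polar_bound_unit (M x : R) (d : nat -> C) (s : nat -> R) (N : nat) (v : C) :
  admissible N d s -> 0 < M -> (forall y, Cmod (power_product d s N (circ y)) <= M) ->
  power_product d s N (circ x) <> 0%C -> Cmod v = 1 ->
  Cmod (power_product d s N (circ x))
  * Cmod (log_derivative d s N (circ x)
          + v * (RtoC (Rsum s N) - Cconj (log_derivative d s N (circ x))))%C
  <= Rsum s N * M.
Proof.
  intros HA HM Hb Hg Hv.
  destruct (Ceq_dec v (- (1))%C) as [->|Nv]; [|now apply polar_bound].
  set (q := log_derivative d s N (circ x)). set (n := Rsum s N).
  set (g := Cmod (power_product d s N (circ x))).
  assert (Lim := continuous_le_right
    (fun y => g * Cmod (q + - circ y * (RtoC n - Cconj q))%C) (fun _ => n * M)).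
  cbv beta in Lim. rewrite circ_0 in Lim. apply Lim.
  - unfold continuous. rewrite circ_0.
    apply (filterlim_Rmult _); [apply filterlim_const|]. apply (filterlim_Cmod _).
    apply (filterlim_Cplus _); [apply filterlim_const|].
    apply (filterlim_Cmult _); [|apply filterlim_const].
    apply (filterlim_Copp _). rewrite <- circ_0. apply filterlim_circ.
  - apply continuous_const.
  - exists (mkposreal PI PI_RGT_0). intros y Hy yp. apply polar_bound; auto.
    + rewrite Cmod_opp; apply Cmod_circ.
    + intros E. apply ball_0_lt in Hy. apply (circ_neq_1 y (conj yp Hy)).
      replace (circ y) with (- - circ y)%C by ring. rewrite E; ring.
Qed.

Lemma aligning_unit (a b : C) : exists v : C, Cmod v = 1 /\ Cmod (a + v * b)%C = Cmod a + Cmod b.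
Proof.
  destruct (Ceq_dec a 0%C) as [->|Na].
  - exists 1%C. rewrite Cmod_1, Cmod_0, Rplus_0_l. split; [reflexivity|f_equal; ring].
  - destruct (Ceq_dec b 0%C) as [->|Nb].
    + exists 1%C. rewrite Cmod_1, Cmod_0, Rplus_0_r. split; [reflexivity|f_equal; ring].
    + assert (A := proj1 (Cmod_gt_0 a) Na). assert (B := proj1 (Cmod_gt_0 b) Nb).
      exists (a / b * RtoC (Cmod b / Cmod a))%C. split.
      * rewrite Cmod_mult, Cmod_div, Cmod_R by exact Nb.
        rewrite Rabs_right; [field; lra|]. apply Rle_ge, Rlt_le. now apply Rdiv_lt_0_compat.
      * replace (a + a / b * RtoC (Cmod b / Cmod a) * b)%C with (a * RtoC (1 + Cmod b / Cmod a))%C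
          by (rewrite RtoC_plus; field; exact Nb).
        rewrite Cmod_mult, Cmod_R, Rabs_right; [field; lra|].
        apply Rle_ge. assert (0 < Cmod b / Cmod a) by now apply Rdiv_lt_0_compat. lra.
Qed.

(* In terms of [G] this reads [|G'| + |n G - z G'| <= n M]. *)
Lemma derivative_sum_bound (M x : R) (d : nat -> C) (s : nat -> R) (N : nat) :
  admissible N d s -> 0 < M -> (forall y, Cmod (power_product d s N (circ y)) <= M) ->
  power_product d s N (circ x) <> 0%C ->
  Cmod (power_product d s N (circ x))
  * (Cmod (log_derivative d s N (circ x)) + Cmod (RtoC (Rsum s N) - log_derivative d s N (circ x))%C)
  <= Rsum s N * M.
Proof.
  intros HA HM Hb Hg. set (q := log_derivative d s N (circ x)).
  destruct (aligning_unit q (RtoC (Rsum s N) - Cconj q)%C) as (v & Hv & Ev).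
  replace (Cmod (RtoC (Rsum s N) - q)%C) with (Cmod (RtoC (Rsum s N) - Cconj q)%C).
  - rewrite <- Ev. now apply polar_bound_unit.
  - rewrite <- (Cmod_conj (RtoC (Rsum s N) - q)%C). f_equal.
    apply injective_projections; simpl; ring.
Qed.

(** A weighted sum of Poisson kernels: on the circle every term is nonnegative, positive for an
    outer zero and 0 for a zero on the circle. This decides between equality and strictness. *)
Lemma deficit_eq (d : nat -> C) (s : nat -> R) (N : nat) (z : C) :
  Rsum s N - 2 * fst (log_derivative d s N z)
  = Rsum (fun k => s k * (1 - 2 * fst (pole_term (d k) z))) N.
Proof.
  unfold log_derivative. rewrite fst_Csum.
  replace (Rsum s N - 2 * _)
      with (Rsum s N + (-2) * Rsum (fun k => fst (RtoC (s k) * pole_term (d k) z)%C) N) by ring.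
  rewrite <- Rsum_scal, <- Rsum_plus. apply Rsum_ext. intros k _. simpl. ring.
Qed.

Lemma deficit_term_nonneg (d z : C) : Cmod d <= 1 -> Cmod z = 1 -> (1 - d * z)%C <> 0%C ->
  0 <= 1 - 2 * fst (pole_term d z).
Proof.
  intros D Z Nz. rewrite pole_term_Re by exact Nz. rewrite Z.
  apply Cmod_gt_0 in Nz. assert (D0 := Cmod_ge_0 d).
  apply Rmult_le_pos; [nra|]. left; apply Rinv_0_lt_compat; nra.
Qed.

Lemma deficit_nonneg (d : nat -> C) (s : nat -> R) (N : nat) (z : C) :
  admissible N d s -> Cmod z = 1 -> (forall k, (1 <= k <= N)%nat -> (1 - d k * z)%C <> 0%C) ->
  0 <= Rsum s N - 2 * fst (log_derivative d s N z).
Proof.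
  intros HA Hz HN. rewrite deficit_eq. apply Rsum_nonneg. intros k Hk.
  destruct (HA k Hk) as (D & S1 & _).
  apply Rmult_le_pos; [lra|]. now apply deficit_term_nonneg; auto.
Qed.

Lemma Rsum_pos (u : nat -> R) (N k : nat) :
  (forall i, (1 <= i <= N)%nat -> 0 <= u i) -> (1 <= k <= N)%nat -> 0 < u k -> 0 < Rsum u N.
Proof.
  induction N as [|N IH]; simpl; intros H Hk P; [lia|].
  assert (A := Rsum_nonneg u N ltac:(intros; apply H; lia)). assert (B := H (S N) ltac:(lia)).
  destruct (PeanoNat.Nat.eq_dec k (S N)) as [->|Nk]; [lra|].
  assert (0 < Rsum u N) by (apply IH; [intros; apply H; lia|lia|exact P]). lra.
Qed.

Lemma deficit_pos (d : nat -> C) (s : nat -> R) (N k : nat) (z : C) :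
  admissible N d s -> Cmod z = 1 -> (forall k, (1 <= k <= N)%nat -> (1 - d k * z)%C <> 0%C) ->
  (1 <= k <= N)%nat -> Cmod (d k) < 1 ->
  0 < Rsum s N - 2 * fst (log_derivative d s N z).
Proof.
  intros HA Hz HN Hk Dk. rewrite deficit_eq. apply Rsum_pos with k; [|exact Hk|].
  - intros i Hi. destruct (HA i Hi) as (D & S1 & _).
    apply Rmult_le_pos; [lra|]. now apply deficit_term_nonneg; auto.
  - destruct (HA k Hk) as (D & S1 & _).
    apply Rmult_lt_0_compat; [lra|]. rewrite pole_term_Re by auto. rewrite Hz.
    assert (Nz := proj1 (Cmod_gt_0 _) (HN k Hk)). assert (D0 := Cmod_ge_0 (d k)).
    apply Rdiv_lt_0_compat; nra.
Qed.

Lemma deficit_zero (d : nat -> C) (s : nat -> R) (N : nat) (z : C) :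
  Cmod z = 1 -> (forall k, (1 <= k <= N)%nat -> (1 - d k * z)%C <> 0%C) ->
  (forall k, (1 <= k <= N)%nat -> Cmod (d k) = 1) ->
  Rsum s N - 2 * fst (log_derivative d s N z) = 0.
Proof.
  intros Hz HN HD. rewrite deficit_eq.
  replace 0 with (0 * Rsum s N) by ring. rewrite <- Rsum_scal. apply Rsum_ext. intros k Hk.
  rewrite pole_term_Re, (HD k Hk), Hz by auto. unfold Rdiv. ring.
Qed.

(** For [s = 1] the convention [Cpower 0 0 = 1] makes this the correct value [- d] also at the zero
    of the factor. *)
Definition factor_derive (d : C) (s : R) (z : C) : C :=
  (RtoC s * - d * Cpower (1 - d * z) (s - 1))%C.

Fixpoint power_product_derive (d : nat -> C) (s : nat -> R) (N : nat) (z : C) : C :=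
  match N with
  | O => RtoC 0
  | S n => (power_product_derive d s n z * Cpower (1 - d (S n) * z) (s (S n))
            + power_product d s n z * factor_derive (d (S n)) (s (S n)) z)%C
  end.

Lemma Cpower_pred (w : C) (s : R) : w <> 0%C -> (Cpower w (s - 1) * w)%C = Cpower w s \/ fst w <= 0.
Proof.
  intros Nw. destruct (Rlt_or_le 0 (fst w)) as [L|L]; [left|now right].
  rewrite !Cpower_neq_0_eq by exact Nw. rewrite <- (Cexp_Clog w L) at 2.
  rewrite <- Cexp_plus. f_equal. rewrite RtoC_minus. ring.
Qed.

Lemma power_product_derive_log (d : nat -> C) (s : nat -> R) (N : nat) (z : C) :
  (forall k, (1 <= k <= N)%nat -> 0 < fst (1 - d k * z)%C) ->
  (z * power_product_derive d s N z)%C = (power_product d s N z * log_derivative d s N z)%C.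
Proof.
  unfold power_product, log_derivative. induction N as [|N IH]; intros H; simpl; [ring|].
  fold (power_product d s N z) in *.
  assert (P := H (S N) ltac:(lia)).
  assert (Nw := Re_pos_neq_0 _ P).
  destruct (Cpower_pred _ (s (S N)) Nw) as [E|E]; [|lra].
  rewrite Cmult_plus_distr_l.
  rewrite Cmult_assoc, IH by (intros; apply H; lia).
  unfold factor_derive, pole_term. rewrite <- E. field. exact Nw.
Qed.

Lemma power_product_factors_pos (N : nat) (d : nat -> C) (s : nat -> R) (z : C) :
  admissible N d s -> Cmod z <= 1 -> power_product d s N z <> 0%C ->
  forall k, (1 <= k <= N)%nat -> 0 < fst (1 - d k * z)%C.
Proof.
  intros HA Hz Hg k Hk. destruct (HA k Hk) as (D & S1 & _).
  apply Re_lt_1_of_unit_disk; [now apply factor_Cmod_le_1|].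
  eapply power_product_factor_neq_0; [|exact Hk|exact Hg]. lra.
Qed.

Lemma Cmod_power_product_derive (N : nat) (d : nat -> C) (s : nat -> R) (z : C) :
  admissible N d s -> Cmod z = 1 -> power_product d s N z <> 0%C ->
  Cmod (power_product_derive d s N z) = Cmod (power_product d s N z) * Cmod (log_derivative d s N z).
Proof.
  intros HA Hz Hg.
  assert (E := power_product_derive_log d s N z (power_product_factors_pos _ _ _ _ HA (Req_le _ _ Hz) Hg)).
  apply (f_equal Cmod) in E. rewrite !Cmod_mult, Hz in E. lra.
Qed.

Lemma filterlim_power_product_derive {T : Type} (F : (T -> Prop) -> Prop) {FF : Filter F}
  (N : nat) (d : nat -> C) (s : nat -> R) (f : T -> C) (a : C) :
  admissible N d s -> Cmod a <= 1 -> filterlim f F (locally a) ->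
  filterlim (fun x => power_product_derive d s N (f x)) F (locally (power_product_derive d s N a)).
Proof.
  intros H Ha Hf. induction N as [|N IH]; simpl; [apply filterlim_const|].
  assert (H' : admissible N d s) by (intros k Hk; apply H; lia).
  destruct (H (S N)) as (D & S1 & _); [lia|].
  assert (W : filterlim (fun x => 1 - d (S N) * f x)%C F (locally (1 - d (S N) * a)%C)).
  { now apply (filterlim_one_minus F). }
  assert (RH := right_half_one_minus _ (factor_Cmod_le_1 _ _ D Ha)).
  apply (filterlim_Cplus F); apply (filterlim_Cmult F).
  - now apply IH.
  - apply (filterlim_Cpower F); [exact W|exact RH|lra].
  - now apply (filterlim_power_product F).
  - unfold factor_derive. apply (filterlim_Cmult F); [apply filterlim_const|].
    apply (filterlim_Cpower F); [exact W|exact RH|lra].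
Qed.

(** [|n - q|^2 - |q|^2 = n (n - 2 Re q)]. *)
Lemma Cmod_le_reflected (q : C) (n : R) : 0 <= n -> 0 <= n - 2 * fst q ->
  Cmod q <= Cmod (RtoC n - q)%C.
Proof.
  intros Hn H. apply Rsqr_incr_0; try apply Cmod_ge_0. unfold Rsqr.
  rewrite !Cmod_sqr. unfold Cdot; simpl. nra.
Qed.

Lemma Cmod_lt_reflected (q : C) (n : R) : 0 < n -> 0 < n - 2 * fst q ->
  Cmod q < Cmod (RtoC n - q)%C.
Proof.
  intros Hn H. apply Rsqr_incrst_0; try apply Cmod_ge_0. unfold Rsqr.
  rewrite !Cmod_sqr. unfold Cdot; simpl. nra.
Qed.

(** If [1 - d e^(i x) = 0], then [1 - d e^(i (x + y)) = 1 - e^(i y)], nonzero for [0 < y < PI].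
    Being isolated from the right, zeros on the circle can be reached by a limit. *)
Lemma power_product_nonzero_nearby (N : nat) (d : nat -> C) (s : nat -> R) (x : R) :
  admissible N d s -> locally 0 (fun y => 0 < y -> power_product d s N (circ (x + y)) <> 0%C).
Proof.
  intros HA.
  assert (Q : locally 0 (fun y => 0 < y -> forall k, (1 <= k <= N)%nat -> (1 - d k * circ (x + y))%C <> 0%C)).
  { clear HA. induction N as [|N IH].
    - apply filter_forall. intros y _ k Hk; lia.
    - assert (K : locally 0 (fun y => 0 < y -> (1 - d (S N) * circ (x + y))%C <> 0%C)).
      { destruct (Ceq_dec (1 - d (S N) * circ x)%C 0%C) as [E|E].
        - exists (mkposreal PI PI_RGT_0). intros y Hy yp E2.
          rewrite circ_plus in E2.
          apply ball_0_lt in Hy. apply (circ_neq_1 y (conj yp Hy)).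
          assert (W : (d (S N) * circ x)%C = 1%C)
            by (replace (d (S N) * circ x)%C with (1 - (1 - d (S N) * circ x))%C by ring; rewrite E; ring).
          replace (circ y) with (1 - (1 - (d (S N) * circ x) * circ y))%C.
          * rewrite <- Cmult_assoc, E2. ring.
          * rewrite W. ring.
        - assert (L : filterlim (fun y => Cmod (1 - d (S N) * circ (x + y))%C) (locally 0)
             (locally (Cmod (1 - d (S N) * circ x)%C))).
          { apply (filterlim_Cmod _), (filterlim_one_minus _), filterlim_circ_shift. }
          apply Cmod_gt_0 in E.
          generalize (proj1 (filterlim_locally _ _) L (mkposreal _ E)). apply filter_imp.
          intros y Hy _ Z. rewrite Z, Cmod_0 in Hy.
          apply ball_Rabs_lt, Rabs_lt_between in Hy. simpl in Hy. lra. }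
      generalize (filter_and _ _ IH K). apply filter_imp.
      intros y [A B] yp k Hk. destruct (PeanoNat.Nat.eq_dec k (S N)) as [->|Nk]; [now apply B|].
      apply A; [exact yp|lia]. }
  revert Q; apply filter_imp. intros y A yp. apply power_product_neq_0. now apply A.
Qed.

(** Away from zeros, [2 |G'| = 2 |G| |q| <= |G| (|q| + |n - q|) <= n M]. A zero on the circle is the
    limit of points to its right, where this applies. *)
Theorem derivative_bound (M x : R) (d : nat -> C) (s : nat -> R) (N : nat) :
  admissible N d s -> 0 < M -> (forall y, Cmod (power_product d s N (circ y)) <= M) ->
  Cmod (power_product_derive d s N (circ x)) <= Rsum s N / 2 * M.
Proof.
  intros HA HM Hb.
  assert (Hn : 0 <= Rsum s N).
  { apply Rsum_nonneg. intros k Hk. destruct (HA k Hk) as (_ & S1 & _). lra. }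
  assert (Gen : forall y, power_product d s N (circ y) <> 0%C ->
     Cmod (power_product_derive d s N (circ y)) <= Rsum s N / 2 * M).
  { intros y Hg. assert (Z := Cmod_circ y).
    rewrite (Cmod_power_product_derive _ _ _ _ HA Z Hg).
    assert (B := derivative_sum_bound M y d s N HA HM Hb Hg).
    assert (P := power_product_factors_pos _ _ _ _ HA (Req_le _ _ Z) Hg).
    assert (C1 := Cmod_le_reflected _ _ Hn (deficit_nonneg d s N (circ y) HA Z (factors_neq_0 _ _ _ P))).
    apply Cmod_gt_0 in Hg. nra. }
  assert (Lim := continuous_le_right (fun y => Cmod (power_product_derive d s N (circ (x + y))))
    (fun _ => Rsum s N / 2 * M)).
  cbv beta in Lim. rewrite Rplus_0_r in Lim. apply Lim.
  - unfold continuous. rewrite Rplus_0_r. apply (filterlim_Cmod _).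
    apply (filterlim_power_product_derive _); [exact HA|rewrite Cmod_circ; lra|].
    apply filterlim_circ_shift.
  - apply continuous_const.
  - generalize (power_product_nonzero_nearby N d s x HA). apply filter_imp.
    intros y Hy yp. now apply Gen, Hy.
Qed.

(** * Attained maxima, strictness and the case of equality *)

Lemma circle_max (g : C -> C) :
  (forall x, filterlim (fun y => g (circ y)) (locally x) (locally (g (circ x)))) ->
  exists x1, forall z, Cmod z = 1 -> Cmod (g z) <= Cmod (g (circ x1)).
Proof.
  intros H. assert (P := PI_RGT_0).
  destruct (continuity_ab_maj (fun y => Cmod (g (circ y))) (- PI) PI) as (x1 & A & _); [lra| |].
  - intros c _. apply continuity_pt_filterlim. apply (filterlim_Cmod _), H.
  - exists x1. intros z Hz. destruct (circ_surjective z Hz) as (y & Hy & ->). now apply A.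
Qed.

Lemma circle_continuous (N : nat) (d : nat -> C) (s : nat -> R) (x : R) : admissible N d s ->
  filterlim (fun y => power_product d s N (circ y)) (locally x) (locally (power_product d s N (circ x))).
Proof.
  intros HA. apply (filterlim_power_product _); [exact HA|rewrite Cmod_circ; lra|apply filterlim_circ].
Qed.

Lemma circle_continuous_derive (N : nat) (d : nat -> C) (s : nat -> R) (x : R) : admissible N d s ->
  filterlim (fun y => power_product_derive d s N (circ y)) (locally x)
    (locally (power_product_derive d s N (circ x))).
Proof.
  intros HA. apply (filterlim_power_product_derive _);
    [exact HA|rewrite Cmod_circ; lra|apply filterlim_circ].
Qed.

Lemma circle_nonzero (N : nat) (d : nat -> C) (s : nat -> R) : admissible N d s ->
  exists x, power_product d s N (circ x) <> 0%C.
Proof.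
  intros HA. destruct (power_product_nonzero_nearby N d s 0 HA) as [e He].
  assert (P := cond_pos e). exists (0 + e / 2). apply He; [|lra].
  apply Rabs_lt_ball. rewrite Rabs_right; lra.
Qed.

(** The cofactors [g] and [g1] are chosen before [d2], so they serve both the original product and
    the one with its [k]-th zero moved. *)
Lemma power_product_split (d : nat -> C) (s : nat -> R) (N k : nat) (z : C) : (1 <= k <= N)%nat ->
  exists g g1 : C, forall d2 : nat -> C, (forall i, i <> k -> d2 i = d i) ->
    power_product d2 s N z = (g * Cpower (1 - d2 k * z) (s k))%C /\
    power_product_derive d2 s N z
    = (g1 * Cpower (1 - d2 k * z) (s k) + g * factor_derive (d2 k) (s k) z)%C.
Proof.
  intros Hk.
  assert (Low : forall n d2, (n < k)%nat -> (forall i, i <> k -> d2 i = d i) ->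
    power_product d2 s n z = power_product d s n z /\
    power_product_derive d2 s n z = power_product_derive d s n z).
  { intros n d2 Hn E. unfold power_product. induction n as [|n IH]; simpl; [auto|].
    destruct (IH ltac:(lia)) as [A B]. rewrite A, B, E by lia.
    unfold power_product. rewrite A. auto. }
  induction N as [|N IH]; [lia|].
  destruct (PeanoNat.Nat.eq_dec k (S N)) as [->|Nk].
  - exists (power_product d s N z), (power_product_derive d s N z). intros d2 E.
    destruct (Low N d2 ltac:(lia) E) as [A B]. simpl. rewrite A, B. split; [|reflexivity].
    unfold power_product in *; simpl. now rewrite A.
  - destruct (IH ltac:(lia)) as (g & g1 & HG).
    exists (g * Cpower (1 - d (S N) * z) (s (S N)))%C.
    exists (g1 * Cpower (1 - d (S N) * z) (s (S N)) + g * factor_derive (d (S N)) (s (S N)) z)%C.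
    intros d2 E. destruct (HG d2 E) as [A B].
    simpl. rewrite A, B, (E (S N)) by lia. unfold power_product in A |- *. simpl. 
    rewrite A, (E (S N)) by lia. split; ring.
Qed.

Lemma blaschke_difference (d z w : C) : (1 - d * z)%C <> 0%C -> (1 - d * w)%C <> 0%C ->
  (blaschke d z - blaschke d w = RtoC (1 - Cmod d * Cmod d) * (z - w) / ((1 - d * z) * (1 - d * w)))%C.
Proof.
  intros A B.
  assert (E : RtoC (1 - Cmod d * Cmod d) = (1 - d * Cconj d)%C).
  { rewrite Cmod_sqr. destruct d; unfold Cdot; apply injective_projections; simpl; ring. }
  rewrite E. unfold blaschke. field. now split.
Qed.

(** The inverse of [blaschke d] is [blaschke (- d)]. *)
Lemma blaschke_inverse (d u : C) : Cmod d < 1 -> Cmod u = 1 ->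
  exists w : C, Cmod w = 1 /\ blaschke d w = u.
Proof.
  intros Hd Hu. exists (blaschke (- d)%C u). split.
  { apply blaschke_unit; [now rewrite Cmod_opp|exact Hu]. }
  assert (N1 : (1 + d * u)%C <> 0%C).
  { replace (1 + d * u)%C with (1 - - d * u)%C by ring. apply one_minus_neq_0.
    rewrite Cmod_mult, Cmod_opp, Hu. lra. }
  assert (N2 : (1 - d * Cconj d)%C <> 0%C).
  { apply one_minus_neq_0. rewrite Cmod_mult, Cmod_conj. assert (D0 := Cmod_ge_0 d). nra. }
  unfold blaschke. rewrite Copp_conj.
  assert (N3 : (1 - - d * u)%C <> 0%C) by (replace (1 - - d * u)%C with (1 + d * u)%C by ring; exact N1).
  assert (N4 : (1 - d * ((u - - Cconj d) / (1 - - d * u)))%C = ((1 - d * Cconj d) / (1 + d * u))%C).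
  { field. repeat split; auto. }
  rewrite N4. field. repeat split; auto.
Qed.

Lemma unit_sum_lt (u v : C) : Cmod u = 1 -> Cmod v = 1 -> u <> v -> Cmod (u + v)%C < 2.
Proof.
  intros Hu Hv N.
  assert (N2 : (u - v)%C <> 0%C).
  { intros E; apply N. replace u with (u - v + v)%C by ring. rewrite E; ring. }
  apply Cmod_gt_0 in N2.
  assert (A := Cmod_sqr (u + v)%C). assert (B := Cmod_sqr (u - v)%C).
  assert (A1 := Cmod_sqr u). assert (B1 := Cmod_sqr v). rewrite Hu in A1. rewrite Hv in B1.
  unfold Cdot in *; simpl in *. assert (P := Cmod_ge_0 (u + v)%C). nra.
Qed.

(* Moving the zero [1 / d] to the circle so that its modulus ratio to the old factor is
   uniquely maximal at [z1]: take [w] with [blaschke d w = - blaschke d z1]. *)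
Lemma extremal_pole (d z1 : C) : Cmod d < 1 -> Cmod z1 = 1 ->
  exists d' : C, Cmod d' = 1 /\ (1 - d' * z1)%C <> 0%C /\
    forall z : C, Cmod z = 1 -> z <> z1 ->
      Cmod (1 - d' * z)%C * Cmod (1 - d * z1)%C < Cmod (1 - d' * z1)%C * Cmod (1 - d * z)%C.
Proof.
  intros Hd Hz1.
  assert (U1 := blaschke_unit d z1 Hd Hz1).
  destruct (blaschke_inverse d (- blaschke d z1)%C Hd) as (w & Hw & Ew).
  { now rewrite Cmod_opp. }
  assert (Nw : w <> 0%C) by (intros ->; rewrite Cmod_0 in Hw; lra).
  assert (Nd : forall z, Cmod z = 1 -> (1 - d * z)%C <> 0%C).
  { intros z Hz. apply one_minus_neq_0. rewrite Cmod_mult, Hz. lra. }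
  assert (D0 := Cmod_ge_0 d).
  assert (W := proj1 (Cmod_gt_0 _) (Nd w Hw)).
  set (K := Cmod (1 - d * w)%C / (1 - Cmod d * Cmod d)).
  assert (KP : 0 < K) by (apply Rdiv_lt_0_compat; nra).
  (* The modulus ratio of new to old factor is thus [K |B z + B z1|] with both Blaschke values
     unimodular: at most [2 * K], and equal to it only when [B z = B z1], that is [z = z1]. *)
  assert (Ratio : forall z, Cmod z = 1 ->
     Cmod (1 - / w * z)%C = K * Cmod (blaschke d z + blaschke d z1)%C * Cmod (1 - d * z)%C).
  { intros z Hz. replace (blaschke d z + blaschke d z1)%C with (blaschke d z - blaschke d w)%C
      by (rewrite Ew; ring).
    rewrite blaschke_difference by auto.
    assert (Z := proj1 (Cmod_gt_0 _) (Nd z Hz)).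
    rewrite Cmod_div, !Cmod_mult, Cmod_R by (apply Cmult_neq_0; auto).
    rewrite Rabs_right by nra.
    replace (1 - / w * z)%C with (- (/ w) * (z - w))%C by (field; exact Nw).
    rewrite Cmod_mult, Cmod_opp, Cmod_inv, Hw by exact Nw.
    unfold K. field. repeat split; nra. }
  assert (E2 : Cmod (blaschke d z1 + blaschke d z1)%C = 2).
  { replace (blaschke d z1 + blaschke d z1)%C with (2 * blaschke d z1)%C by ring.
    rewrite Cmod_mult, U1, Cmod_R, Rabs_right; lra. }
  assert (Z1 := proj1 (Cmod_gt_0 _) (Nd z1 Hz1)).
  exists (/ w)%C. repeat split.
  - rewrite Cmod_inv, Hw by exact Nw. field.
  - apply Cmod_gt_0. rewrite (Ratio z1 Hz1), E2. nra.
  - intros z Hz Nz. rewrite (Ratio z Hz), (Ratio z1 Hz1), E2.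
    assert (Z := proj1 (Cmod_gt_0 _) (Nd z Hz)).
    assert (L : Cmod (blaschke d z + blaschke d z1)%C < 2).
    { apply unit_sum_lt; [now apply blaschke_unit|exact U1|].
      intros E. assert (Q := blaschke_difference d z z1 (Nd z Hz) (Nd z1 Hz1)).
      rewrite E in Q. apply (f_equal Cmod) in Q.
      replace (blaschke d z1 - blaschke d z1)%C with (RtoC 0) in Q by ring.
      rewrite Cmod_div, !Cmod_mult, !Cmod_R in Q by (apply Cmult_neq_0; auto).
      rewrite Rabs_R0, Rabs_right in Q by nra.
      assert (P : 0 < Cmod (z - z1)%C).
      { apply Cmod_gt_0. intros E3. apply Nz. replace z with (z - z1 + z1)%C by ring. rewrite E3; ring. }
      assert (0 < (1 - Cmod d * Cmod d) * Cmod (z - z1)%C / (Cmod (1 - d * z)%C * Cmod (1 - d * z1)%C)).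
      { apply Rdiv_lt_0_compat; apply Rmult_lt_0_compat; auto. nra. }
      lra. }
    replace (K * 2 * Cmod (1 - d * z1)%C * Cmod (1 - d * z)%C)
      with (2 * (K * Cmod (1 - d * z)%C * Cmod (1 - d * z1)%C)) by ring.
    replace (K * Cmod (blaschke d z + blaschke d z1)%C * Cmod (1 - d * z)%C * Cmod (1 - d * z1)%C)
      with (Cmod (blaschke d z + blaschke d z1)%C * (K * Cmod (1 - d * z)%C * Cmod (1 - d * z1)%C)) by ring.
    apply Rmult_lt_compat_r; [|exact L].
    apply Rmult_lt_0_compat; [now apply Rmult_lt_0_compat|exact Z1].
Qed.

Lemma Cmod_Cpower_ratio (w w' : C) (s : R) : w <> 0%C -> w' <> 0%C ->
  Cmod (Cpower w' s) = Cmod (Cpower w s) * exp (s * ln (Cmod w' / Cmod w)).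
Proof.
  intros N N'. rewrite !Cmod_Cpower by assumption.
  rewrite <- exp_plus. f_equal. apply Cmod_gt_0 in N. apply Cmod_gt_0 in N'.
  rewrite ln_div by assumption. ring.
Qed.

(** Where the product is nonzero, [|q| < |n - q|]. At a zero on the circle, equality is refuted by
    replacing [d k] with the pole of [extremal_pole]: the derivative at [z1] grows by exactly
    [rho z1 ^ s_k], the maximum of the product by strictly less, against [derivative_bound] for the
    new product. *)
Theorem derivative_bound_strict (M : R) (d : nat -> C) (s : nat -> R) (N k : nat) (z1 : C) :
  admissible N d s -> 0 < M -> (forall y, Cmod (power_product d s N (circ y)) <= M) ->
  (1 <= k <= N)%nat -> Cmod (d k) < 1 -> Cmod z1 = 1 ->
  Cmod (power_product_derive d s N z1) < Rsum s N / 2 * M.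
Proof.
  intros HA HM Hb Hk Dk Hz1.
  assert (Hn : 0 < Rsum s N).
  { apply Rsum_pos with k; [|exact Hk|].
    - intros i Hi. destruct (HA i Hi) as (_ & S1 & _). lra.
    - destruct (HA k Hk) as (_ & S1 & _). lra. }
  destruct (circ_surjective z1 Hz1) as (x1 & _ & Ex1).
  destruct (Ceq_dec (power_product d s N z1) 0%C) as [Z|Z].
  2:{ rewrite (Cmod_power_product_derive _ _ _ _ HA Hz1 Z).
      assert (P := power_product_factors_pos _ _ _ _ HA (Req_le _ _ Hz1) Z).
      assert (C1 := Cmod_lt_reflected _ _ Hn (deficit_pos d s N k z1 HA Hz1 (factors_neq_0 _ _ _ P) Hk Dk)).
      rewrite Ex1 in *. assert (B := derivative_sum_bound M x1 d s N HA HM Hb Z).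
      apply Cmod_gt_0 in Z. nra. }
  assert (LE : Cmod (power_product_derive d s N z1) <= Rsum s N / 2 * M)
    by (rewrite Ex1; now apply derivative_bound).
  destruct LE as [LT|EQ]; [exact LT|exfalso].
  destruct (HA k Hk) as (_ & S1 & _).
  destruct (extremal_pole (d k) z1 Dk Hz1) as (d' & Hd' & Nd' & Ext).
  set (d2 := fun i => if PeanoNat.Nat.eq_dec i k then d' else d i).
  assert (E2 : forall i, i <> k -> d2 i = d i).
  { intros i Hi. unfold d2. destruct PeanoNat.Nat.eq_dec; tauto. }
  assert (E2k : d2 k = d') by (unfold d2; destruct PeanoNat.Nat.eq_dec; tauto).
  assert (HA2 : admissible N d2 s).
  { intros i Hi. unfold d2. destruct PeanoNat.Nat.eq_dec as [->|_].
    - repeat split; lra.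
    - now apply HA. }
  assert (Nd : forall z, Cmod z = 1 -> (1 - d k * z)%C <> 0%C).
  { intros z Hz. apply one_minus_neq_0. rewrite Cmod_mult, Hz. lra. }
  destruct (power_product_split d s N k z1 Hk) as (g & g1 & HG).
  destruct (HG d (fun _ _ => eq_refl)) as [A1 B1]. destruct (HG d2 E2) as [A2 B2].
  (* The [k]-th factor does not vanish at [z1], so the cofactor does. The derivative at [z1] is then
     [g1] times the [k]-th power and scales like that power. *)
  assert (g0 : g = 0%C).
  { rewrite Z in A1. destruct (Ceq_dec g 0%C) as [->|Ng]; [reflexivity|exfalso].
    apply (Cmult_neq_0 g (Cpower (1 - d k * z1)%C (s k)) Ng); [|now symmetry].
    apply Cpower_neq_0. auto. }
  rewrite g0 in A2, B1, B2. rewrite E2k in A2, B2.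
  replace (g1 * Cpower (1 - d k * z1) (s k) + 0 * factor_derive (d k) (s k) z1)%C
    with (g1 * Cpower (1 - d k * z1) (s k))%C in B1 by ring.
  replace (g1 * Cpower (1 - d' * z1) (s k) + 0 * factor_derive d' (s k) z1)%C
    with (g1 * Cpower (1 - d' * z1) (s k))%C in B2 by ring.
  set (rho := fun z => Cmod (1 - d' * z)%C / Cmod (1 - d k * z)%C).
  assert (D1 : Cmod (power_product_derive d2 s N z1) = Rsum s N / 2 * M * exp (s k * ln (rho z1))).
  { rewrite B2, Cmod_mult, (Cmod_Cpower_ratio _ _ (s k) (Nd z1 Hz1) Nd').
    fold (rho z1). rewrite <- EQ, B1, Cmod_mult. ring. }
  destruct (circle_max _ (fun x => circle_continuous N d2 s x HA2)) as (x2 & Hx2).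
  set (M2 := Cmod (power_product d2 s N (circ x2))) in *.
  assert (M2P : 0 < M2).
  { destruct (circle_nonzero N d2 s HA2) as [y Hy]. apply Cmod_gt_0 in Hy.
    assert (Q := Hx2 (circ y) (Cmod_circ y)). lra. }
  assert (D2 : Cmod (power_product_derive d2 s N z1) <= Rsum s N / 2 * M2).
  { rewrite Ex1. apply derivative_bound; [exact HA2|exact M2P|].
    intros y. apply Hx2, Cmod_circ. }
  (* The new product still vanishes at [z1], so its maximum is attained elsewhere, where the ratio
     [rho] is strictly below [rho z1]. *)
  assert (Lt : M2 < M * exp (s k * ln (rho z1))).
  { assert (N12 : circ x2 <> z1).
    { intros E. unfold M2 in M2P. rewrite E, A2, Cmult_0_l, Cmod_0 in M2P. lra. }
    destruct (power_product_split d s N k (circ x2) Hk) as (h & h1 & HH).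
    destruct (HH d (fun _ _ => eq_refl)) as [A3 _]. destruct (HH d2 E2) as [A4 _].
    rewrite E2k in A4.
    assert (Nz : (1 - d' * circ x2)%C <> 0%C).
    { intros E. unfold M2 in M2P. rewrite A4, E, Cpower_0_l, Cmult_0_r, Cmod_0 in M2P by lra. lra. }
    assert (Em : M2 = Cmod (power_product d s N (circ x2)) * exp (s k * ln (rho (circ x2)))).
    { unfold M2. rewrite A4, A3, !Cmod_mult,
        (Cmod_Cpower_ratio _ _ (s k) (Nd _ (Cmod_circ x2)) Nz). unfold rho. ring. }
    assert (R1 := proj1 (Cmod_gt_0 _) (Nd z1 Hz1)).
    assert (R2 := proj1 (Cmod_gt_0 _) (Nd _ (Cmod_circ x2))).
    assert (R3 := proj1 (Cmod_gt_0 _) Nz).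
    assert (X := Ext (circ x2) (Cmod_circ x2) N12).
    assert (Rl : rho (circ x2) < rho z1).
    { unfold rho. apply Rmult_lt_reg_r with (Cmod (1 - d k * z1)%C * Cmod (1 - d k * circ x2)%C);
        [now apply Rmult_lt_0_compat|].
      replace (Cmod (1 - d' * circ x2)%C / Cmod (1 - d k * circ x2)%C *
        (Cmod (1 - d k * z1)%C * Cmod (1 - d k * circ x2)%C))
        with (Cmod (1 - d' * circ x2)%C * Cmod (1 - d k * z1)%C) by (field; lra).
      replace (Cmod (1 - d' * z1)%C / Cmod (1 - d k * z1)%C *
        (Cmod (1 - d k * z1)%C * Cmod (1 - d k * circ x2)%C))
        with (Cmod (1 - d' * z1)%C * Cmod (1 - d k * circ x2)%C) by (field; lra).
      exact X. }
    assert (Rp : 0 < rho (circ x2)) by (now apply Rdiv_lt_0_compat).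
    assert (Ex : exp (s k * ln (rho (circ x2))) < exp (s k * ln (rho z1))).
    { apply exp_increasing, Rmult_lt_compat_l; [lra|]. now apply ln_increasing. }
    rewrite Em. assert (Hb2 := Hb x2). assert (Ep := exp_pos (s k * ln (rho (circ x2)))).
    eapply Rle_lt_trans; [apply Rmult_le_compat_r; [lra|exact Hb2]|].
    now apply Rmult_lt_compat_l. }
  rewrite D1 in D2. nra.
Qed.

(** With all zeros on the circle the Poisson kernels vanish and [Re q = n / 2], so [|q| >= n / 2];
    this is used where the product attains its maximum. *)
Theorem derivative_attained (M : R) (d : nat -> C) (s : nat -> R) (N : nat) (z : C) :
  admissible N d s -> 0 < M -> Cmod z = 1 -> Cmod (power_product d s N z) = M ->
  (forall k, (1 <= k <= N)%nat -> Cmod (d k) = 1) ->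
  Rsum s N / 2 * M <= Cmod (power_product_derive d s N z).
Proof.
  intros HA HM Hz E HD.
  assert (Nz : power_product d s N z <> 0%C) by (intros Z; rewrite Z, Cmod_0 in E; lra).
  rewrite (Cmod_power_product_derive _ _ _ _ HA Hz Nz), E.
  assert (P := power_product_factors_pos _ _ _ _ HA (Req_le _ _ Hz) Nz).
  assert (Q := deficit_zero d s N z Hz (factors_neq_0 _ _ _ P) HD).
  assert (R1 := re_le_Cmod (log_derivative d s N z)). unfold Re in R1.
  assert (R2 := Rle_abs (fst (log_derivative d s N z))). nra.
Qed.

(** * From the analytic function to the explicit product *)

Definition unit_disk (z : C) : Prop := Cmod z < 1.

Lemma component_le_Cmod (z : C) : Rabs (fst z) <= Cmod z /\ Rabs (snd z) <= Cmod z.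
Proof.
  assert (Q := Rmax_Cmod z). split.
  - eapply Rle_trans; [apply Rmax_l|exact Q].
  - eapply Rle_trans; [apply Rmax_r|exact Q].
Qed.

Lemma hol_derive_of_is_derive (f : C -> C) (z l : C) :
  @is_derive C_AbsRing C_NormedModule f z l -> hol_derive f z l.
Proof.
  intros [_ H] e.
  assert (Hz : is_filter_lim (locally (T := AbsRing_UniformSpace C_AbsRing) z) z)
    by (intros P HP; exact HP).
  specialize (H z Hz).
  assert (K : forall eps : posreal, exists d : posreal, forall x : R, x <> 0 -> Rabs x < d ->
     Cmod ((f (z + RtoC x * e)%C - f z) - RtoC x * (e * l))%C <= eps * Rabs x).
  { intros eps. assert (E1 : 0 < eps / (1 + Cmod e)).
    { apply Rdiv_lt_0_compat; [apply cond_pos|]. assert (A := Cmod_ge_0 e). lra. }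
    destruct (H (mkposreal _ E1)) as [d Hd].
    assert (D1 : 0 < d / (1 + Cmod e)).
    { apply Rdiv_lt_0_compat; [apply cond_pos|]. assert (A := Cmod_ge_0 e). lra. }
    exists (mkposreal _ D1). intros x Nx Hx. simpl in Hx. assert (A := Cmod_ge_0 e).
    assert (Em : minus (z + RtoC x * e)%C z = (RtoC x * e)%C).
    { unfold minus, plus, opp; simpl. ring. }
    assert (Bl : Cmod (RtoC x * e)%C < d).
    { rewrite Cmod_mult, Cmod_R. apply Rmult_lt_compat_r with (r := 1 + Cmod e) in Hx; [|lra].
      replace (d / (1 + Cmod e) * (1 + Cmod e)) with (pos d) in Hx by (field; lra).
      assert (0 <= Rabs x) by apply Rabs_pos. nra. }
    specialize (Hd (z + RtoC x * e)%C).
    assert (Q : @norm C_AbsRing C_NormedModule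
       (minus (minus (f (z + RtoC x * e)%C) (f z)) (scal (minus (z + RtoC x * e)%C z) l))
       <= eps / (1 + Cmod e) * Cmod (minus (z + RtoC x * e)%C z)).
    { apply Hd. change (Cmod (z + RtoC x * e + - z)%C < d).
      replace (z + RtoC x * e + - z)%C with (RtoC x * e)%C by ring. exact Bl. }
    rewrite Em in Q.
    change (Cmod ((f (z + RtoC x * e) + - f z) + - ((RtoC x * e) * l))%C
      <= eps / (1 + Cmod e) * Cmod (RtoC x * e)%C) in Q.
    replace ((f (z + RtoC x * e)%C - f z) - RtoC x * (e * l))%C
      with ((f (z + RtoC x * e) + - f z) + - ((RtoC x * e) * l))%C by ring.
    eapply Rle_trans; [exact Q|]. rewrite Cmod_mult, Cmod_R.
    replace (eps / (1 + Cmod e) * (Rabs x * Cmod e)) with (eps * Rabs x * (Cmod e / (1 + Cmod e)))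
      by (field; lra).
    rewrite <- (Rmult_1_r (eps * Rabs x)) at 2. apply Rmult_le_compat_l.
    - apply Rmult_le_pos; [left; apply cond_pos|apply Rabs_pos].
    - apply Rmult_le_reg_r with (1 + Cmod e); [lra|].
      replace (Cmod e / (1 + Cmod e) * (1 + Cmod e)) with (Cmod e) by (field; lra). lra. }
  assert (Comp : forall p : C -> R, (forall u v, p (u - v)%C = p u - p v) ->
    (forall (x : R) u, p (RtoC x * u)%C = x * p u) -> (forall u, Rabs (p u) <= Cmod u) ->
    is_derive (fun x => p (f (z + RtoC x * e)%C)) 0 (p (e * l)%C)).
  { intros p Psub Pscal Ple. apply is_derive_Reals. intros eps He.
    assert (e2 : 0 < eps / 2) by lra. destruct (K (mkposreal _ e2)) as [d Hd]. exists d.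
    intros x Nx Hx. rewrite Rplus_0_l, line_at_0.
    specialize (Hd x Nx Hx). simpl pos in Hd.
    assert (Q := Ple ((f (z + RtoC x * e)%C - f z) - RtoC x * (e * l))%C).
    rewrite !Psub, Pscal in Q. assert (P : 0 < Rabs x) by now apply Rabs_pos_lt.
    replace ((p (f (z + RtoC x * e)%C) - p (f z)) / x - p (e * l)%C)
      with ((p (f (z + RtoC x * e)%C) - p (f z) - x * p (e * l)%C) / x) by (field; exact Nx).
    unfold Rdiv. rewrite Rabs_mult, Rabs_inv.
    apply Rmult_lt_reg_r with (Rabs x); [exact P|].
    rewrite Rmult_assoc, Rinv_l by lra. nra. }
  split; (apply Comp; [intros; simpl; ring|intros; simpl; ring|apply component_le_Cmod]).
Qed.

Lemma filterlim_line (z e : C) (x : R) :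
  filterlim (fun y => z + RtoC y * e)%C (locally x) (locally (z + RtoC x * e)%C).
Proof. exact (curve_derive_continuous _ _ _ (curve_derive_line z e x)). Qed.

Lemma unit_disk_line (z e : C) : unit_disk z -> locally 0 (fun x => unit_disk (z + RtoC x * e)%C).
Proof.
  intros H. unfold unit_disk in *.
  assert (L := filterlim_Cmod _ _ _ (filterlim_line z e 0)). rewrite line_at_0 in L.
  assert (P : 0 < 1 - Cmod z) by lra.
  generalize (proj1 (filterlim_locally _ _) L (mkposreal _ P)). apply filter_imp.
  intros x Hx. apply ball_Rabs_lt, Rabs_lt_between in Hx. simpl in Hx. lra.
Qed.

Lemma curve_derive_unique (g : R -> C) (x : R) (v w : C) :
  curve_derive g x v -> curve_derive g x w -> v = w.
Proof.
  intros [A1 A2] [B1 B2]. apply injective_projections.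
  - rewrite <- (is_derive_unique _ _ _ A1). now apply is_derive_unique.
  - rewrite <- (is_derive_unique _ _ _ A2). now apply is_derive_unique.
Qed.

Lemma hol_derive_unique (f : C -> C) (z v w : C) : hol_derive f z v -> hol_derive f z w -> v = w.
Proof.
  intros A B. assert (E := curve_derive_unique _ _ _ _ (A 1%C) (B 1%C)).
  now rewrite !Cmult_1_l in E.
Qed.

Lemma hol_derive_ext_disk (f g : C -> C) (z v : C) :
  (forall w, unit_disk w -> f w = g w) -> unit_disk z -> hol_derive f z v -> hol_derive g z v.
Proof.
  intros E Hz H e. eapply curve_derive_ext_loc, H.
  generalize (unit_disk_line z e Hz). apply filter_imp. intros x Hx. now apply E.
Qed.

Lemma hol_derive_Cpower (d : C) (s : R) (z : C) : Cmod d <= 1 -> unit_disk z ->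
  hol_derive (fun w => Cpower (1 - d * w) s) z (factor_derive d s z).
Proof.
  intros Hd Hz.
  assert (Nz : forall w, unit_disk w -> (1 - d * w)%C <> 0%C).
  { intros w Hw. apply one_minus_neq_0. rewrite Cmod_mult. unfold unit_disk in Hw.
    assert (A := Cmod_ge_0 d). assert (B := Cmod_ge_0 w). nra. }
  assert (P : 0 < fst (1 - d * z)%C).
  { apply Re_lt_1_of_unit_disk; [|auto]. apply factor_Cmod_le_1; [exact Hd|]. unfold unit_disk in Hz; lra. }
  apply hol_derive_ext_disk with (fun w => Cexp (RtoC s * Clog (1 - d * w))%C).
  - intros w Hw. symmetry. apply Cpower_neq_0_eq. auto.
  - exact Hz.
  - eapply hol_derive_value.
    + apply hol_derive_exp, hol_derive_mult; [apply (hol_derive_const s)|].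
      apply hol_derive_log; [|exact P].
      apply hol_derive_plus; [apply (hol_derive_const 1)|].
      apply hol_derive_opp, hol_derive_mult; [apply (hol_derive_const d)|apply hol_derive_id].
    + cbv beta. rewrite <- Cpower_neq_0_eq by auto. unfold factor_derive.
      destruct (Cpower_pred _ s (Nz z Hz)) as [E|E]; [|lra].
      rewrite <- E. field. auto.
Qed.

Lemma hol_derive_power_product (N : nat) (d : nat -> C) (s : nat -> R) (z : C) :
  admissible N d s -> unit_disk z -> hol_derive (power_product d s N) z (power_product_derive d s N z).
Proof.
  intros HA Hz. induction N as [|N IH].
  - apply (hol_derive_const 1).
  - destruct (HA (S N)) as (D & S1 & _); [lia|].
    apply (hol_derive_mult (power_product d s N) (fun w => Cpower (1 - d (S N) * w) (s (S N)))).
    + apply IH. intros k Hk. apply HA; lia.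
    + now apply hol_derive_Cpower.
Qed.

Lemma Cdot_zero_both (u v : C) : u <> 0%C -> Cdot u v = 0 -> Cdot u (Ci * v)%C = 0 -> v = 0%C.
Proof.
  intros Nu A B. apply Cmod_gt_0 in Nu. assert (U := Cmod_sqr u).
  destruct u as [u1 u2], v as [v1 v2]; unfold Cdot in *; simpl in *.
  assert (E : (u1 * u1 + u2 * u2) * (v1 * v1 + v2 * v2) = 0).
  { transitivity ((u1 * v1 + u2 * v2) * (u1 * v1 + u2 * v2)
      + (u1 * (0 * v1 - 1 * v2) + u2 * (0 * v2 + 1 * v1)) * (u1 * (0 * v1 - 1 * v2) + u2 * (0 * v2 + 1 * v1)));
      [ring|rewrite A, B; ring]. }
  apply Rmult_integral in E. destruct E as [E|E]; [nra|].
  apply injective_projections; simpl; nra.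
Qed.

(** Differentiating [|q|^2] along a line makes [e * v] orthogonal to [q z]; the directions [1] and
    [Ci] together leave only 0. *)
Lemma constant_modulus_derive (q : C -> C) (z v : C) (c1 : R) :
  (forall w, unit_disk w -> Cmod (q w) = c1) -> 0 < c1 -> unit_disk z -> hol_derive q z v -> v = 0%C.
Proof.
  intros H Hc Hz D.
  assert (Nq : q z <> 0%C) by (apply Cmod_gt_0; rewrite H; assumption).
  assert (K : forall e, Cdot (q z) (e * v)%C = 0).
  { intros e. assert (A := is_derive_Cdot _ _ _ _ _ (D e) (D e)). cbv beta in A.
    rewrite line_at_0 in A.
    assert (B : is_derive (fun y => Cdot (q (z + RtoC y * e)%C) (q (z + RtoC y * e)%C)) 0 0).
    { apply is_derive_ext_loc with (fun _ => c1 * c1).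
      - generalize (unit_disk_line z e Hz). apply filter_imp. intros x Hx.
        rewrite <- Cmod_sqr, H by exact Hx. reflexivity.
      - apply (is_derive_const (K := R_AbsRing) (V := R_NormedModule)). }
    apply is_derive_unique in A. apply is_derive_unique in B. rewrite A in B.
    assert (Sy : Cdot (e * v)%C (q z) = Cdot (q z) (e * v)%C) by (unfold Cdot; ring). lra. }
  apply Cdot_zero_both with (q z); auto.
  specialize (K 1%C). now rewrite Cmult_1_l in K.
Qed.

Lemma zero_derive_constant (q : C -> C) :
  (forall z, unit_disk z -> hol_derive q z 0%C) -> forall z, unit_disk z -> q z = q 0%C.
Proof.
  intros H z Hz.
  assert (D : forall x, 0 <= x <= 1 -> curve_derive (fun y => q (0 + RtoC y * z)%C) x 0%C).
  { intros x Hx. eapply curve_derive_value.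
    - apply (hol_derive_line q (fun _ => 0%C)). apply H. unfold unit_disk in *.
      rewrite Cplus_0_l, Cmod_mult, Cmod_R, Rabs_right by lra. assert (A := Cmod_ge_0 z). nra.
    - ring. }
  replace z with (0 + RtoC 1 * z)%C at 1 by ring.
  replace (q 0%C) with (q (0 + RtoC 0 * z)%C) by (f_equal; ring).
  apply injective_projections.
  - destruct (MVT_cor2 (fun y => fst (q (0 + RtoC y * z)%C)) (fun _ => 0) 0 1) as (c & E & _); [lra| |lra].
    intros x Hx. apply is_derive_Reals. apply (D x Hx).
  - destruct (MVT_cor2 (fun y => snd (q (0 + RtoC y * z)%C)) (fun _ => 0) 0 1) as (c & E & _); [lra| |lra].
    intros x Hx. apply is_derive_Reals. apply (D x Hx).
Qed.

(** * Boundary values, norms and identification of the function *)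

Lemma within_disk_proper (z : C) : Cmod z = 1 ->
  ProperFilter (within unit_disk (locally z)).
Proof.
  intros Hz. constructor; [|apply within_filter, locally_filter].
  intros P H. unfold within in H.
  assert (L := filterlim_line z (- z)%C 0). rewrite line_at_0 in L.
  destruct (L _ H) as [e He].
  set (x := Rmin (e / 2) (1 / 2)). assert (ep := cond_pos e).
  assert (x0 : 0 < x) by (unfold x; apply Rmin_case; lra).
  assert (x1 : x <= e / 2) by apply Rmin_l. assert (x2 : x <= 1 / 2) by apply Rmin_r.
  exists (z + RtoC x * - z)%C. apply He.
  - apply Rabs_lt_ball. rewrite Rabs_right; lra.
  - unfold unit_disk. replace (z + RtoC x * - z)%C with (RtoC (1 - x) * z)%C by (rewrite RtoC_minus; ring).
    rewrite Cmod_mult, Hz, Cmod_R, Rabs_right; lra.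
Qed.

(** [lim] is specified only through completeness: for a Cauchy filter it is a limit. A convergent
    filter is Cauchy, and uniqueness of limits identifies the value. *)
Lemma disk_ext_eq (g : C -> C) (z l : C) : Cmod z = 1 ->
  filterlim g (within unit_disk (locally z)) (locally l) -> disk_ext g z = l.
Proof.
  intros Hz H. unfold disk_ext.
  assert (PF := within_disk_proper z Hz).
  set (F := filtermap g (within (fun w => Cmod w < 1) (locally z))).
  assert (PF2 : ProperFilter F) by (apply filtermap_proper_filter; exact PF).
  assert (FL : is_filter_lim (T := C_UniformSpace) F l).
  { intros P HP. exact (H P HP). }
  apply (is_filter_lim_unique (K := C_AbsRing) (V := C_NormedModule) (F := F)).
  - intros P [e He].
    assert (Q := complete_cauchy (T := C_CompleteNormedModule) F PF2).
    assert (Cy : cauchy (T := C_UniformSpace) F).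
    { intros eps. exists l. apply FL. now exists eps. }
    specialize (Q Cy e). unfold F in *. revert Q. apply filter_imp. exact He.
  - exact FL.
Qed.

Lemma circle_norm_eq (g h : C -> C) (x1 : R) :
  (forall z, Cmod z = 1 -> disk_ext g z = h z) ->
  (forall z, Cmod z = 1 -> Cmod (h z) <= Cmod (h (circ x1))) ->
  circle_norm g = Cmod (h (circ x1)).
Proof.
  intros E M. unfold circle_norm.
  rewrite (is_lub_Rbar_unique _ (Finite (Cmod (h (circ x1))))); [reflexivity|]. split.
  - intros r (z & Hz & ->). rewrite E by exact Hz. now apply M.
  - intros b Hb. apply Hb. exists (circ x1). split; [apply Cmod_circ|].
    now rewrite E by apply Cmod_circ.
Qed.

Lemma prod_n_m_Cprod (v : nat -> C) (N : nat) : prod_n_m v 1 N = Cprod v N.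
Proof.
  induction N as [|N IH]; [reflexivity|].
  unfold prod_n_m in *. rewrite (Iter.iter_nat_Chasles _ _) with (m := N).
  - rewrite IH, Iter.iter_nat_point; [reflexivity|intros; ring].
  - intros; ring.
  - intros; ring.
  - lia.
  - lia.
Qed.

Lemma sum_n_m_Rsum (s : nat -> R) (N : nat) : sum_n_m s 1 N = Rsum s N.
Proof.
  induction N as [|N IH]; [rewrite sum_n_m_zero; [reflexivity|lia]|].
  rewrite sum_n_Sm by lia. rewrite IH. reflexivity.
Qed.

Lemma Cmod_power_value (w : C) (s : R) (v : C) : is_power_value w s v ->
  w <> 0%C /\ Cmod v = exp (s * ln (Cmod w)).
Proof.
  intros (l & <- & ->). split; [apply Cexp_neq_0|].
  rewrite !Cmod_Cexp, ln_exp. f_equal. simpl. ring.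
Qed.

Fixpoint Rprod (u : nat -> R) (N : nat) : R :=
  match N with O => 1 | S n => Rprod u n * u (S n) end.

Lemma Cmod_Cprod_scaled (u v : nat -> C) (t : nat -> R) (N : nat) :
  (forall k, (1 <= k <= N)%nat -> Cmod (u k) = t k * Cmod (v k)) ->
  Cmod (Cprod u N) = Rprod t N * Cmod (Cprod v N).
Proof.
  induction N as [|N IH]; intros H; simpl.
  - ring.
  - rewrite !Cmod_mult, IH, (H (S N)); [ring|lia|intros; apply H; lia].
Qed.

Lemma Rprod_pos (t : nat -> R) (N : nat) :
  (forall k, (1 <= k <= N)%nat -> 0 < t k) -> 0 < Rprod t N.
Proof.
  induction N as [|N IH]; intros H; simpl; [lra|].
  apply Rmult_lt_0_compat; [apply IH; intros; apply H; lia|apply H; lia].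
Qed.

(** No branch is tracked. The pointwise choice of powers determines [|f|], a constant multiple of
    [|G|]; so [f / G] is differentiable with constant modulus on the disk, hence constant. *)
Lemma analytic_power_product_eq (N : nat) (c : C) (a : nat -> C) (s : nat -> R) (f : C -> C) :
  c <> 0%C -> (forall k, (1 <= k <= N)%nat -> 1 <= Cmod (a k)) ->
  admissible N (fun k => / a k)%C s ->
  is_analytic_power_product N c a s f ->
  exists C1 : C, C1 <> 0%C /\
    (forall z, unit_disk z -> f z = (C1 * power_product (fun k => / a k) s N z)%C) /\
    (forall z, unit_disk z -> C_derive f z = (C1 * power_product_derive (fun k => / a k) s N z)%C).
Proof.
  intros Hc Ha HA [Hd Hf].
  set (d := fun k => (/ a k)%C) in *.
  set (G := power_product d s N).
  assert (Na : forall k, (1 <= k <= N)%nat -> a k <> 0%C).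
  { intros k Hk E. specialize (Ha k Hk). rewrite E, Cmod_0 in Ha; lra. }
  assert (Nz : forall z k, unit_disk z -> (1 <= k <= N)%nat -> (1 - d k * z)%C <> 0%C).
  { intros z k Hz Hk. destruct (HA k Hk) as (D & _). apply one_minus_neq_0. rewrite Cmod_mult.
    unfold unit_disk in Hz. assert (A := Cmod_ge_0 (d k)). assert (B := Cmod_ge_0 z). nra. }
  assert (NG : forall z, unit_disk z -> G z <> 0%C).
  { intros z Hz. apply power_product_neq_0. intros k Hk; now apply Nz. }
  (* [t k] is [|a k| ^ s k], from [|z - a| = |a| |1 - z / a|]. *)
  set (t := fun k => exp (s k * ln (Cmod (a k)))).
  set (c1 := Cmod c * Rprod t N).
  assert (c1p : 0 < c1).
  { apply Rmult_lt_0_compat; [now apply Cmod_gt_0|]. apply Rprod_pos. intros; apply exp_pos. }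
  assert (Mod : forall z, unit_disk z -> Cmod (f z) = c1 * Cmod (G z)).
  { intros z Hz. destruct (Hf z Hz) as (v & Hv & Ef). rewrite Ef, Cmod_mult, prod_n_m_Cprod.
    unfold c1, G, power_product. rewrite Rmult_assoc. f_equal.
    apply Cmod_Cprod_scaled. intros k Hk.
    destruct (Cmod_power_value _ _ _ (Hv k Hk)) as [_ ->].
    rewrite Cmod_Cpower by now apply Nz. unfold t. rewrite <- exp_plus. f_equal.
    rewrite <- Rmult_plus_distr_l, <- ln_mult.
    - do 2 f_equal. rewrite <- Cmod_mult, <- Cmod_opp. f_equal. unfold d. field. now apply Na.
    - now apply Cmod_gt_0, Na.
    - now apply Cmod_gt_0, Nz. }
  set (q := fun z => (f z * / G z)%C).
  assert (Df : forall z, unit_disk z -> exists l, hol_derive f z l /\ C_derive f z = l).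
  { intros z Hz. destruct (Hd z Hz) as [l Hl]. exists l. split.
    - now apply hol_derive_of_is_derive.
    - now apply is_C_derive_unique. }
  assert (Dq : forall z, unit_disk z -> hol_derive q z 0%C).
  { intros z Hz. destruct (Df z Hz) as (l & Hl & _).
    assert (D := hol_derive_mult f (fun z => / G z)%C z _ _ Hl
      (hol_derive_inv G z _ (hol_derive_power_product N d s z HA Hz) (NG z Hz))).
    eapply hol_derive_value; [exact D|].
    apply (constant_modulus_derive q z _ c1); [|exact c1p|exact Hz|exact D].
    intros w Hw. unfold q. rewrite Cmod_mult, Cmod_inv, Mod by auto.
    assert (P := proj1 (Cmod_gt_0 _) (NG w Hw)). field. lra. }
  assert (D0 : unit_disk 0%C) by (unfold unit_disk; rewrite Cmod_0; lra).
  exists (q 0%C).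
  assert (Ef : forall z, unit_disk z -> f z = (q 0%C * G z)%C).
  { intros z Hz. rewrite <- (zero_derive_constant q Dq z Hz). unfold q. field. now apply NG. }
  split; [|split; [exact Ef|]].
  - apply Cmod_gt_0. unfold q. rewrite Cmod_mult, Cmod_inv, Mod by auto.
    assert (P := proj1 (Cmod_gt_0 _) (NG _ D0)).
    replace (c1 * Cmod (G 0%C) * / Cmod (G 0%C)) with c1 by (field; lra). exact c1p.
  - intros z Hz. destruct (Df z Hz) as (l & Hl & ->).
    apply (hol_derive_unique f z); [exact Hl|].
    apply hol_derive_ext_disk with (fun w => q 0%C * G w)%C; [|exact Hz|].
    + intros w Hw. symmetry. now apply Ef.
    + eapply hol_derive_value.
      * apply hol_derive_mult; [apply (hol_derive_const (q 0%C))|].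
        apply (hol_derive_power_product N d s z HA Hz).
      * cbv beta. ring.
Qed.

Lemma disk_ext_scaled (g h : C -> C) (C1 z : C) : Cmod z = 1 ->
  (forall w, unit_disk w -> g w = (C1 * h w)%C) ->
  filterlim h (within unit_disk (locally z)) (locally (h z)) ->
  disk_ext g z = (C1 * h z)%C.
Proof.
  intros Hz E H. apply disk_ext_eq; [exact Hz|].
  apply filterlim_within_ext with (fun w => C1 * h w)%C.
  - intros w Hw. symmetry. now apply E.
  - assert (PF := within_disk_proper z Hz).
    apply (filterlim_Cmult _); [apply filterlim_const|exact H].
Qed.

Theorem theorem5 (N : nat) (hN : (1 <= N)%nat)
  (c : C) (hc : c <> RtoC 0)
  (a : nat -> C) (ha : forall k : nat, (1 <= k <= N)%nat -> 1 <= Cmod (a k))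
  (s : nat -> R) (hs : forall k : nat, (1 <= k <= N)%nat -> 1 <= s k)
  (hsN : forall k : nat, (1 <= k <= N)%nat ->
           1 < Cmod (a k) -> exists n : nat, s k = INR n)
  (f : C -> C) (hf : is_analytic_power_product N c a s f) :
  circle_norm (C_derive f) <= sum_n_m s 1 N / 2 * circle_norm f /\
  (circle_norm (C_derive f) = sum_n_m s 1 N / 2 * circle_norm f <->
   forall k : nat, (1 <= k <= N)%nat -> Cmod (a k) = 1).
Proof.
  set (d := fun k => (/ a k)%C).
  assert (Na : forall k, (1 <= k <= N)%nat -> a k <> 0%C).
  { intros k Hk E. specialize (ha k Hk). rewrite E, Cmod_0 in ha; lra. }
  assert (Ed : forall k, (1 <= k <= N)%nat -> Cmod (d k) * Cmod (a k) = 1).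
  { intros k Hk. unfold d. rewrite Cmod_inv by now apply Na.
    assert (P := proj1 (Cmod_gt_0 _) (Na k Hk)). field. lra. }
  assert (HA : admissible N d s).
  { intros k Hk. specialize (Ed k Hk). specialize (ha k Hk).
    assert (A := Cmod_ge_0 (d k)). repeat split; [nra|now apply hs|].
    intros L. apply hsN; [exact Hk|]. nra. }
  destruct (analytic_power_product_eq N c a s f hc ha HA hf) as (C1 & NC & E0 & E1).
  fold d in E0, E1. rewrite sum_n_m_Rsum.
  assert (W : forall z, Cmod z = 1 -> filterlim (fun w => w) (within unit_disk (locally z)) (locally z)).
  { intros z _ P HP. apply (filter_le_within (F := locally z)). exact HP. }
  destruct (circle_max _ (fun x => circle_continuous N d s x HA)) as (x0 & X0).
  destruct (circle_max _ (fun x => circle_continuous_derive N d s x HA)) as (x1 & X1).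
  assert (Nf : circle_norm f = Cmod C1 * Cmod (power_product d s N (circ x0))).
  { rewrite <- Cmod_mult.
    apply (circle_norm_eq f (fun z => C1 * power_product d s N z)%C x0).
    - intros z Hz. apply disk_ext_scaled; auto.
      assert (PF := within_disk_proper z Hz).
      apply (filterlim_power_product _ N d s (fun w => w)); [exact HA|lra|now apply W].
    - intros z Hz. rewrite !Cmod_mult. apply Rmult_le_compat_l; [apply Cmod_ge_0|now apply X0]. }
  assert (Nf' : circle_norm (C_derive f) = Cmod C1 * Cmod (power_product_derive d s N (circ x1))).
  { rewrite <- Cmod_mult.
    apply (circle_norm_eq (C_derive f) (fun z => C1 * power_product_derive d s N z)%C x1).
    - intros z Hz. apply disk_ext_scaled; auto.
      assert (PF := within_disk_proper z Hz).
      apply (filterlim_power_product_derive _ N d s (fun w => w)); [exact HA|lra|now apply W].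
    - intros z Hz. rewrite !Cmod_mult. apply Rmult_le_compat_l; [apply Cmod_ge_0|now apply X1]. }
  set (M := Cmod (power_product d s N (circ x0))) in *.
  assert (MP : 0 < M).
  { destruct (circle_nonzero N d s HA) as [y Hy]. apply Cmod_gt_0 in Hy.
    assert (Q := X0 (circ y) (Cmod_circ y)). lra. }
  assert (Hb : forall y, Cmod (power_product d s N (circ y)) <= M) by (intros y; apply X0, Cmod_circ).
  assert (CP := proj1 (Cmod_gt_0 _) NC).
  assert (LE := derivative_bound M x1 d s N HA MP Hb).
  rewrite Nf, Nf'. split; [|split].
  - replace (Rsum s N / 2 * (Cmod C1 * M)) with (Cmod C1 * (Rsum s N / 2 * M)) by ring.
    apply Rmult_le_compat_l; lra.
  (* One zero off the circle makes the bound strict at every point of the circle, in particular at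
     [circ x1], where the derivative attains its norm. *)
  - intros E k Hk. destruct (ha k Hk) as [L|L]; [exfalso|now symmetry].
    assert (Dk : Cmod (d k) < 1).
    { specialize (Ed k Hk). assert (A := Cmod_ge_0 (d k)). nra. }
    assert (LT := derivative_bound_strict M d s N k (circ x1) HA MP Hb Hk Dk (Cmod_circ x1)).
    replace (Rsum s N / 2 * (Cmod C1 * M)) with (Cmod C1 * (Rsum s N / 2 * M)) in E by ring.
    apply Rmult_eq_reg_l in E; lra.
  (* The reverse inequality already holds at [circ x0], where the product attains its norm. *)
  - intros Hall.
    assert (Hd1 : forall k, (1 <= k <= N)%nat -> Cmod (d k) = 1).
    { intros k Hk. specialize (Ed k Hk). rewrite (Hall k Hk) in Ed. lra. }
    assert (GE := derivative_attained M d s N (circ x0) HA MP (Cmod_circ x0) eq_refl Hd1).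
    assert (Q := X1 (circ x0) (Cmod_circ x0)).
    assert (E : Cmod (power_product_derive d s N (circ x1)) = Rsum s N / 2 * M) by lra.
    rewrite E. ring.
Qed.
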